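(* Let $E$ be a finite graph without sinks or sources in which every cycle has an exit, let $k\ge 1$, and let $\mathcal{G}_0$ be the labeled graph with vertex set $E^{k-1}$ and no edges. Then $\Phi_1(0,\mathcal{G}_0)$ (the output of the recursion defined in the context) is the set of permutation graphs corresponding to all level-$k$ permutative automorphisms, i.e. $$\Phi_1(0,\mathcal{G}_0)=\{(E_\tau,\mathcal{L}_\tau) : \tau\in\mathrm{Perm}(E^k)\text{ endpoint-fixing and }\lambda_\tau\text{ an automorphism of }C^*(E)\}.$$
   Context: A graph means a directed multigraph $E=(E^0,E^1,r,s)$. $E^l$ is the set of paths of length $l$ (length-0 paths are vertices), $E^l_{u\to v}$ the paths with source $u$ and range $v$, $E^l_{u\to *}$ (resp. $E^l_{*\to v}$) the paths with source $u$ (resp. range $v$). A cycle $\mu$ has an exit if some $s(\mu_i)$ emits at least two edges. $C^*(E)$ is the universal $C^*$-algebra generated by mutually orthogonal projections $\{P_v\}_{v\in E^0}$ and partial isometries $\{S_e\}_{e\in E^1}$ with $S_e^*S_e=P_{r(e)}$, $S_e^*S_f=0$ for $e\ne f$, $S_eS_e^*\le P_{s(e)}$, and $P_v=\sum_{s(e)=v}S_eS_e^*$ for $v$ emitting a nonzero finite number of edges. $S_\mu=S_{\mu_1}\cdots S_{\mu_l}$ for a path $\mu$. $\tau\in\mathrm{Perm}(E^k)$ is endpoint-fixing if $\tau(E^k_{u\to v})=E^k_{u\to v}$ for all $u,v$; then $U_\tau=\sum_{\alpha\in E^k}S_{\tau(\alpha)}S_\alpha^*$ is unitary and $\lambda_\tau$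 is the unital $*$-endomorphism of $C^*(E)$ with $\lambda_\tau(S_e)=U_\tau S_e$. All labeled graphs here have vertex set $E^{k-1}$ and labels in $E^1\times E^1$, and are regarded as given by their sets of labeled edges; a labeled edge $\beta\xrightarrow{e,f}\alpha$ has source $\beta$, range $\alpha$, first label $e$, second label $f$. The permutation graph $(E_\tau,\mathcal{L}_\tau)$ has exactly one edge $\beta\xrightarrow{e,f}\alpha$ whenever $e\alpha\in E^k$ and $\tau(e\alpha)=\beta f$ ($e,f\in E^1$, $\alpha,\beta\in E^{k-1}$), and no other edges. $\mathcal{G}\oplus\mu$ denotes $\mathcal{G}$ with the labeled edge $\mu$ added. A labeled graph $\mathcal{G}$ synchronizes in both labels if there is $m\in\mathbb{N}$ such that (a) any two paths in $\mathcal{G}$ of length $m$ with the same sequence of first labels have the same source, and (b) any two paths of length at least $m$ with the same sequence of second labels have the same range. $\mathrm{valid}(\mathcal{G})$ is true if $\mathcal{G}$ synchronizes in both labels and: (i) every edge $\beta\xrightarrow{e,f}\alpha$ of $\mathcal{G}$ satisfies $s(\beta)=s(e)$, $s(\alpha)=r(e)$, $r(\beta)=s(f)$, $r(\alpha)=r(f)$; (ii) for every $e\in E^1$ and $\alpha\in E^{k-1}_{r(e)\to *}$ there is at most one edge in $\mathcal{G}$ with range $\alpha$ and first label $e$; (iii) for every $f\in E^1$ and $\beta\in E^{k-1}_{*\to s(f)}$ there is at most one edge in $\mathcal{G}$ with source $\beta$ and second label $f$. Enumerate $E^1=\{e_0,\dots,e_{|E^1|-1}\}$, put $r_m=r(e_m)$,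 and for each $u\in E^0$ enumerate $E^{k-1}_{u\to *}=\{\alpha_u^n : 0\le n\le |E^{k-1}_{u\to *}|-1\}$. The recursion is $$\Phi_1(|E^1|,\mathcal{G})=\{\mathcal{G}\},\qquad \Phi_1(m,\mathcal{G})=\Phi_0(m,0,\mathcal{G})\ \ (m<|E^1|),$$ $$\Phi_0(m,|E^{k-1}_{r_m\to *}|,\mathcal{G})=\Phi_1(m+1,\mathcal{G}),$$ $$\Phi_0(m,n,\mathcal{G})=\biguplus_{\mu}\Phi_0(m,n+1,\mathcal{G}\oplus\mu)\quad (n<|E^{k-1}_{r_m\to *}|),$$ where the disjoint union is over all labeled edges $\mu\colon\beta\xrightarrow{e_m,f}\alpha^n_{r_m}$ ($\beta\in E^{k-1}$, $f\in E^1$) for which $\mathrm{valid}(\mathcal{G}\oplus\mu)$ holds (an empty union is $\emptyset$). *)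

(* Defs.v *)
From HB Require Import structures.
From mathcomp Require Import all_boot all_order all_fingroup all_algebra.
From mathcomp Require Import complex.
From mathcomp Require Import all_classical all_reals all_analysis.

Set Implicit Arguments.
Unset Strict Implicit.
Unset Printing Implicit Defensive.

Import Order.TTheory GRing.Theory Num.Theory.

Record digraph := Digraph {
  vert : finType;
  edge : finType;
  src : edge -> vert;
  rng : edge -> vert }.

Arguments src {d}.
Arguments rng {d}.

Definition no_sinks (E : digraph) := forall v : vert E, exists e, src e = v.

Definition no_sources (E : digraph) := forall v : vert E, exists e, rng e = v.

Fixpoint walk (E : digraph) (v : vert E) (s : seq (edge E)) : bool :=
  if s is e :: s' then (src e == v) && walk (rng e) s' else true.

(* A path carries its source explicitly, so that the paths of length 0 are
   the vertices; in positive length the source is forced by the edges. *)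
Definition epath (E : digraph) (l : nat) : finType :=
  {p : vert E * l.-tuple (edge E) | walk p.1 p.2}.

Section Paths.
Context {E : digraph}.

Definition psrc l (p : epath E l) : vert E := (val p).1.

Definition pedges l (p : epath E l) : seq (edge E) := (val p).2.

Definition prng l (p : epath E l) : vert E :=
  last (psrc p) (map rng (pedges p)).

Definition paths_between l (u v : vert E) : {set epath E l} :=
  [set p : epath E l | (psrc p == u) && (prng p == v)].

(* x = e a as a path; this includes the requirement that e a is a path *)
Definition is_cons l l' (e : edge E) (a : epath E l) (x : epath E l') : bool :=
  [&& psrc a == rng e, psrc x == src e & pedges x == e :: pedges a].

(* y = b f as a path *)
Definition is_rcons l l' (b : epath E l) (f : edge E) (y : epath E l') : bool :=
  [&& src f == prng b, psrc y == psrc b & pedges y == rcons (pedges b) f].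

End Paths.

(* A path of length l.+1 with equal endpoints need not be a simple cycle; all
   of them have an exit if and only if all simple cycles do. *)
Definition every_cycle_has_exit (E : digraph) :=
  forall l (mu : epath E l.+1), psrc mu = prng mu ->
  exists2 e, e \in pedges mu & 1 < #|[set f : edge E | src f == src e]|.

Definition endpoint_fixing (E : digraph) k (tau : {perm epath E k}) :=
  forall u v : vert E,
    (tau @: paths_between k u v)%SET = paths_between k u v.

Local Open Scope ring_scope.

(* C*-algebras need not be unital here, and may be zero. *)
Record cstarAlgebra (R : realType) := CStarAlgebra {
  cstar_car :> completeNormedModType R[i];
  cmul : cstar_car -> cstar_car -> cstar_car;
  cstar : cstar_car -> cstar_car;
  cmulA : associative cmul;
  cmulDl : left_distributive cmul +%R;
  cmulDr : right_distributive cmul +%R;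
  cscaleAl : forall (c : R[i]) x y, c *: cmul x y = cmul (c *: x) y;
  cscaleAr : forall (c : R[i]) x y, c *: cmul x y = cmul x (c *: y);
  cnormM : forall x y, `|cmul x y| <= `|x| * `|y|;
  cstarK : involutive cstar;
  cstarD : {morph cstar : x y / x + y};
  cstarZ : forall (c : R[i]) x, cstar (c *: x) = Num.conj c *: cstar x;
  cstarM : forall x y, cstar (cmul x y) = cmul (cstar y) (cstar x);
  cnorm_star : forall x, `|cmul (cstar x) x| = `|x| ^+ 2 }.

Section CStar.
Context {R : realType}.
Implicit Types A B : cstarAlgebra R.

Definition is_projection A (p : A) := cstar p = p /\ cmul p p = p.

Definition is_partial_isometry A (s : A) := cmul (cmul s (cstar s)) s = s.

(* The usual order: the positive elements are those of the form z^* z. *)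
Definition cstar_le A (x y : A) := exists z : A, y - x = cmul (cstar z) z.

Record star_hom A B (f : A -> B) : Prop := StarHom {
  star_hom_linear : linear f;
  star_homM : {morph f : x y / cmul x y};
  star_homS : {morph f : x / cstar x} }.

Record closed_star_subalgebra A (D : set A) : Prop := ClosedStarSubalgebra {
  subalg_closed : closed D;
  subalg0 : D 0;
  subalgD : forall x y, D x -> D y -> D (x + y);
  subalgZ : forall (c : R[i]) x, D x -> D (c *: x);
  subalgM : forall x y, D x -> D y -> D (cmul x y);
  subalgS : forall x, D x -> D (cstar x) }.

Definition emits (E : digraph) (v : vert E) := exists e : edge E, src e = v.

Record ck_family (E : digraph) A (P : vert E -> A) (S : edge E -> A) : Prop :=
  CKFamily {
    ck_proj : forall v, is_projection (P v);
    ck_orth : forall u v, u != v -> cmul (P u) (P v) = 0;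
    ck_pisom : forall e, is_partial_isometry (S e);
    ck_initial : forall e, cmul (cstar (S e)) (S e) = P (rng e);
    ck_edge_orth : forall e f, e != f -> cmul (cstar (S e)) (S f) = 0;
    ck_le : forall e, cstar_le (cmul (S e) (cstar (S e))) (P (src e));
    ck_sum : forall v, emits v ->
      P v = \sum_(e | src e == v) cmul (S e) (cstar (S e)) }.

(* C*(E) by its universal property, i.e. up to isomorphism; the uniqueness of f
   in ga_universal is a consequence of ga_generated. *)
Record is_graph_algebra (E : digraph) A (P : vert E -> A) (S : edge E -> A) :
  Prop := IsGraphAlgebra {
    ga_family : ck_family P S;
    ga_generated : forall D : set A, closed_star_subalgebra D ->
      (forall v, D (P v)) -> (forall e, D (S e)) -> forall x, D x;
    ga_universal : forall (B : cstarAlgebra R)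
      (Q : vert E -> B) (T : edge E -> B), ck_family Q T ->
      exists f : A -> B, [/\ star_hom f, forall v, f (P v) = Q v
                          & forall e, f (S e) = T e] }.

Section Lambda.
Variables (E : digraph) (A : cstarAlgebra R).
Variables (P : vert E -> A) (S : edge E -> A).

Definition path_elt l (p : epath E l) : A :=
  if pedges p is e :: es then foldl (fun x f => cmul x (S f)) (S e) es
  else P (psrc p).

Definition U_perm k (tau : {perm epath E k}) : A :=
  \sum_(a : epath E k) cmul (path_elt (tau a)) (cstar (path_elt a)).

(* The unit of C*(E) is the sum of the P v, E being finite. *)
Definition is_lambda k (tau : {perm epath E k}) (lam : A -> A) :=
  [/\ star_hom lam,
      lam (\sum_v P v) = \sum_v P v
    & forall e, lam (S e) = cmul (U_perm tau) (S e)].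

Definition lambda_automorphism k (tau : {perm epath E k}) :=
  exists2 lam : A -> A, is_lambda tau lam & bijective lam.

End Lambda.
End CStar.

Local Close Scope ring_scope.

(* (b, e, f, a) is the labeled edge b -> a with first label e and second label
   f. A labeled graph is its set of labeled edges: its vertex set is always
   the whole of E^n, isolated vertices included. *)
Definition ledge (E : digraph) (n : nat) : finType :=
  (epath E n * edge E * edge E * epath E n)%type.

Section LabeledGraphs.
Context {E : digraph} {n : nat}.

Definition lsrc (mu : ledge E n) : epath E n := mu.1.1.1.
Definition lab1 (mu : ledge E n) : edge E := mu.1.1.2.
Definition lab2 (mu : ledge E n) : edge E := mu.1.2.
Definition lrng (mu : ledge E n) : epath E n := mu.2.

Implicit Types G : {set ledge E n}.

Fixpoint lwalk G (b : epath E n) (p : seq (ledge E n)) : bool :=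
  if p is mu :: p' then [&& mu \in G, lsrc mu == b & lwalk G (lrng mu) p']
  else true.

Definition lend (b : epath E n) (p : seq (ledge E n)) : epath E n :=
  last b (map lrng p).

Definition synchronizes G := exists m : nat,
  (forall b b' p p', lwalk G b p -> lwalk G b' p' ->
     size p = m -> size p' = m -> map lab1 p = map lab1 p' -> b = b') /\
  (forall b b' p p', lwalk G b p -> lwalk G b' p' ->
     m <= size p -> m <= size p' -> map lab2 p = map lab2 p' ->
     lend b p = lend b' p').

Definition valid_edge (mu : ledge E n) :=
  [/\ psrc (lsrc mu) = src (lab1 mu), psrc (lrng mu) = rng (lab1 mu),
      prng (lsrc mu) = src (lab2 mu) & prng (lrng mu) = rng (lab2 mu)].

Record valid G : Prop := Valid {
  valid_sync : synchronizes G;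
  valid_ends : forall mu, mu \in G -> valid_edge mu;
  valid_lab1 : forall (e : edge E) (a : epath E n), psrc a = rng e ->
    forall mu nu, mu \in G -> nu \in G ->
    lrng mu = a -> lab1 mu = e -> lrng nu = a -> lab1 nu = e -> mu = nu;
  valid_lab2 : forall (f : edge E) (b : epath E n), prng b = src f ->
    forall mu nu, mu \in G -> nu \in G ->
    lsrc mu = b -> lab2 mu = f -> lsrc nu = b -> lab2 nu = f -> mu = nu }.

End LabeledGraphs.

Definition perm_graph (E : digraph) k (tau : {perm epath E k}) :
    {set ledge E k.-1} :=
  [set mu : ledge E k.-1 | [exists x : epath E k,
     is_cons (lab1 mu) (lrng mu) x && is_rcons (lsrc mu) (lab2 mu) (tau x)]].

Definition edge_enumeration (E : digraph) (es : seq (edge E)) :=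
  uniq es /\ forall e, e \in es.

Definition path_enumeration (E : digraph) n (al : vert E -> seq (epath E n)) :=
  forall u, uniq (al u) /\ forall a, (a \in al u) = (psrc a == u).

Section Recursion.
Context {E : digraph} {n : nat}.
Variables (es : seq (edge E)) (al : vert E -> seq (epath E n)).

Local Notation lgraph := {set ledge E n}.
Local Open Scope classical_set_scope.

Definition extensions (e : edge E) (a : epath E n) (G : lgraph) :
    set (ledge E n) :=
  [set mu | [/\ lab1 mu = e, lrng mu = a & valid (mu |: G)%SET]].

Fixpoint Phi0_rec (next : lgraph -> set lgraph) (e : edge E)
    (s : seq (epath E n)) (G : lgraph) : set lgraph :=
  if s is a :: s' then
    \bigcup_(mu in extensions e a G) Phi0_rec next e s' (mu |: G)%SET
  else next G.

Fixpoint Phi1_rec (s : seq (edge E)) (G : lgraph) : set lgraph :=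
  if s is e :: s' then Phi0_rec (Phi1_rec s') e (al (rng e)) G else [set G].

(* es lists the edges e_m and al u lists the paths alpha_u^j; the lists still
   to be processed at stage (m, j) are drop m es and drop j (al (rng e_m)).
   The lemmas Phi1_size, Phi1E, Phi0_size and Phi0E are the defining equations
   of the recursion, and Phi0_disjoint says that its unions are disjoint. *)
Definition Phi1 (m : nat) (G : lgraph) : set lgraph := Phi1_rec (drop m es) G.

Definition Phi0 (m j : nat) (G : lgraph) : set lgraph :=
  if drop m es is e :: s' then Phi0_rec (Phi1_rec s') e (drop j (al (rng e))) G
  else set0.

Lemma Phi1_size G : Phi1 (size es) G = [set G].
Proof. by rewrite /Phi1 drop_size. Qed.

Lemma Phi1E m G : m < size es -> Phi1 m G = Phi0 m 0 G.
Proof.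
case E0 : es => [//|e0 s0]; rewrite -E0 => mlt.
by rewrite /Phi1 /Phi0 (drop_nth e0 mlt) drop0.
Qed.

Lemma Phi0_size e0 m G : m < size es ->
  Phi0 m (size (al (rng (nth e0 es m)))) G = Phi1 m.+1 G.
Proof. by move=> mlt; rewrite /Phi0 /Phi1 (drop_nth e0 mlt) drop_size. Qed.

Lemma Phi0E e0 a0 m j G (e := nth e0 es m) (a := nth a0 (al (rng e)) j) :
  m < size es -> j < size (al (rng e)) ->
  Phi0 m j G = \bigcup_(mu in extensions e a G) Phi0 m j.+1 (mu |: G)%SET.
Proof.
move=> mlt jlt.
by rewrite /Phi0 (drop_nth e0 mlt) -/e (drop_nth a0 jlt).
Qed.

Let grows (G : lgraph) (H : lgraph) := G \subset H /\ (H = G \/ valid H).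

Let grows_trans G H (mu : ledge E n) :
  valid (mu |: G)%SET -> grows (mu |: G)%SET H -> grows G H.
Proof.
move=> vG [sGH vH]; split; first exact: fintype.subset_trans (finset.subsetUr _ _) sGH.
by right; case: vH => [->|].
Qed.

Let Phi0_rec_grows next e s G H :
  (forall G', next G' H -> grows G' H) -> Phi0_rec next e s G H -> grows G H.
Proof.
move=> nextP; elim: s G => [|a s IH] G /=; first exact: nextP.
by case=> mu [_ _ vG] /IH; exact: grows_trans.
Qed.

Let Phi1_rec_grows s G H : Phi1_rec s G H -> grows G H.
Proof.
elim: s G => [|e s IH] G /=; first by move=> ->; split=> //; left.
exact: Phi0_rec_grows.
Qed.

Lemma Phi0_disjoint e0 a0 m j G
    (e := nth e0 es m) (a := nth a0 (al (rng e)) j) :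
  path_enumeration al -> m < size es -> j < size (al (rng e)) ->
  classical_sets.trivIset (extensions e a G)
    (fun mu => Phi0 m j.+1 (mu |: G)%SET).
Proof.
move=> alP mlt jlt mu nu [mu1 mu2 vmu] [nu1 nu2 vnu] [H []].
rewrite /Phi0 (drop_nth e0 mlt) => PhiM PhiN.
have [sM vM] := Phi0_rec_grows (@Phi1_rec_grows _ ^~ H) PhiM.
have [sN _] := Phi0_rec_grows (@Phi1_rec_grows _ ^~ H) PhiN.
have vH : valid H by case: vM => [->|].
have sa : psrc a = rng e.
  by have [_ /(_ a)] := alP (rng e); rewrite mem_nth// => /esym/eqP.
apply: (valid_lab1 vH sa) => //.
- by apply: (fintype.subsetP sM); rewrite finset.setU11.
- by apply: (fintype.subsetP sN); rewrite finset.setU11.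
Qed.

End Recursion.

(* Main.v *)
Require Import Defs.
From HB Require Import structures.
From mathcomp Require Import all_boot all_order all_fingroup all_algebra.
From mathcomp Require Import complex.
From mathcomp Require Import all_classical all_reals all_analysis.
From mathcomp Require Import ring lra zify.

(* An edge (b, e, f, a) of the permutation graph says that
   lambda_tau(S_e) S_a = S_b S_f. A walk from b to a with labels (mu, nu)
   therefore gives lambda_tau(S_mu) S_a = S_b S_nu.

   If the graph synchronizes, synchronization of the first labels puts
   S_a S_a^* in the image of lambda_tau, and synchronization of the second labels
   then does the same for S_g S_d^* whenever g and d are paths of length k with
   the same range. So U_tau^* = lambda_tau(w) for some w in the span of the
   S_x S_y^* with |x| = |y|. As lambda_tau is injective on this span, w is a
   unitary commuting with the P_v, and lambda_w is the inverse of lambda_tau.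

   Conversely, represent C*(E) on l2 of (infinite paths) x Z. There U_tau permutes
   the basis, so lambda_tau(S_e) is again given by a partial bijection of the
   basis, the inverse branch of a new shift. If two points of the same degree
   have the same code for the new shift, matching their tail classes for that
   shift defines a partial isometry commuting with the image of lambda_tau. When
   lambda_tau is onto, it commutes with all S_e. Hence points with the same code
   are equal, and points with the same tail have the same tail for the new shift.
   A graph that does not synchronize contains, by the pigeonhole principle, two
   infinite walks that never meet and have the same first labels, or the same
   second labels, and these contradict the two properties respectively. *)

Set Implicit Arguments.
Unset Strict Implicit.
Unset Printing Implicit Defensive.

Import Order.TTheory GRing.Theory Num.Theory numFieldNormedType.Exports.

Local Open Scope classical_set_scope.
Local Open Scope ring_scope.

(** * C*-algebras and automatic continuity *)

Notation "x ** y" := (cmul x y) (at level 40, left associativity).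

(** [ga_universal] yields bare star homomorphisms, while [ga_generated] speaks of closed
    subalgebras. An identity checked on generators thus spreads to all of [C*(E)] only through
    continuity of star homomorphisms, which is derived from the C*-identity and a square root built
    by a contraction. The universal property also needs a concrete target before it says anything
    about [C*(E)]; hence the C*-algebra of operators on l2.

    Injectivity of lambda_tau on the span of the S_x S_y^* with |x| = |y| has an elementary reason:
    the coefficients S_a^* z S_b of an element z of this span, with a and b long enough, lie in the
    span of the P_v, which lambda_tau fixes pointwise. This is why the preimages constructed, and
    the image of U_tau under the candidate inverse, are shown to lie there.

    On the combinatorial side, validity passes to subgraphs, so testing it after every added edge
    discards nothing that could still be completed. A valid graph with an edge for every composable
    pair (first label, range) is the graph of a permutation: clause (iii) gives injectivity, and
    finiteness does the rest. *)

Section CStarTheory.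
Context {R : realType} {A : cstarAlgebra R}.
Implicit Types x y z : A.

Lemma cmul0l x : 0 ** x = 0 :> A.
Proof. by apply: (addIr (0 ** x)); rewrite -cmulDl !add0r. Qed.

Lemma cmul0r x : x ** 0 = 0 :> A.
Proof. by apply: (addIr (x ** 0)); rewrite -cmulDr !add0r. Qed.

Lemma cmulNl x y : (- x) ** y = - (x ** y).
Proof. by apply: (addIr (x ** y)); rewrite -cmulDl !addNr cmul0l. Qed.

Lemma cmulNr x y : x ** (- y) = - (x ** y).
Proof. by apply: (addIr (x ** y)); rewrite -cmulDr !addNr cmul0r. Qed.

Lemma cmulBl x y z : (x - y) ** z = x ** z - y ** z.
Proof. by rewrite cmulDl cmulNl. Qed.

Lemma cmulBr x y z : z ** (x - y) = z ** x - z ** y.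
Proof. by rewrite cmulDr cmulNr. Qed.

Lemma cmul_suml I (r : seq I) (Q : pred I) (F : I -> A) x :
  (\sum_(i <- r | Q i) F i) ** x = \sum_(i <- r | Q i) (F i ** x).
Proof. by apply: (big_morph (fun y => y ** x)) => [y z|]; rewrite ?cmulDl ?cmul0l. Qed.

Lemma cmul_sumr I (r : seq I) (Q : pred I) (F : I -> A) x :
  x ** (\sum_(i <- r | Q i) F i) = \sum_(i <- r | Q i) (x ** F i).
Proof. by apply: (big_morph (fun y => x ** y)) => [y z|]; rewrite ?cmulDr ?cmul0r. Qed.

Lemma cstar0 : cstar 0 = 0 :> A.
Proof. by apply: (addIr (cstar (0 : A))); rewrite -cstarD !add0r. Qed.

Lemma cstarN x : cstar (- x) = - cstar x.
Proof. by apply: (addIr (cstar x)); rewrite -cstarD !addNr cstar0. Qed.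

Lemma cstarB x y : cstar (x - y) = cstar x - cstar y.
Proof. by rewrite cstarD cstarN. Qed.

Lemma cstar_sum I (r : seq I) (Q : pred I) (F : I -> A) :
  cstar (\sum_(i <- r | Q i) F i) = \sum_(i <- r | Q i) cstar (F i).
Proof. by apply: (big_morph (@cstar R A)) => [y z|]; rewrite ?cstarD ?cstar0. Qed.

(** The C*-identity and submultiplicativity give |y|^2 <= |y*| |y|; cancel |y| and apply the result
    to [cstar x] as well. *)
Lemma cnorm_cstar x : `|cstar x| = `|x|.
Proof.
have le_star y : `|y| <= `|cstar y|.
  have [->|y0] := eqVneq y 0; first by rewrite cstar0.
  have := cnormM (cstar y) y.
  by rewrite cnorm_star expr2 ler_pM2r// normr_gt0.
by apply/eqP; rewrite eq_le le_star -{2}(cstarK x) le_star.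
Qed.

Lemma cstar_continuous : continuous (@cstar R A).
Proof.
move=> x; apply/cvgrPdist_lt => e e0; near=> y.
by rewrite -cstarB cnorm_cstar; near: y; exact: cvgr_dist_lt.
Unshelve. all: end_near. Qed.

Lemma cmulr_continuous x : continuous (fun y => x ** y).
Proof.
move=> y; apply/cvgrPdist_lt => e e0; near=> z.
rewrite -cmulBr (le_lt_trans (cnormM _ _))//.
have x1 : 0 < `|x| + 1 by rewrite ltr_wpDl.
apply: (@le_lt_trans _ _ ((`|x| + 1) * `|y - z|)).
  by rewrite ler_wpM2r// lerDl.
rewrite -ltr_pdivlMl//; near: z; apply: cvgr_dist_lt => //.
by rewrite mulr_gt0// invr_gt0.
Unshelve. all: end_near. Qed.

Lemma cmull_continuous x : continuous (fun y => y ** x).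
Proof.
move=> y.
rewrite (_ : (fun y => y ** x) = @cstar R A \o (fun y => cstar x ** y) \o @cstar R A); last first.
  by apply/funext => z /=; rewrite cstarM !cstarK.
apply: continuous_comp; first exact: cstar_continuous.
by apply: continuous_comp; [exact: cmulr_continuous|exact: cstar_continuous].
Qed.

Lemma projection_norm_le1 (p : A) : is_projection p -> `|p| <= 1.
Proof.
move=> [ps pp]; have := cnorm_star p; rewrite ps pp => pn.
have [->|p0] := eqVneq `|p| 0; first exact: ler01.
by move/eqP: pn; rewrite expr2 -{1}[`|p|]mulr1 (inj_eq (mulfI p0)) => /eqP <-.
Qed.

End CStarTheory.

Section StarHomContractive.
Context {R : realType}.
Implicit Types A B : cstarAlgebra R.

(** Norms and radii live in [R[i]], whose positive elements are real; this moves epsilon arguments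
    back to [R]. *)
Lemma complex_gt0_real (e : R[i]) : 0 < e -> exists2 r : R, 0 < r & e = r%:C%C.
Proof.
move=> e0; have eR : e \is Num.real by rewrite realE ltW.
by exists (complex.Re e); rewrite -?ltcR RRe_real.
Qed.

Section SquareRoot.
Variables (A : cstarAlgebra R) (h : A).
Hypotheses (hs : cstar h = h).
Variable q : R.
Hypotheses (q0 : 0 <= q) (q1 : q < 1) (hq : `|h| <= q%:C%C).

(** On [U] the map [f] below is a contraction of ratio [q]. A fixed point satisfies h^2 + c^2 = 2c,
    that is, (1 - c)^2 = 1 - h^2. *)
Let U (c : A) := [/\ `|c| <= q%:C%C, cstar c = c & c ** h = h ** c].
Let f (c : A) := 2^-1 *: (h ** h + c ** c).

Let qC0 : 0 <= q%:C%C :> R[i].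
Proof. by rewrite ler0c. Qed.

Let qC1 : q%:C%C <= 1 :> R[i].
Proof. by rewrite -[1]/(1%:C%C) lecR ltW. Qed.

Let Uf c : U c -> U (f c).
Proof.
move=> [cq cs ch]; split.
- have sq z : `|z| <= q%:C%C -> `|z ** z| <= q%:C%C.
    move=> zq; rewrite (le_trans (cnormM _ _))// -[leRHS]mulr1 ler_pM//.
    exact: le_trans qC1.
  rewrite normrZ gtr0_norm ?invr_gt0// ler_pdivrMl//.
  apply: le_trans (ler_normD _ _) _.
  by rewrite mulr_natl mulr2n lerD// sq.
- by rewrite cstarZ cstarD !cstarM hs cs rmorphV/= ?unitfE// conjC_nat.
- rewrite -cscaleAl -cscaleAr cmulDl cmulDr !cmulA; congr (_ *: (_ + _)).
  by rewrite -cmulA ch cmulA ch.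
Qed.

Let f_contr c d : U c -> U d -> `|f c - f d| <= q%:C%C * `|c - d|.
Proof.
move=> [cq cs ch] [dq ds dh].
rewrite -scalerBr opprD addrACA subrr add0r.
rewrite normrZ gtr0_norm ?invr_gt0// ler_pdivrMl//.
have -> : c ** c - d ** d = c ** (c - d) + (c - d) ** d.
  by rewrite cmulBl cmulBr addrA subrK.
apply: le_trans (ler_normD _ _) _.
rewrite mulr_natl mulr2n lerD// (le_trans (cnormM _ _))//.
  by rewrite ler_wpM2r.
by rewrite mulrC ler_wpM2r.
Qed.

Let y n := iter n f 0.

Let Uy n : U (y n).
Proof.
elim: n => [|n IH]; last exact: Uf.
by split; rewrite /= ?normr0 ?cstar0 ?cmul0l ?cmul0r.
Qed.

(** Each iterate has norm at most 1, so any two are at distance at most 2; every further application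
    of [f] gains a factor [q]. *)
Let y_dist N a b : `|y (a + N) - y (b + N)| <= q%:C%C ^+ N * 2.
Proof.
elim: N => [|N IH].
  rewrite !addn0 expr0 mul1r (le_trans (ler_normB _ _))//.
  have [ya _ _] := Uy a; have [yb _ _] := Uy b.
  by rewrite -[2]/(1 + 1) lerD// (le_trans _ qC1).
rewrite !addnS (le_trans (f_contr (Uy _) (Uy _)))//.
by rewrite exprS -mulrA ler_wpM2l.
Qed.

Let y_cvg : cvgn y.
Proof.
apply: cauchy_cvg; apply: cauchy_exP => e /complex_gt0_real[r r0 ->].
have /cvgrPdist_lt/(_ (r / 2)) := @cvg_expr R q (ltac:(by rewrite ger0_norm)).
rewrite divr_gt0// => /(_ isT)[N _ /(_ N (leqnn N))].
rewrite sub0r normrN ger0_norm ?exprn_ge0// ltr_pdivlMr// => qN.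
exists (y N); exists N => //= m /subnK <-.
rewrite -ball_normE/= -{1}[N]add0n (le_lt_trans (y_dist _ _ _))//.
by rewrite -[2]/(2%:R) -(rmorph_nat (real_complex R)) -rmorphXn -rmorphM ltcR.
Qed.

(** The limit of the iterates inherits self-adjointness and commutation with [h], both closed
    conditions, and is fixed by [f]. The last equation is written without a unit, since [A] is not
    assumed unital here. *)
Lemma cstar_sqrt_exists : exists c : A,
  [/\ cstar c = c, c ** h = h ** c & h ** h + c ** c = 2 *: c].
Proof.
have yl : y @ \oo --> lim (y @ \oo) by [].
have [c cE] : exists c, c = lim (y @ \oo) by eexists.
rewrite -cE in yl.
have cs : cstar c = c.
  apply: (@cvg_unique _ _ (y @ \oo)) => //.
  have : (@cstar R A \o y) @ \oo --> cstar c.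
    by apply: continuous_cvg => //; exact: cstar_continuous.
  suff -> : @cstar R A \o y = y by [].
  by apply/funext => n /=; have [] := Uy n.
have ch : c ** h = h ** c.
  have h1 : (fun n => y n ** h) @ \oo --> c ** h.
    by apply: (@cvg_comp _ _ _ y (fun z => z ** h)); [exact: yl|exact: cmull_continuous].
  have h2 : (fun n => h ** y n) @ \oo --> h ** c.
    by apply: (@cvg_comp _ _ _ y (fun z => h ** z)); [exact: yl|exact: cmulr_continuous].
  apply: cvg_unique h1 _ => //.
  suff -> : (fun n => y n ** h) = (fun n => h ** y n) by [].
  by apply/funext => n; have [] := Uy n.
exists c; split => //.
suff -> : 2 *: c = 2 *: f c by rewrite /f scalerA mulfV ?scale1r// pnatr_eq0.
congr (_ *: _).
have yS : (fun n => y n.+1) @ \oo --> c by rewrite (cvg_shiftS y).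
apply: cvg_unique yS _ => //.
apply/cvgrPdist_lt => e e0; near=> n.
rewrite [y n.+1]/(f (y n)) -scalerBr opprD addrACA subrr add0r.
have -> : c ** c - y n ** y n = c ** (c - y n) + (c - y n) ** y n.
  by rewrite cmulBl cmulBr addrA subrK.
rewrite normrZ gtr0_norm ?invr_gt0// ltr_pdivrMl//.
apply: (@le_lt_trans _ _ ((`|c| + 1) * `|c - y n|)).
  apply: le_trans (ler_normD _ _) _; rewrite mulrDl mul1r lerD ?cnormM//.
  rewrite (le_trans (cnormM _ _))// -[leRHS]mulr1 ler_pM//.
  by have [yq _ _] := Uy n; exact: le_trans qC1.
rewrite -ltr_pdivlMl ?ltr_wpDl//; near: n.
by move/cvgrPdist_lt: yl; apply; rewrite mulr_gt0 ?mulr_gt0// invr_gt0 ltr_wpDl.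
Unshelve. all: end_near. Qed.

End SquareRoot.

Section Contractive.
Variables (A B : cstarAlgebra R) (one : A) (f : A -> B).
Hypotheses (one_proj : is_projection one).
Hypotheses (one_l : forall x, one ** x = x) (one_r : forall x, x ** one = x).
Hypothesis (fh : star_hom f).

Lemma star_homD x y : f (x + y) = f x + f y.
Proof. by have := star_hom_linear fh 1 x y; rewrite !scale1r. Qed.

Lemma star_hom0 : f 0 = 0.
Proof. by apply: (addIr (f 0)); rewrite -star_homD !add0r. Qed.

Lemma star_homZ c x : f (c *: x) = c *: f x.
Proof. by have := star_hom_linear fh c x 0; rewrite !addr0 star_hom0 addr0. Qed.

Lemma star_homB x y : f (x - y) = f x - f y.
Proof. by rewrite -scaleN1r star_homD star_homZ scaleN1r. Qed.

Lemma star_hom_sum I (r : seq I) (Q : pred I) (F : I -> A) :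
  f (\sum_(i <- r | Q i) F i) = \sum_(i <- r | Q i) f (F i).
Proof. exact: (big_morph f star_homD star_hom0). Qed.

(* A self-adjoint [h] of norm [< 1] is the real part of the unitary
   [h + i (1 - c)], where [(1 - c)^2 = 1 - h^2]; the image of a unitary is a
   partial isometry, of norm [<= 1]. *)
Lemma star_hom_selfadjoint_le1 (h : A) (q : R) :
  cstar h = h -> 0 <= q -> q < 1 -> `|h| <= q%:C%C -> `|f h| <= 1.
Proof.
move=> hs q0 q1 hq.
have [c [cs ch hc]] := cstar_sqrt_exists hs q0 q1 hq.
have [os oo] := one_proj.
pose d := one - c; pose v := h + 'i *: d.
have ds : cstar d = d by rewrite cstarB os cs.
have vs : cstar v = h - 'i *: d by rewrite cstarD cstarZ hs ds conjCi scaleNr.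
have hd : h ** d = d ** h by rewrite cmulBr cmulBl one_l one_r ch.
have dd : d ** d = one - h ** h.
  have -> : h ** h = c + c - c ** c by rewrite -mulr2n -scaler_nat -hc addrK.
  rewrite cmulBl !cmulBr !one_l one_r -addrA; congr (_ + _).
  by rewrite !opprB opprD addrCA.
have vv : cstar v ** v = one.
  rewrite vs cmulBl !cmulDr -!cscaleAl -!cscaleAr scalerA hd dd.
  rewrite -expr2 sqrCi scaleN1r (opprB ('i *: _)) addrACA.
  by rewrite subrr addr0 addrC subrK.
have fv : `|f v| <= 1.
  have : `|f v| ^+ 2 <= 1.
    rewrite -cnorm_star -(star_homS fh) -(star_homM fh) vv.
    apply: projection_norm_le1; split.
      by rewrite -(star_homS fh) os.
    by rewrite -(star_homM fh) oo.
  by rewrite expr_le1.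
have -> : f h = 2^-1 *: (f v + cstar (f v)).
  rewrite -(star_homS fh) -star_homD vs /v addrACA subrr addr0.
  have -> : h + h = 2 *: h by rewrite scaler_nat mulr2n.
  by rewrite star_homZ scalerA mulVf ?scale1r// pnatr_eq0.
rewrite normrZ gtr0_norm ?invr_gt0// ler_pdivrMl// mulr1.
by rewrite (le_trans (ler_normD _ _))// cnorm_cstar -[2]/(1 + 1) lerD.
Qed.

Lemma star_hom_selfadjoint_le (h : A) : cstar h = h -> `|f h| <= `|h|.
Proof.
move=> hs; have [h0|] := eqVneq h 0; first by rewrite h0 star_hom0 !normr0.
rewrite -normr_gt0 => /complex_gt0_real[r r0 rE].
have fhr : exists s : R, 0 <= s /\ `|f h| = s%:C%C.
  have := normr_ge0 (f h); rewrite le_eqVlt => /predU1P[<-|].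
    by exists 0.
  by move=> /complex_gt0_real[s s0 ->]; exists s; rewrite ltW.
have [s [s0 sE]] := fhr; rewrite sE rE lecR leNgt; apply/negP => rs.
(* If r < s, this scaling puts 1 strictly between t r and t s; then [t h] has norm below 1 and its
   image has norm above 1. *)
pose t := 2 / (r + s).
have t0 : 0 < t by rewrite divr_gt0// addr_gt0// (lt_trans r0).
have rs0 : 0 < r + s by rewrite ltr_wpDr.
have tc : Num.conj t%:C%C = t%:C%C :> R[i].
  by apply/CrealP; rewrite realE ler0c ltW.
have tn : `|t%:C%C| = t%:C%C :> R[i] by rewrite ger0_norm// ler0c ltW.
have t2 : t * (r + s) = 2 by rewrite mulfVK// gt_eqF.
have := @star_hom_selfadjoint_le1 (t%:C%C *: h) (t * r).
rewrite cstarZ tc hs star_homZ !normrZ rE sE tn -!(rmorphM (real_complex R)).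
rewrite (_ : 1 = 1%:C%C :> R[i])// !lecR => /(_ erefl)/(_ _)/(_ _)/(_ (lexx _)) H.
have : t * s <= 1 by apply: H; nra.
by nra.
Qed.

(** By the C*-identity, the claim for [x] is the claim for the self-adjoint element
    [cstar x ** x]. *)
Lemma star_hom_le x : `|f x| <= `|x|.
Proof.
have : `|f x| ^+ 2 <= `|x| ^+ 2.
  rewrite -!cnorm_star -(star_homS fh) -(star_homM fh).
  by apply: star_hom_selfadjoint_le; rewrite cstarM cstarK.
by rewrite ler_pXn2r// nnegrE.
Qed.

Lemma star_hom_continuous : continuous f.
Proof.
move=> x; apply/cvgrPdist_lt => e e0; near=> y.
rewrite -star_homB; apply: le_lt_trans (star_hom_le _) _.
near: y; exact: cvgr_dist_lt.
Unshelve. all: end_near. Qed.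

End Contractive.
End StarHomContractive.

(** * Square-summable families *)

Section ExhaustingFilter.
Context {Y : choiceType}.

(** Duplicate-free lists stand for finite subsets, directed by inclusion; a limit along this filter
    is an unordered sum. *)
Definition exhausting : set_system (seq Y) :=
  filter_from setT (fun s : seq Y => [set t | uniq t /\ {subset s <= t}]).

#[global] Instance exhausting_filter : ProperFilter exhausting.
Proof.
apply: filter_from_proper => [|s _]; last first.
  by exists (undup s); split; [exact: undup_uniq|move=> y; rewrite mem_undup].
apply: filter_from_filter; first by exists [::].
move=> s t _ _; exists (s ++ t) => // r [ur sr].
by split; split => // y yr; apply: sr; rewrite mem_cat yr ?orbT.
Qed.

End ExhaustingFilter.

Section SquareSummable.
Context {R : realType} {Y : choiceType}.
Implicit Types (f g : Y -> R) (s t : seq Y).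

Definition psum f s : R := \sum_(y <- s) f y.

Lemma psum_subset_le f s t : (forall y, 0 <= f y) -> uniq s -> uniq t ->
  {subset s <= t} -> psum f s <= psum f t.
Proof.
move=> f0 us ut st.
rewrite /psum [leRHS](perm_big (s ++ [seq y <- t | y \notin s]))/=; last first.
  apply: uniq_perm => //.
    rewrite cat_uniq us filter_uniq// andbT.
    by apply/hasPn => y; rewrite mem_filter => /andP[].
  move=> y; rewrite mem_cat mem_filter.
  by have [/st ->|] := boolP (y \in s).
by rewrite big_cat lerDl sumr_ge0.
Qed.

Lemma psum_exhausting_cvg f (M : R) : (forall y, 0 <= f y) ->
  (forall s, uniq s -> psum f s <= M) -> cvg (psum f @ exhausting).
Proof.
move=> f0 fM; pose D := [set psum f s | s in [set s | uniq s]].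
have supD : has_sup D.
  split; first by exists (psum f [::]); exists [::].
  by exists M => _ [s us <-]; exact: fM.
apply/cvg_ex; exists (sup D); apply/cvgrPdist_lt => e e0.
have [_ [s us <-] ltD] := sup_adherent e0 supD.
exists s => // t [ut st] /=.
have ts : psum f s <= psum f t by exact: psum_subset_le.
have tD : psum f t <= sup D by apply: sup_upper_bound => //; exists t.
rewrite ger0_norm ?subr_ge0// ltrBlDl -ltrBlDr.
exact: lt_le_trans ts.
Qed.

Definition square_summable f :=
  exists M, forall s, uniq s -> psum (fun y => f y ^+ 2) s <= M.

Lemma square_summableD f g :
  square_summable f -> square_summable g -> square_summable (f \+ g).
Proof.
move=> [M fM] [N gN]; exists (2 * M + 2 * N) => s us.
apply: (@le_trans _ _ (2 * psum (fun y => f y ^+ 2) s + 2 * psum (fun y => g y ^+ 2) s)).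
  rewrite /psum !mulr_sumr -big_split/=; apply: ler_sum => y _.
  by have := sqr_ge0 (f y - g y); nra.
by rewrite lerD// ler_wpM2l// ?fM ?gN.
Qed.

Lemma square_summableZ (c : R) f : square_summable f -> square_summable (c \*: f).
Proof.
move=> [M fM]; exists (c ^+ 2 * M) => s us.
rewrite /psum; under eq_bigr do rewrite exprMn.
by rewrite -mulr_sumr ler_wpM2l ?sqr_ge0// fM.
Qed.

(** Convergence is so far known for nonnegative terms only; polarization writes f g as half of (f +
    g)^2 - f^2 - g^2. *)
Lemma psum_mul_cvg f g : square_summable f -> square_summable g ->
  cvg (psum (f \* g) @ exhausting).
Proof.
move=> sf sg; have [L sfg] := square_summableD sf sg.
have sqc h : square_summable h -> cvg (psum (fun y => h y ^+ 2) @ exhausting).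
  by move=> [M hM]; apply: psum_exhausting_cvg hM => y; exact: sqr_ge0.
have -> : psum (f \* g) = fun s => 2^-1 * (psum (fun y => (f \+ g) y ^+ 2) s
    - psum (fun y => f y ^+ 2) s - psum (fun y => g y ^+ 2) s).
  apply/funext => s; rewrite /psum -!sumrB mulr_sumr.
  by apply: eq_bigr => y _ /=; field.
apply: is_cvgMr; apply: is_cvgB; last exact: sqc.
by apply: is_cvgB; apply: sqc => //; exists L.
Qed.

End SquareSummable.

Section L2.
Variables (R : realType) (Y : choiceType).

Definition square_summable_pred : {pred (Y -> R)} := fun f => `[< square_summable f >].

Lemma square_summable_submod : submod_closed square_summable_pred.
Proof.
split=> [|c f g /asboolP sf /asboolP sg]; apply/asboolP.
  by exists 0 => s _; rewrite /psum big1// => y _; rewrite expr0n.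
exact: square_summableD (square_summableZ c sf) sg.
Qed.

HB.instance Definition _ :=
  GRing.isSubmodClosed.Build R (Y -> R) square_summable_pred square_summable_submod.

Record l2 := L2 { l2_val :> Y -> R; l2P : l2_val \in square_summable_pred }.

HB.instance Definition _ := [isSub for l2_val].
HB.instance Definition _ := [Choice of l2 by <:].
HB.instance Definition _ := [SubChoice_isSubLmodule of l2 by <:].

End L2.

Section InnerProduct.
Context {R : realType} {Y : choiceType}.
Local Notation H := (l2 R Y).
Implicit Types f g h : H.

Lemma l2_square_summable f : square_summable f.
Proof. by have /asboolP := l2P f. Qed.

Definition ip f g : R := lim (psum ((f : Y -> R) \* g) @ exhausting).

Lemma ip_cvg f g : psum ((f : Y -> R) \* g) @ exhausting --> ip f g.
Proof. by apply: psum_mul_cvg; exact: l2_square_summable. Qed.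

Lemma ip_unique f g l : psum ((f : Y -> R) \* g) @ exhausting --> l -> ip f g = l.
Proof. by move=> /cvg_lim; apply. Qed.

Lemma ipC f g : ip f g = ip g f.
Proof.
apply: ip_unique.
rewrite (_ : (f : Y -> R) \* g = (g : Y -> R) \* f); first exact: ip_cvg.
by apply/funext => y /=; rewrite mulrC.
Qed.

Lemma ipDl f g h : ip (f + g) h = ip f h + ip g h.
Proof.
apply: ip_unique.
rewrite (_ : psum _ = psum ((f : Y -> R) \* h) \+ psum ((g : Y -> R) \* h)).
  by apply: cvgD; exact: ip_cvg.
apply/funext => s; rewrite /psum /= -big_split; apply: eq_bigr => y _ /=.
by rewrite mulrDl.
Qed.

Lemma ipZl c f g : ip (c *: f) g = c * ip f g.
Proof.
apply: ip_unique.
rewrite (_ : psum _ = fun s => c * psum ((f : Y -> R) \* g) s).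
  by apply: cvgM; [exact: cvg_cst|exact: ip_cvg].
apply/funext => s; rewrite /psum mulr_sumr; apply: eq_bigr => y _ /=.
by rewrite mulrA.
Qed.

Lemma ipNl f g : ip (- f) g = - ip f g.
Proof. by rewrite -scaleN1r ipZl mulN1r. Qed.

Lemma ipBl f g h : ip (f - g) h = ip f h - ip g h.
Proof. by rewrite ipDl ipNl. Qed.

Lemma ipDr f g h : ip h (f + g) = ip h f + ip h g.
Proof. by rewrite ipC ipDl !(ipC h). Qed.

Lemma ipZr c f g : ip f (c *: g) = c * ip f g.
Proof. by rewrite ipC ipZl ipC. Qed.

Lemma ipNr f g : ip f (- g) = - ip f g.
Proof. by rewrite ipC ipNl ipC. Qed.

Lemma ipBr f g h : ip h (f - g) = ip h f - ip h g.
Proof. by rewrite ipDr ipNr. Qed.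

Lemma psum_le_ip f s : uniq s -> psum (fun y => f y ^+ 2) s <= ip f f.
Proof.
move=> us; apply: (cvgr_to_ge (@ip_cvg f f)); exists s => // t [ut st].
rewrite [leRHS](_ : _ = psum (fun y => f y ^+ 2) t) //.
by apply: psum_subset_le => // y; exact: sqr_ge0.
Qed.

Lemma ip_le f (M : R) :
  (forall s, uniq s -> psum (fun y => f y ^+ 2) s <= M) -> ip f f <= M.
Proof.
move=> fM; apply: (cvgr_to_le (@ip_cvg f f)); exists [::] => // t [ut _].
by rewrite [leLHS](_ : _ = psum (fun y => f y ^+ 2) t) ?fM.
Qed.

Lemma ip_ge0 f : 0 <= ip f f.
Proof. by have := @psum_le_ip f [::] isT; rewrite /psum big_nil. Qed.

Lemma sqr_le_ip f y : f y ^+ 2 <= ip f f.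
Proof. by have := @psum_le_ip f [:: y] isT; rewrite /psum big_seq1. Qed.

Lemma ip_eq0 f : ip f f = 0 -> f = 0.
Proof.
move=> f0; apply/val_inj/funext => y /=; apply/eqP.
by rewrite -sqrf_eq0 eq_le sqr_ge0 -f0 sqr_le_ip.
Qed.

Lemma ip_inj f g : (forall h, ip h f = ip h g) -> f = g.
Proof.
by move=> fg; apply/eqP; rewrite -subr_eq0; apply/eqP/ip_eq0; rewrite ipBr fg subrr.
Qed.

Definition l2norm f : R := Num.sqrt (ip f f).

Lemma l2norm_ge0 f : 0 <= l2norm f.
Proof. exact: sqrtr_ge0. Qed.

Lemma l2norm_sqr f : l2norm f ^+ 2 = ip f f.
Proof. by rewrite sqr_sqrtr// ip_ge0. Qed.

Lemma cauchy_schwarz f g : `|ip f g| <= l2norm f * l2norm g.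
Proof.
rewrite -(@ler_pXn2r _ 2) ?nnegrE ?mulr_ge0 ?l2norm_ge0//.
rewrite exprMn !l2norm_sqr real_normK ?num_real//.
have [f0|f0] := eqVneq (ip f f) 0.
  by rewrite (ip_eq0 f0) -(scale0r (0 : H)) !ipZl !mul0r expr0n.
have fp : 0 < ip f f by rewrite lt_def f0 ip_ge0.
have := ip_ge0 (ip f f *: g - ip f g *: f).
rewrite !ipBl !ipBr !ipZl !ipZr (ipC g f).
have -> : ip f f * (ip f f * ip g g) - ip f f * (ip f g * ip f g)
   - (ip f g * (ip f f * ip f g) - ip f g * (ip f g * ip f f))
   = ip f f * (ip f f * ip g g - ip f g ^+ 2) by ring.
by rewrite pmulr_rge0// subr_ge0.
Qed.

Lemma ip_le_norm f g : ip f g <= l2norm f * l2norm g.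
Proof. exact: le_trans (ler_norm _) (cauchy_schwarz f g). Qed.

Lemma l2normD f g : l2norm (f + g) <= l2norm f + l2norm g.
Proof.
rewrite -(@ler_pXn2r _ 2) ?nnegrE ?addr_ge0 ?l2norm_ge0//.
rewrite sqrrD !l2norm_sqr ipDl !ipDr (ipC g f).
by have := ip_le_norm f g; lra.
Qed.

Lemma l2norm0 : l2norm 0 = 0.
Proof. by rewrite /l2norm -(scale0r (0 : H)) ipZl mul0r sqrtr0. Qed.

Lemma l2norm_eq0 f : l2norm f = 0 -> f = 0.
Proof. by move=> f0; apply: ip_eq0; rewrite -l2norm_sqr f0 expr0n. Qed.

Lemma l2normN f : l2norm (- f) = l2norm f.
Proof. by rewrite /l2norm ipNl ipNr opprK. Qed.

Lemma l2normZ c f : l2norm (c *: f) = `|c| * l2norm f.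
Proof. by rewrite /l2norm ipZl ipZr mulrA -expr2 sqrtrM ?sqr_ge0// sqrtr_sqr. Qed.

Lemma l2norm_le f M : 0 <= M -> ip f f <= M ^+ 2 -> l2norm f <= M.
Proof. by move=> M0 fM; rewrite -(ger0_norm M0) -sqrtr_sqr ler_wsqrtr. Qed.

Lemma coord_le_norm f y : `|f y| <= l2norm f.
Proof. by rewrite -sqrtr_sqr ler_wsqrtr// sqr_le_ip. Qed.

Definition l2_delta_fun (y : Y) : Y -> R := fun z => (z == y)%:R.

Lemma l2_delta_subproof y : l2_delta_fun y \in @square_summable_pred R Y.
Proof.
apply/asboolP; exists 1 => s us; rewrite /psum.
have [ys|ys] := boolP (y \in s).
  rewrite (bigD1_seq y)//= /l2_delta_fun eqxx expr1n big1 ?addr0//.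
  by move=> z /negPf ->; rewrite expr0n.
rewrite big1_seq// => z /= zs; rewrite /l2_delta_fun.
by case: eqP zs ys => [->->//|]; rewrite expr0n.
Qed.

Definition l2_delta y : H := L2 (l2_delta_subproof y).

Lemma l2_deltaE y z : l2_delta y z = (z == y)%:R.
Proof. by []. Qed.

End InnerProduct.

Section PartialBijections.
Context {R : realType} {Y : choiceType}.
Implicit Types phi psi : Y -> option Y.

(** A partial bijection comes together with its inverse, because composition with the inverse is the
    adjoint of composition with the map. *)
Definition pinvmap phi psi := forall y z, phi y = Some z <-> psi z = Some y.

Lemma pinvmapC phi psi : pinvmap phi psi -> pinvmap psi phi.
Proof. by move=> pq y z; split=> /pq. Qed.

Definition pull_fun phi (f : Y -> R) : Y -> R := fun y => oapp f 0 (phi y).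

Lemma pmap_uniq_pinv phi psi s : pinvmap phi psi -> uniq s -> uniq (pmap phi s).
Proof.
move=> pq; elim: s => //= y s IH /andP[ys /IH us].
case E : (phi y) => [z|]//=; rewrite us andbT mem_pmap.
apply: contra ys => /mapP[x xs /esym/pq]; move/pq: E => ->.
by case=> ->.
Qed.

Lemma sum_pmap phi (F : Y -> R) s :
  \sum_(y <- s) oapp F 0 (phi y) = \sum_(z <- pmap phi s) F z.
Proof.
elim: s => [|y s IH]; first by rewrite !big_nil.
by rewrite big_cons IH /=; case: (phi y) => [z|]/=; rewrite ?big_cons ?add0r.
Qed.

Lemma pull_subproof phi psi (f : l2 R Y) : pinvmap phi psi ->
  pull_fun phi f \in @square_summable_pred R Y.
Proof.
move=> pq; apply/asboolP; exists (ip f f) => s us.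
rewrite /psum (eq_bigr (fun y => oapp (fun z => f z ^+ 2) 0 (phi y))); last first.
  by move=> y _; rewrite /pull_fun; case: (phi y) => //=; rewrite expr0n.
by rewrite sum_pmap psum_le_ip// (pmap_uniq_pinv pq).
Qed.

Definition pull phi psi (pq : pinvmap phi psi) (f : l2 R Y) : l2 R Y :=
  L2 (pull_subproof f pq).

Lemma pullE phi psi (pq : pinvmap phi psi) f y :
  pull pq f y = oapp f 0 (phi y).
Proof. by []. Qed.

Lemma ip_pull phi psi (pq : pinvmap phi psi) f g :
  ip (pull pq f) g = ip f (pull (pinvmapC pq) g).
Proof.
apply/eqP; rewrite -subr_eq0 -normr_le0; apply/ler_addgt0Pr => e e0.
have e2 : 0 < e / 2 by rewrite divr_gt0.
have /cvgrPdist_lt/(_ _ e2)[s _ sP] := @ip_cvg R Y (pull pq f) g.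
have /cvgrPdist_lt/(_ _ e2)[t _ tP] := @ip_cvg R Y f (pull (pinvmapC pq) g).
(* Both inner products are approximated on finite sets that correspond under [phi]. The set [s']
   contains [s] and the preimages of [t]; [t'] is the image of [s'] together with the points of [t]
   outside the domain of [psi], where the terms vanish. The two partial sums are then equal. *)
pose s' := undup (s ++ pmap psi t).
pose t' := pmap phi s' ++ [seq z <- undup t | ~~ psi z].
have us' : uniq s' by exact: undup_uniq.
have /sP {sP} : [set r | uniq r /\ {subset s <= r}] s'.
  by split=> // y ys; rewrite mem_undup mem_cat ys.
have /tP {tP} : [set r | uniq r /\ {subset t <= r}] t'.
  split.
    rewrite cat_uniq (pmap_uniq_pinv pq)// filter_uniq ?undup_uniq// andbT.
    apply/hasPn => z; rewrite mem_filter => /andP[zp _]; apply: contra zp.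
    by rewrite mem_pmap => /mapP[y _ /esym/pq ->].
  move=> z zt; rewrite mem_cat mem_filter mem_undup zt andbT.
  case E : (psi z) => [y|]; last by rewrite orbT.
  rewrite orbF mem_pmap; apply/mapP; exists y; last by apply/esym/pq.
  rewrite mem_undup mem_cat mem_pmap; apply/orP; right; apply/mapP.
  by exists z.
have -> : psum ((f : Y -> R) \* pull (pinvmapC pq) g) t' =
          psum ((pull pq f : Y -> R) \* g) s'.
  rewrite /psum big_cat/= [X in _ + X]big1_seq ?addr0; last first.
    move=> z; rewrite mem_filter /= /pull_fun => /andP[+ _].
    by case: (psi z) => //=; rewrite mulr0.
  rewrite -sum_pmap; apply: eq_bigr => y _ /=; rewrite /pull_fun.
  case E : (phi y) => [z|] /=; last by rewrite mul0r.
  by move/pq: E => ->.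
set a := psum _ _; move=> h1 h2.
rewrite (_ : _ - _ = (ip (pull pq f) g - a) - (ip f (pull (pinvmapC pq) g) - a)); last by ring.
rewrite add0r (le_trans (ler_normB _ _))//; lra.
Qed.

End PartialBijections.

(** * The C*-algebra of bounded operators *)

(* Complex Hilbert space structure on the real space [l2 R (X * bool)]: [J] is
   the multiplication by [i]. *)
Section ComplexStructure.
Context {R : realType} {X : choiceType}.
Local Notation H := (l2 R (X * bool)%type).
Implicit Types f g : H.

Definition flip (y : X * bool) : option (X * bool) := Some (y.1, ~~ y.2).

Lemma flip_pinv : pinvmap flip flip.
Proof. by move=> [x b] [z c]; split=> -[<- <-]; rewrite /flip /= negbK. Qed.

Definition signed_fun (f : X * bool -> R) : X * bool -> R :=
  fun y => (-1) ^+ (~~ y.2) * f y.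

Lemma signed_subproof f : signed_fun f \in @square_summable_pred R (X * bool)%type.
Proof.
apply/asboolP; exists (ip f f) => s us.
rewrite /psum (eq_bigr (fun y => f y ^+ 2)); first exact: psum_le_ip.
by move=> y _; rewrite /signed_fun exprMn sqrr_sign mul1r.
Qed.

Definition signed f : H := L2 (signed_subproof f).

Lemma ip_signed f g : ip (signed f) g = ip f (signed g).
Proof.
apply: ip_unique.
rewrite (_ : (signed f : _ -> R) \* g = (f : _ -> R) \* signed g); first exact: ip_cvg.
by apply/funext => y /=; rewrite /signed_fun mulrCA mulrA.
Qed.

(** The coordinate [(x, false)] holds the real part and [(x, true)] the imaginary part of the value
    at [x]. *)
Definition J f : H := signed (pull flip_pinv f).

Lemma JE f x b : J f (x, b) = (-1) ^+ (~~ b) * f (x, ~~ b).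
Proof. by []. Qed.

Lemma l2_oppE f y : (- f : H) y = - f y. Proof. by []. Qed.
Lemma l2_addE f g y : (f + g : H) y = f y + g y. Proof. by []. Qed.
Lemma l2_scaleE c f y : (c *: f : H) y = c * f y. Proof. by []. Qed.

Lemma ip_J f g : ip (J f) g = - ip f (J g).
Proof.
rewrite ip_signed ip_pull -ipNr; congr (ip _ _).
apply/val_inj/funext => -[x b].
rewrite [LHS]/= /pull_fun /= /signed_fun /= -[RHS]/((- J g) (x, b)) l2_oppE JE.
by case: b => /=; rewrite ?expr0 ?expr1 ?mul1r ?mulN1r ?opprK.
Qed.

Lemma JJ f : J (J f) = - f.
Proof.
apply/val_inj/funext => -[x b].
rewrite -[LHS]/(J (J f) (x, b)) -[RHS]/((- f) (x, b)) !JE l2_oppE negbK.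
by case: b => /=; rewrite ?expr0 ?expr1 ?mul1r ?mulN1r.
Qed.

Lemma JD f g : J (f + g) = J f + J g.
Proof.
apply/val_inj/funext => -[x b].
rewrite -[LHS]/(J (f + g) (x, b)) -[RHS]/((J f + J g) (x, b)).
by rewrite l2_addE !JE l2_addE mulrDr.
Qed.

Lemma JZ c f : J (c *: f) = c *: J f.
Proof.
apply/val_inj/funext => -[x b].
rewrite -[LHS]/(J (c *: f) (x, b)) -[RHS]/((c *: J f) (x, b)).
by rewrite l2_scaleE !JE l2_scaleE mulrCA.
Qed.

Lemma JN f : J (- f) = - J f.
Proof. by rewrite -scaleN1r JZ scaleN1r. Qed.

Lemma ip_JJ f g : ip (J f) (J g) = ip f g.
Proof. by rewrite ip_J JJ ipNr opprK. Qed.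

Lemma ip_J_self f : ip f (J f) = 0.
Proof. by have := ip_J f f; rewrite ipC; lra. Qed.

Lemma l2norm_J f : l2norm (J f) = l2norm f.
Proof. by rewrite /l2norm ip_JJ. Qed.

End ComplexStructure.

Section BoundedOperators.
Variables (R : realType) (X : choiceType).
Local Notation H := (l2 R (X * bool)%type).
Implicit Types f g : H.

(** Carrying the adjoint as data replaces an appeal to Riesz representation. Its existence forces
    real linearity, and commutation with [J] makes the operator complex linear. *)
Record bop := Bop {
  bop_fun :> H -> H;
  bop_adj : H -> H;
  bop_ip : forall f g, ip (bop_fun f) g = ip f (bop_adj g);
  bop_bounded : exists M, forall f, l2norm (bop_fun f) <= M * l2norm f;
  bop_J : forall f, bop_fun (J f) = J (bop_fun f) }.

HB.instance Definition _ := gen_eqMixin bop.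
HB.instance Definition _ := gen_choiceMixin bop.

Implicit Types S T : bop.

Lemma bop_ip_adj T f g : ip (bop_adj T f) g = ip f (T g).
Proof. by rewrite ipC -bop_ip ipC. Qed.

Lemma bop_ext S T : (forall f, S f = T f) -> S = T.
Proof.
move=> ST; have E1 : bop_fun S = bop_fun T by apply/funext.
have E2 : bop_adj S = bop_adj T.
  by apply/funext => f; apply: ip_inj => h; rewrite -!bop_ip ST.
case: S T E1 E2 {ST} => s s' a b c [t t' a' b' c'] /= E1 E2.
by rewrite {}E1 {}E2 in a b c *; congr Bop; exact: Prop_irrelevance.
Qed.

Lemma bopD T f g : T (f + g) = T f + T g.
Proof. by apply: ip_inj => h; rewrite -bop_ip_adj !ipDr !bop_ip_adj. Qed.

Lemma bopZ T c f : T (c *: f) = c *: T f.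
Proof. by apply: ip_inj => h; rewrite -bop_ip_adj !ipZr !bop_ip_adj. Qed.

Lemma bop0 T : T 0 = 0.
Proof. by rewrite -(scale0r (0 : H)) bopZ !scale0r. Qed.

Lemma bop_bounded_ge0 T :
  exists2 M, 0 <= M & forall f, l2norm (T f) <= M * l2norm f.
Proof.
have [M TM] := bop_bounded T; exists (Num.max 0 M); first by rewrite le_max lexx.
move=> f; apply: le_trans (TM f) _.
by rewrite ler_wpM2r ?l2norm_ge0// le_max lexx orbT.
Qed.

(** With T* the adjoint, |T* f|^2 = <f, T T* f> <= |f| M |T* f|, and |T* f| cancels unless it is
    zero. *)
Lemma bop_adj_le T (M : R) : 0 <= M -> (forall f, l2norm (T f) <= M * l2norm f) ->
  forall f, l2norm (bop_adj T f) <= M * l2norm f.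
Proof.
move=> M0 TM f; set g := bop_adj T f.
have [g0|g0] := eqVneq (l2norm g) 0; first by rewrite g0 mulr_ge0 ?l2norm_ge0.
have gp : 0 < l2norm g by rewrite lt_def g0 l2norm_ge0.
rewrite -(ler_pM2r gp) -expr2 l2norm_sqr {1}/g bop_ip_adj.
apply: le_trans (ip_le_norm _ _) _.
by rewrite [M * _]mulrC -mulrA ler_wpM2l ?l2norm_ge0.
Qed.

Lemma bop_adj_J T f : bop_adj T (J f) = J (bop_adj T f).
Proof.
by apply: ip_inj => h; rewrite -bop_ip -[RHS]opprK -ip_J -bop_ip bop_J ip_J opprK.
Qed.

Lemma bop_adj_bounded T : exists M, forall f, l2norm (bop_adj T f) <= M * l2norm f.
Proof.
by have [M M0 TM] := bop_bounded_ge0 T; exists M; exact: bop_adj_le.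
Qed.

Definition bstar T : bop :=
  Bop (@bop_ip_adj T) (bop_adj_bounded T) (bop_adj_J T).

Lemma bcomp_ip S T f g : ip (S (T f)) g = ip f (bop_adj T (bop_adj S g)).
Proof. by rewrite !bop_ip. Qed.

Lemma bcomp_bounded S T : exists M, forall f, l2norm (S (T f)) <= M * l2norm f.
Proof.
have [M M0 SM] := bop_bounded_ge0 S; have [N N0 TN] := bop_bounded_ge0 T.
exists (M * N) => f; rewrite -mulrA; apply: le_trans (SM _) _.
by rewrite ler_wpM2l.
Qed.

Lemma bcomp_J S T f : S (T (J f)) = J (S (T f)).
Proof. by rewrite !bop_J. Qed.

Definition bcomp S T : bop := Bop (bcomp_ip S T) (bcomp_bounded S T) (bcomp_J S T).

Lemma badd_ip S T f g : ip (S f + T f) g = ip f (bop_adj S g + bop_adj T g).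
Proof. by rewrite ipDl ipDr !bop_ip. Qed.

Lemma badd_bounded S T : exists M, forall f, l2norm (S f + T f) <= M * l2norm f.
Proof.
have [M M0 SM] := bop_bounded_ge0 S; have [N N0 TN] := bop_bounded_ge0 T.
by exists (M + N) => f; rewrite mulrDl (le_trans (l2normD _ _))// lerD.
Qed.

Lemma badd_J S T f : S (J f) + T (J f) = J (S f + T f).
Proof. by rewrite !bop_J JD. Qed.

Definition badd S T : bop := Bop (badd_ip S T) (badd_bounded S T) (badd_J S T).

Lemma bzero_ip f g : ip (0 : H) g = ip f 0.
Proof. by rewrite -(scale0r (0 : H)) ipZl ipZr !mul0r. Qed.

Lemma bzero_bounded : exists M, forall f, l2norm (0 : H) <= M * l2norm f.
Proof. by exists 0 => f; rewrite l2norm0 mul0r. Qed.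

Lemma bzero_J f : 0 = J (0 : H).
Proof. by rewrite -(scale0r (0 : H)) JZ !scale0r. Qed.

Definition bzero : bop := Bop bzero_ip bzero_bounded bzero_J.

Definition cplx_scale (c : R[i]) f : H := complex.Re c *: f + complex.Im c *: J f.

(** [J f] is orthogonal to [f] and has the same norm, so Pythagoras applies. *)
Lemma cplx_scale_norm c f : l2norm (cplx_scale c f) = complex.Re `|c| * l2norm f.
Proof.
rewrite /l2norm /cplx_scale ipDl !ipDr !ipZl !ipZr ip_JJ (ipC (J f)) ip_J_self.
rewrite !mulr0 addr0 add0r !mulrA -mulrDl -!expr2.
by rewrite sqrtrM ?addr_ge0 ?sqr_ge0// normc_def.
Qed.

Lemma bscale_ip c T f g :
  ip (cplx_scale c (T f)) g = ip f (cplx_scale (Num.conj c) (bop_adj T g)).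
Proof.
case: c => a b; rewrite /cplx_scale ipDl ipDr !ipZl !ipZr ip_J -bop_adj_J -!bop_ip.
by rewrite mulrN mulNr.
Qed.

Lemma bscale_bounded c T : exists M, forall f, l2norm (cplx_scale c (T f)) <= M * l2norm f.
Proof.
have [M M0 TM] := bop_bounded_ge0 T; exists (complex.Re `|c| * M) => f.
rewrite cplx_scale_norm -mulrA ler_wpM2l//.
by rewrite -ler0c RRe_real// normr_real.
Qed.

Lemma bscale_J c T f : cplx_scale c (T (J f)) = J (cplx_scale c (T f)).
Proof. by rewrite /cplx_scale JD !JZ !bop_J. Qed.

Definition bscale c T : bop :=
  Bop (bscale_ip c T) (bscale_bounded c T) (bscale_J c T).

End BoundedOperators.

Section BoundedOperatorAlgebra.
Variables (R : realType) (X : choiceType).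
Local Notation H := (l2 R (X * bool)%type).
Local Notation bop := (bop R X).
Implicit Types (f g : H) (S T : bop).

Lemma l2_ext f g : (forall y, f y = g y) -> f = g.
Proof. by move=> fg; apply/val_inj/funext. Qed.

Let l2E := (@l2_addE R X, @l2_scaleE R X, @l2_oppE R X).

Lemma cplx_scaleA a b f : cplx_scale a (cplx_scale b f) = cplx_scale (a * b) f.
Proof.
case: a b => a1 a2 [b1 b2]; rewrite /cplx_scale JD !JZ JJ /=; apply: l2_ext => y.
by rewrite !l2E; ring.
Qed.

Lemma cplx_scale1 f : cplx_scale 1 f = f.
Proof. by rewrite /cplx_scale/= scale1r scale0r addr0. Qed.

Lemma cplx_scaleDl a b f : cplx_scale (a + b) f = cplx_scale a f + cplx_scale b f.
Proof.
case: a b => a1 a2 [b1 b2]; rewrite /cplx_scale /=; apply: l2_ext => y.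
by rewrite !l2E; ring.
Qed.

Lemma cplx_scaleDr a f g : cplx_scale a (f + g) = cplx_scale a f + cplx_scale a g.
Proof.
case: a => a1 a2; rewrite /cplx_scale JD /=; apply: l2_ext => y.
by rewrite !l2E; ring.
Qed.

Lemma bop_cplx_scale T a f : T (cplx_scale a f) = cplx_scale a (T f).
Proof. by rewrite /cplx_scale bopD !bopZ bop_J. Qed.

Lemma cplx_scaleN1 f : cplx_scale (- 1) f = - f.
Proof. by rewrite /cplx_scale/= oppr0 scale0r addr0 scaleN1r. Qed.

Lemma baddA : associative (@badd R X).
Proof. by move=> S T U; apply: bop_ext => f /=; rewrite addrA. Qed.

Lemma baddC : commutative (@badd R X).
Proof. by move=> S T; apply: bop_ext => f /=; rewrite addrC. Qed.

Lemma badd0 : left_id (bzero R X) (@badd R X).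
Proof. by move=> S; apply: bop_ext => f /=; rewrite add0r. Qed.

Lemma baddN : left_inverse (bzero R X) (@bscale R X (- 1)) (@badd R X).
Proof. by move=> S; apply: bop_ext => f /=; rewrite cplx_scaleN1 addNr. Qed.

HB.instance Definition _ := GRing.isZmodule.Build bop baddA baddC badd0 baddN.

Lemma bscaleA a b T : bscale a (bscale b T) = bscale (a * b) T.
Proof. by apply: bop_ext => f /=; exact: cplx_scaleA. Qed.

Lemma bscale1 : left_id 1 (@bscale R X).
Proof. by move=> T; apply: bop_ext => f /=; exact: cplx_scale1. Qed.

Lemma bscaleDr : right_distributive (@bscale R X) +%R.
Proof. by move=> a S T; apply: bop_ext => f /=; exact: cplx_scaleDr. Qed.

Lemma bscaleDl T : {morph (@bscale R X)^~ T : a b / a + b}.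
Proof. by move=> a b; apply: bop_ext => f /=; exact: cplx_scaleDl. Qed.

HB.instance Definition _ := GRing.Zmodule_isLmodule.Build R[i] bop
  bscaleA bscale1 bscaleDr bscaleDl.

Definition opnorm T : R := sup [set l2norm (T f) | f in [set f | l2norm f <= 1]].

Lemma opnorm_has_sup T : has_sup [set l2norm (T f) | f in [set f | l2norm f <= 1]].
Proof.
split; first by exists (l2norm (T 0)); exists 0 => //=; rewrite l2norm0.
have [M M0 TM] := bop_bounded_ge0 T; exists M => _ [f f1 <-].
by rewrite (le_trans (TM f))// ler_piMr.
Qed.

Lemma opnorm_ge0 T : 0 <= opnorm T.
Proof.
apply: (le_trans (l2norm_ge0 (T 0))); apply: sup_upper_bound (opnorm_has_sup T) _ _.
by exists 0 => //=; rewrite l2norm0.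
Qed.

Lemma l2norm_bop_le T f : l2norm (T f) <= opnorm T * l2norm f.
Proof.
have [/eqP/l2norm_eq0 ->|f0] := boolP (l2norm f == 0).
  by rewrite bop0 l2norm0 mulr0.
have fp : 0 < l2norm f by rewrite lt_def f0 l2norm_ge0.
have fV : 0 <= (l2norm f)^-1 by rewrite invr_ge0 ltW.
rewrite -ler_pdivrMr// mulrC -{1}(ger0_norm fV) -l2normZ -bopZ.
apply: sup_upper_bound (opnorm_has_sup T) _ _.
by exists ((l2norm f)^-1 *: f) => //=; rewrite l2normZ ger0_norm// mulVf.
Qed.

Lemma opnorm_le T M : 0 <= M -> (forall f, l2norm (T f) <= M * l2norm f) ->
  opnorm T <= M.
Proof.
move=> M0 TM; apply: ge_sup; first by case: (opnorm_has_sup T).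
by move=> _ [f f1 <-]; rewrite (le_trans (TM f))// ler_piMr.
Qed.

Lemma opnormD S T : opnorm (S + T) <= opnorm S + opnorm T.
Proof.
apply: opnorm_le => [|f]; first by rewrite addr_ge0 ?opnorm_ge0.
by rewrite (le_trans (l2normD _ _))// mulrDl lerD ?l2norm_bop_le.
Qed.

Lemma opnormZ_le c T : opnorm (c *: T) <= complex.Re `|c| * opnorm T.
Proof.
have c0 : 0 <= complex.Re `|c| by rewrite -ler0c RRe_real// normr_real.
apply: opnorm_le => [|f]; first by rewrite mulr_ge0 ?opnorm_ge0.
by rewrite /= cplx_scale_norm -mulrA ler_wpM2l// l2norm_bop_le.
Qed.

Lemma opnorm0_eq0 T : opnorm T = 0 -> T = 0.
Proof.
move=> T0; apply: bop_ext => f; apply: l2norm_eq0; apply/eqP.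
by rewrite eq_le l2norm_ge0 andbT -(mul0r (l2norm f)) -T0 l2norm_bop_le.
Qed.

Definition bnorm T : R[i] := (opnorm T)%:C%C.

Lemma bnormD S T : bnorm (S + T) <= bnorm S + bnorm T.
Proof. by rewrite /bnorm -(rmorphD (real_complex R)) lecR opnormD. Qed.

Lemma bnorm0_eq0 T : bnorm T = 0 -> T = 0.
Proof. by move=> /(congr1 (@complex.Re _)); exact: opnorm0_eq0. Qed.

Lemma bnormZ c T : bnorm (c *: T) = `|c| * bnorm T.
Proof.
have le_norm (d : R[i]) (S : bop) : bnorm (d *: S) <= `|d| * bnorm S.
  rewrite /bnorm -[`|d|]RRe_real ?normr_real//.
  by rewrite -(rmorphM (real_complex R)) lecR opnormZ_le.
apply/eqP; rewrite eq_le le_norm/=.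
have [->|c0] := eqVneq c 0.
  by rewrite normr0 mul0r /bnorm ler0c opnorm_ge0.
rewrite -{1}[T]scale1r -(mulVf c0) -scalerA.
by rewrite (le_trans (ler_wpM2l _ (le_norm _ _)))// mulrA -normrM mulfV// normr1 mul1r.
Qed.

HB.instance Definition _ := Lmodule_isNormed.Build R[i] bop bnormD bnormZ bnorm0_eq0.

Lemma opnorm_bstar_le T : opnorm (bstar T) <= opnorm T.
Proof.
by apply: opnorm_le; [exact: opnorm_ge0|apply: bop_adj_le; [exact: opnorm_ge0|exact: l2norm_bop_le]].
Qed.

Lemma norm_bopE T : `|T| = (opnorm T)%:C%C.
Proof. by []. Qed.

Lemma bop_subE S T f : (S - T) f = S f - T f.
Proof. by rewrite /= cplx_scaleN1. Qed.

Lemma bop_adj_subE S T f : bop_adj (S - T) f = bop_adj S f - bop_adj T f.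
Proof.
apply: ip_inj => h.
by rewrite -bop_ip bop_subE ipBl ipBr !bop_ip.
Qed.

End BoundedOperatorAlgebra.

Section BoundedOperatorComplete.
Variables (R : realType) (X : choiceType).
Local Notation H := (l2 R (X * bool)%type).
Local Notation bop := (bop R X).
Implicit Types (f g : H) (S T : bop).

Lemma bstarB S T : bstar (S - T) = bstar S - bstar T.
Proof. by apply: bop_ext => f; rewrite bop_subE -bop_adj_subE. Qed.

Section CauchyFilter.
Variable F : set_system bop.
Context {FF : ProperFilter F}.

Let near_cauchy := forall e : R, 0 < e ->
  exists2 Q, F Q & forall S T, Q S -> Q T -> opnorm (S - T) <= e.

Section PointwiseLimit.
Hypothesis Fc : near_cauchy.

Definition limit_fun f (y : X * bool) : R := lim ((fun T : bop => T f y) @ F).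

Let limit_cvg f y : (fun T : bop => T f y) @ F --> limit_fun f y.
Proof.
have : cauchy ((fun T : bop => T f y) @ F).
  apply: cauchy_exP => e e0.
  have n0 : 0 < l2norm f + 1 by rewrite ltr_wpDl ?l2norm_ge0.
  have [Q FQ Qe] := Fc (divr_gt0 e0 n0).
  have [T QT] := filter_ex FQ; exists (T f y).
  rewrite /fmap/= -ball_normE; apply: (@filterS _ F _ Q) => // S QS /=.
  have -> : T f y - S f y = (T - S) f y by rewrite bop_subE.
  rewrite (le_lt_trans (coord_le_norm _ _))//.
  rewrite (le_lt_trans (l2norm_bop_le _ _))//.
  apply: (@le_lt_trans _ _ (e / (l2norm f + 1) * l2norm f)).
    by rewrite ler_wpM2r ?l2norm_ge0// Qe.
  by rewrite -mulrAC ltr_pdivrMr// ltr_pM2l// ltrDl.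
by move=> /cauchy_cvg; apply.
Qed.

(** A Fatou argument: on a finite list the bound survives the coordinatewise limit, and it does not
    depend on the list. It yields both that the limit is in l2 and that convergence holds in
    norm. *)
Let limit_psum_le (Q : set bop) (e : R) f T : F Q -> 0 <= e ->
  (forall S T, Q S -> Q T -> opnorm (S - T) <= e) -> Q T ->
  forall s, uniq s ->
    psum (fun y => (T f y - limit_fun f y) ^+ 2) s <= (e * l2norm f) ^+ 2.
Proof.
move=> FQ e0 Qe QT s us.
have lim_psum : (fun S : bop => psum (fun y => (T f y - S f y) ^+ 2) s) @ F -->
    psum (fun y => (T f y - limit_fun f y) ^+ 2) s.
  rewrite /psum; elim: s {us} => [|y s IH].
    by rewrite big_nil; under eq_fun do rewrite big_nil; exact: cvg_cst.
  rewrite big_cons; under eq_fun do rewrite big_cons; apply: cvgD IH.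
  have h : (fun S : bop => T f y - S f y) @ F --> T f y - limit_fun f y.
    by apply: cvgB; [exact: cvg_cst|exact: limit_cvg].
  exact: (cvgM h h).
apply: (cvgr_to_le lim_psum); apply: (@filterS _ F _ Q) => // S QS.
rewrite [leLHS](_ : _ = psum (fun y => ((T - S) f) y ^+ 2) s); last first.
  by apply: eq_bigr => y _; rewrite bop_subE.
rewrite (le_trans (psum_le_ip _ us))// -l2norm_sqr.
rewrite ler_pXn2r ?nnegrE ?l2norm_ge0 ?mulr_ge0 ?l2norm_ge0//.
rewrite (le_trans (l2norm_bop_le _ _))// ler_wpM2r ?l2norm_ge0//.
exact: Qe.
Qed.

Let limit_subproof f : limit_fun f \in @square_summable_pred R (X * bool)%type.
Proof.
have [Q FQ Qe] := Fc ltr01; have [T QT] := filter_ex FQ.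
have d2 : square_summable (fun y => T f y - limit_fun f y).
  by exists ((1 * l2norm f) ^+ 2); exact: limit_psum_le Qe QT.
apply/asboolP; rewrite (_ : limit_fun f =
  (T f : _ -> R) \+ ((-1) \*: (fun y => T f y - limit_fun f y))).
  apply: square_summableD; first exact: l2_square_summable.
  exact: square_summableZ.
by apply/funext => y /=; rewrite /GRing.scale/=; ring.
Qed.

Definition pointwise_limit f : H := L2 (limit_subproof f).

Lemma pointwise_limit_le (Q : set bop) (e : R) f T : F Q -> 0 <= e ->
  (forall S T, Q S -> Q T -> opnorm (S - T) <= e) -> Q T ->
  l2norm (T f - pointwise_limit f) <= e * l2norm f.
Proof.
move=> FQ e0 Qe QT; apply: l2norm_le; first by rewrite mulr_ge0 ?l2norm_ge0.
by apply: ip_le => s us; apply: limit_psum_le Qe QT _ us.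
Qed.

End PointwiseLimit.
End CauchyFilter.

(** An operator here needs an adjoint, so the pointwise limit is taken twice, along [F] and along
    the filter of adjoints. A single [T] close to both limits transfers the adjoint relation, the
    bound and commutation with [J]. *)
Lemma bop_complete (F : set_system bop) : ProperFilter F -> cauchy F -> cvg F.
Proof.
move=> FF Fc.
have Fe (e : R) : 0 < e ->
    exists2 Q, F Q & forall S T, Q S -> Q T -> opnorm (S - T) <= e.
  move=> e0.
  have /cauchy_ballP/(_ e%:C%C) := Fc; rewrite -[0]/(0%:C%C) ltcR => /(_ e0).
  case=> [[Q1 Q2] [FQ1 FQ2] QQ]; exists (Q1 `&` Q2); first exact: filterI.
  move=> S T [S1 _] [_ T2]; have := QQ (S, T) (conj S1 T2).
  by rewrite -ball_normE/= norm_bopE ltcR => /ltW.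
pose Fs := (@bstar R X) @ F.
have Fse (e : R) : 0 < e ->
    exists2 Q, Fs Q & forall S T, Q S -> Q T -> opnorm (S - T) <= e.
  move=> /Fe[Q FQ Qe]; exists [set T | Q (bstar T)].
    rewrite /Fs /=; apply: filterS FQ => T QT.
    by rewrite /= (_ : bstar (bstar T) = T)//; exact: bop_ext.
  move=> S T QS QT; have := Qe _ _ QS QT; rewrite -bstarB.
  apply: le_trans; rewrite [leLHS](_ : _ = opnorm (bstar (bstar (S - T)))).
    exact: opnorm_bstar_le.
  by congr opnorm; exact: bop_ext.
have FsP : ProperFilter Fs by exact: fmap_proper_filter.
pose L := @pointwise_limit F FF Fe; pose L' := @pointwise_limit Fs FsP Fse.
have Lclose (e : R) : 0 < e -> exists T : bop,
    (forall f, l2norm (T f - L f) <= e * l2norm f) /\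
    (forall f, l2norm (bop_adj T f - L' f) <= e * l2norm f).
  move=> e0; have [Q FQ Qe] := Fe _ e0; have [Q' FQ' Qe'] := Fse _ e0.
  have FbQ' : F ((@bstar R X) @^-1` Q') by exact: FQ'.
  have [T [QT QT']] := filter_ex (filterI FQ FbQ').
  exists T; split=> f; first exact: pointwise_limit_le FQ (ltW e0) Qe QT.
  exact: (@pointwise_limit_le Fs FsP Fse Q' e f (bstar T) FQ' (ltW e0) Qe' QT').
have small (a M : R) : 0 <= M -> (forall e, 0 < e -> `|a| <= e * M) -> a = 0.
  move=> M0 aM; apply/eqP; rewrite -normr_le0; apply/ler_addgt0Pr => e e0.
  have n0 : 0 < M + 1 by rewrite ltr_wpDl.
  rewrite add0r (le_trans (aM _ (divr_gt0 e0 n0)))//.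
  by rewrite -mulrAC ler_pdivrMr// ler_pM2l// lerDl.
have Lip f g : ip (L f) g = ip f (L' g).
  apply/eqP; rewrite -subr_eq0; apply/eqP.
  apply: (small _ (2 * (l2norm f * l2norm g))) => [|e e0].
    by rewrite !mulr_ge0 ?l2norm_ge0.
  have [T [T1 T2]] := Lclose _ e0.
  rewrite (_ : _ - _ = ip f (bop_adj T g - L' g) - ip (T f - L f) g).
    rewrite (le_trans (ler_normB _ _))//.
    have := le_trans (cauchy_schwarz f _) (ler_wpM2l (l2norm_ge0 f) (T2 g)).
    have := le_trans (cauchy_schwarz _ g) (ler_wpM2r (l2norm_ge0 g) (T1 f)).
    by nra.
  by rewrite ipBl ipBr bop_ip; ring.
have Lbd : exists M, forall f, l2norm (L f) <= M * l2norm f.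
  have [T [T1 _]] := Lclose _ ltr01; exists (1 + opnorm T) => f.
  rewrite -[L f](subrK (T f)) (le_trans (l2normD _ _))// mulrDl lerD//.
    by rewrite -l2normN opprB.
  exact: l2norm_bop_le.
have LJ f : L (J f) = J (L f).
  apply/eqP; rewrite -subr_eq0; apply/eqP/l2norm_eq0.
  apply: (small _ (2 * l2norm f)) => [|e e0]; first by rewrite mulr_ge0 ?l2norm_ge0.
  have [T [T1 _]] := Lclose _ e0; rewrite ger0_norm ?l2norm_ge0//.
  rewrite (_ : _ - _ = J (T f - L f) - (T (J f) - L (J f))).
    rewrite (le_trans (l2normD _ _))// l2normN l2norm_J.
    have := T1 f; have := T1 (J f); rewrite l2norm_J; lra.
  by rewrite JD JN bop_J opprB [RHS]addrC addrA subrK.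
apply/cvg_ex; exists (Bop Lip Lbd LJ).
apply/cvgrPdist_le => e /complex_gt0_real[r r0 ->].
have [Q FQ Qe] := Fe _ r0; apply: (@filterS _ F _ Q) => // T QT.
rewrite norm_bopE lecR; apply: opnorm_le; first exact: ltW.
move=> f; rewrite bop_subE -l2normN opprB.
exact: (@pointwise_limit_le F FF Fe Q r f T FQ (ltW r0) Qe QT).
Qed.

HB.instance Definition _ := Uniform_isComplete.Build bop bop_complete.

Lemma bcompA : associative (@bcomp R X).
Proof. by move=> S T U; exact: bop_ext. Qed.

Lemma bcompDl : left_distributive (@bcomp R X) +%R.
Proof. by move=> S T U; exact: bop_ext. Qed.

Lemma bcompDr : right_distributive (@bcomp R X) +%R.
Proof. by move=> S T U; apply: bop_ext => f /=; rewrite bopD. Qed.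

Lemma bscaleAl (c : R[i]) S T : c *: bcomp S T = bcomp (c *: S) T.
Proof. exact: bop_ext. Qed.

Lemma bscaleAr (c : R[i]) S T : c *: bcomp S T = bcomp S (c *: T).
Proof. by apply: bop_ext => f /=; rewrite bop_cplx_scale. Qed.

Lemma bcomp_norm S T : `|bcomp S T| <= `|S| * `|T|.
Proof.
rewrite !norm_bopE -(rmorphM (real_complex R)) lecR.
apply: opnorm_le => [|f]; first by rewrite mulr_ge0 ?opnorm_ge0.
rewrite (le_trans (l2norm_bop_le S _))// -mulrA.
by rewrite ler_wpM2l ?opnorm_ge0 ?l2norm_bop_le.
Qed.

Lemma bstarK : involutive (@bstar R X).
Proof. by move=> T; exact: bop_ext. Qed.

Lemma bstarD : {morph (@bstar R X) : S T / S + T}.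
Proof. by move=> S T; exact: bop_ext. Qed.

Lemma bstarZ (c : R[i]) T : bstar (c *: T) = Num.conj c *: bstar T.
Proof. exact: bop_ext. Qed.

Lemma bstarM S T : bstar (bcomp S T) = bcomp (bstar T) (bstar S).
Proof. exact: bop_ext. Qed.

Lemma bnorm_star T : `|bcomp (bstar T) T| = `|T| ^+ 2.
Proof.
have T0 := opnorm_ge0 T.
apply/eqP; rewrite eq_le; apply/andP; split.
  rewrite (le_trans (bcomp_norm _ _))// expr2 ler_wpM2r//.
  by rewrite !norm_bopE lecR opnorm_bstar_le.
rewrite !norm_bopE -(rmorphXn (real_complex R)) lecR.
have C0 := opnorm_ge0 (bcomp (bstar T) T).
(* It is enough that the square root of the norm of T* T bounds [T]; this is Cauchy-Schwarz for |T
   f|^2 = <f, T* T f>. *)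
rewrite -[leRHS]sqr_sqrtr// ler_pXn2r ?nnegrE ?sqrtr_ge0//.
apply: opnorm_le => [|f]; first exact: sqrtr_ge0.
rewrite -(@ler_pXn2r _ 2) ?nnegrE ?mulr_ge0 ?sqrtr_ge0 ?l2norm_ge0//.
rewrite exprMn l2norm_sqr (sqr_sqrtr C0) bop_ip.
rewrite (le_trans (ip_le_norm _ _))// mulrC expr2 mulrA ler_wpM2r ?l2norm_ge0//.
exact: (l2norm_bop_le (bcomp (bstar T) T)).
Qed.

Definition bop_cstarAlgebra : cstarAlgebra R :=
  CStarAlgebra bcompA bcompDl bcompDr bscaleAl bscaleAr bcomp_norm
    bstarK bstarD bstarZ bstarM bnorm_star.

End BoundedOperatorComplete.

(** * The graded path representation *)

Lemma pull_bounded (R : realType) (Y : choiceType) (phi psi : Y -> option Y)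
    (pq : pinvmap phi psi) :
  exists M, forall f : l2 R Y, l2norm (pull pq f) <= M * l2norm f.
Proof.
exists 1 => f; rewrite mul1r; apply: l2norm_le; first exact: l2norm_ge0.
rewrite l2norm_sqr; apply: ip_le => s us.
rewrite /psum (eq_bigr (fun y => oapp (fun z => f z ^+ 2) 0 (phi y))); last first.
  by move=> y _; rewrite pullE; case: (phi y) => //=; rewrite expr0n.
by rewrite sum_pmap psum_le_ip// (pmap_uniq_pinv pq).
Qed.

Section PartialBijectionOperators.
Variables (R : realType) (X : choiceType).
Local Notation H := (l2 R (X * bool)%type).
Implicit Types (f : H) (phi psi : X -> option X).

Definition lift_pmap phi (y : X * bool) : option (X * bool) :=
  omap (fun z => (z, y.2)) (phi y.1).

Lemma lift_pinv phi psi : pinvmap phi psi -> pinvmap (lift_pmap phi) (lift_pmap psi).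
Proof.
move=> pq [x b] [z c]; rewrite /lift_pmap /=; split.
  by case E : (phi x) => [w|]//= [<- <-]; move/pq: E => ->.
by case E : (psi z) => [w|]//= [<- <-]; move/pq: E => ->.
Qed.

Lemma pull_J phi psi (pq : pinvmap phi psi) f :
  pull (lift_pinv pq) (J f) = J (pull (lift_pinv pq) f).
Proof.
apply: l2_ext => -[x b]; rewrite JE !pullE /lift_pmap /=.
by case: (phi x) => [z|] //=; rewrite mulr0.
Qed.

Definition pop phi psi (pq : pinvmap phi psi) : bop R X :=
  Bop (ip_pull (lift_pinv pq)) (pull_bounded R (lift_pinv pq)) (pull_J pq).

Lemma popE phi psi (pq : pinvmap phi psi) f x b :
  pop pq f (x, b) = oapp (fun z => f (z, b)) 0 (phi x).
Proof.
by rewrite [LHS]pullE /lift_pmap /=; case: (phi x).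
Qed.

Lemma pop_adjE phi psi (pq : pinvmap phi psi) f x b :
  bop_adj (pop pq) f (x, b) = oapp (fun z => f (z, b)) 0 (psi x).
Proof.
by rewrite [LHS]pullE /lift_pmap /=; case: (psi x).
Qed.

Lemma bop_sumE (I : Type) (r : seq I) (Q : pred I) (F : I -> bop R X) f y :
  (\sum_(i <- r | Q i) F i) f y = \sum_(i <- r | Q i) F i f y.
Proof. by apply: (big_morph (fun T : bop R X => T f y)). Qed.

Lemma bop_ext2 (S T : bop R X) : (forall f x b, S f (x, b) = T f (x, b)) -> S = T.
Proof. by move=> ST; apply: bop_ext => f; apply: l2_ext => -[x b]. Qed.

End PartialBijectionOperators.

Section ProjectionOrder.
Context {R : realType} {A : cstarAlgebra R}.

(** The difference p - q is itself a projection, hence its own positive square root. *)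
Lemma projection_le (p q : A) :
  is_projection p -> is_projection q -> p ** q = q -> cstar_le q p.
Proof.
move=> [ps pp] [qs qq] pq; exists (p - q).
have qp : q ** p = q by rewrite -qs -{1}ps -cstarM pq.
by rewrite cstarB ps qs cmulBr !cmulBl pp pq qp qq subrr subr0.
Qed.

End ProjectionOrder.

Section PathRepresentation.
Variables (R : realType) (E : digraph).

Definition infpath (z : nat -> edge E) := forall i, rng (z i) = src (z i.+1).

Definition icons (e : edge E) (z : nat -> edge E) : nat -> edge E :=
  fun i => if i is j.+1 then z j else e.

Definition ishift (z : nat -> edge E) : nat -> edge E := fun i => z i.+1.

Lemma icons_shift z : icons (z 0) (ishift z) = z.
Proof. by apply/funext => -[|i]. Qed.

Lemma ishift_cons e z : ishift (icons e z) = z.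
Proof. by []. Qed.

Lemma infpath_shift z : infpath z -> infpath (ishift z).
Proof. by move=> zp i; exact: zp. Qed.

Lemma infpath_cons e z : infpath z -> rng e = src (z 0) -> infpath (icons e z).
Proof. by move=> zp ez [|i] //=; exact: zp. Qed.

(* The integer grades the representation: it makes the shift act freely, so
   that periodic paths need no special treatment. *)
Definition gpath : choiceType := ((nat -> edge E) * int)%type.

(** Operators compose functions with maps of points, so composing with the shift sends the basis
    vector at [(w, d)] to the one at [(e w, d - 1)]. The index type also contains edge sequences
    that are not paths; the partial maps are undefined there and all the operators vanish on
    them. *)
Definition shift_pmap e (x : gpath) : option gpath :=
  if `[< infpath x.1 >] && (x.1 0 == e) then Some (ishift x.1, x.2 + 1) else None.

Definition cons_pmap e (x : gpath) : option gpath :=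
  if `[< infpath x.1 >] && (rng e == src (x.1 0)) then Some (icons e x.1, x.2 - 1)
  else None.

Lemma shift_cons_pinv e : pinvmap (shift_pmap e) (cons_pmap e).
Proof.
move=> [z c] [w d]; rewrite /shift_pmap /cons_pmap /=; split.
  case: ifP => // /andP[/asboolP zp /eqP <-] [<- <-].
  rewrite (asboolT (infpath_shift zp)) zp eqxx /= icons_shift.
  by rewrite addrK.
case: ifP => // /andP[/asboolP zp /eqP ez] [<- <-].
by rewrite (asboolT (infpath_cons zp ez)) eqxx /= subrK.
Qed.

Definition vert_pmap v (x : gpath) : option gpath :=
  if `[< infpath x.1 >] && (src (x.1 0) == v) then Some x else None.

Lemma vert_pinv v : pinvmap (vert_pmap v) (vert_pmap v).
Proof.
by move=> x w; rewrite /vert_pmap; split; case: ifP => // xv [<-]; rewrite xv.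
Qed.

Local Notation B := (bop_cstarAlgebra R gpath).

Definition repP v : B := pop R (vert_pinv v).
Definition repS e : B := pop R (shift_cons_pinv e).

Lemma repSE e (f : l2 R (gpath * bool)%type) z d b :
  (repS e : bop R gpath) f (z, d, b) =
  if `[< infpath z >] && (z 0 == e) then f (ishift z, d + 1, b) else 0.
Proof. by rewrite popE /shift_pmap /=; case: ifP. Qed.

Lemma repS_adjE e (f : l2 R (gpath * bool)%type) z d b :
  bop_adj (repS e : bop R gpath) f (z, d, b) =
  if `[< infpath z >] && (rng e == src (z 0)) then f (icons e z, d - 1, b) else 0.
Proof. by rewrite pop_adjE /cons_pmap /=; case: ifP. Qed.

Lemma repPE v (f : l2 R (gpath * bool)%type) z d b :
  (repP v : bop R gpath) f (z, d, b) =
  if `[< infpath z >] && (src (z 0) == v) then f (z, d, b) else 0.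
Proof. by rewrite popE /vert_pmap /=; case: ifP. Qed.

Lemma rep_range e (f : l2 R (gpath * bool)%type) z d b :
  (cmul (repS e) (cstar (repS e)) : bop R gpath) f (z, d, b) =
  if `[< infpath z >] && (z 0 == e) then f (z, d, b) else 0.
Proof.
rewrite [LHS]repSE; case: ifP => // /andP[/asboolP zp /eqP <-].
rewrite [LHS]repS_adjE (asboolT (infpath_shift zp)) zp eqxx /= icons_shift.
by rewrite addrK.
Qed.

Lemma rep_ck_family : ck_family repP repS.
Proof.
have projP v : is_projection (repP v).
  split; apply: bop_ext2 => f [z d] b.
    by rewrite [LHS]pop_adjE [RHS]popE.
  by rewrite [LHS]repPE repPE; case: (_ && _).
have projS e : is_projection (cmul (repS e) (cstar (repS e))).
  split; first by rewrite cstarM cstarK.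
  by apply: bop_ext2 => f [z d] b; rewrite [LHS]rep_range rep_range; case: (_ && _).
split => //.
- move=> u v uv; apply: bop_ext2 => f [z d] b.
  rewrite [LHS]repPE; case: ifP => // /andP[_ /eqP zu].
  by rewrite repPE zu (negPf uv) andbF.
- move=> e; apply: bop_ext2 => f [z d] b.
  by rewrite [LHS]rep_range repSE; case: (_ && _).
- move=> e; apply: bop_ext2 => f [z d] b.
  rewrite [LHS]repS_adjE [RHS]repPE eq_sym; case: ifP => // /andP[/asboolP zp /eqP ez].
  rewrite repSE (asboolT (infpath_cons zp _))//= eqxx ishift_cons.
  by rewrite subrK.
- move=> e f ef; apply: bop_ext2 => g [z d] b.
  rewrite [LHS]repS_adjE; case: ifP => // /andP[/asboolP zp /eqP ez].
  by rewrite repSE /= (negPf ef) andbF.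
- move=> e; apply: projection_le => //; apply: bop_ext2 => f [z d] b.
  rewrite [LHS]repPE rep_range; case: ifP => // zs.
  by case: ifP => // /andP[zp /eqP ze]; rewrite zp ze eqxx in zs.
- move=> v _; apply: bop_ext2 => f [z d] b.
  rewrite bop_sumE repPE; under eq_bigr do rewrite rep_range.
  have [zp|zp] := boolP `[< infpath z >]; last by rewrite big1.
  rewrite -big_mkcondr /= (eq_bigl (fun e => (e == z 0) && (src (z 0) == v))).
    rewrite /=; case: (_ == v); last by rewrite big_pred0// => e; rewrite andbF.
    by rewrite (big_pred1 (z 0))// => e; rewrite andbT.
  by move=> e; rewrite andbC eq_sym; case: eqP => // ->.
Qed.

End PathRepresentation.

Section EndpointFixing.
Variables (E : digraph) (k : nat) (tau : {perm epath E k}).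

Lemma endpoint_fixingP : endpoint_fixing tau <->
  forall a, psrc (tau a) = psrc a /\ prng (tau a) = prng a.
Proof.
split=> [tfix a|tfix u v].
  have : tau a \in paths_between k (psrc a) (prng a).
    by rewrite -tfix mem_imset ?inE ?eqxx//; exact: perm_inj.
  by rewrite inE => /andP[/eqP -> /eqP ->].
apply/setP => a; apply/imsetP/idP => [[b + ->]|].
  by rewrite !inE; have [-> ->] := tfix b.
rewrite inE => uv; exists ((tau^-1)%g a); last by rewrite permKV.
rewrite inE; have [] := tfix ((tau^-1)%g a); rewrite permKV => <- <-.
exact: uv.
Qed.

End EndpointFixing.

Lemma endpoint_fixingV (E : digraph) k (tau : {perm epath E k}) :
  endpoint_fixing tau -> endpoint_fixing (tau^-1)%g.
Proof.
move=> /endpoint_fixingP tfix; apply/endpoint_fixingP => a.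
by have [] := tfix ((tau^-1)%g a); rewrite permKV => -> ->.
Qed.

(** * Infinite paths and the action of a permutation on their initial segments *)

Section InfinitePaths.
Variable E : digraph.
Implicit Types (z : nat -> edge E) (s : seq (edge E)).

Lemma pedges_size l (a : epath E l) : size (pedges a) = l.
Proof. by rewrite size_tuple. Qed.

Lemma pedges_walk l (a : epath E l) : walk (psrc a) (pedges a).
Proof. exact: (valP a). Qed.

Lemma epath_eq l (a b : epath E l) : psrc a = psrc b -> pedges a = pedges b -> a = b.
Proof.
case: a b => [[v s] sp] [[w t] tp] /= vw st; apply/val_inj => /=.
by rewrite /psrc /pedges /= in vw st; rewrite vw; congr pair; exact: val_inj.
Qed.

Lemma epath_of_walk l v s : walk v s -> size s = l ->
  exists a : epath E l, psrc a = v /\ pedges a = s.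
Proof.
move=> ws /eqP sl.
by exists (Sub (v, Tuple sl) ws : epath E l); rewrite /psrc /pedges SubK.
Qed.

Definition icat s z : nat -> edge E := foldr (@icons E) z s.

Definition ishiftn l z : nat -> edge E := fun i => z (l + i)%N.

Lemma ishiftn0 l z : ishiftn l z 0 = z l.
Proof. by rewrite /ishiftn addn0. Qed.

Lemma ishift_ishiftn l z : ishift (ishiftn l z) = ishiftn l.+1 z.
Proof. by apply/funext => i; rewrite /ishift /ishiftn addnS. Qed.

(** The source is compared separately because for l = 0 the edge list carries no information. *)
Definition starts l (a : epath E l) z := (psrc a == src (z 0)) && (pedges a == mkseq z l).

Lemma mkseq_ishift z l : mkseq z l.+1 = z 0 :: mkseq (ishift z) l.
Proof. by rewrite /mkseq /= -[1%N]/(1 + 0)%N iotaDl -map_comp. Qed.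

Lemma icat_mkseq l z : icat (mkseq z l) (ishiftn l z) = z.
Proof.
elim: l z => [|l IH] z; first by apply/funext.
by rewrite mkseq_ishift -[RHS]icons_shift -[X in icons _ X]IH.
Qed.

Lemma mkseq_icat s z : mkseq (icat s z) (size s) = s.
Proof. by elim: s => // e s IH; rewrite [size _]/= mkseq_ishift IH. Qed.

Lemma ishiftn_icat s z : ishiftn (size s) (icat s z) = z.
Proof. by elim: s => [|e s IH]; [exact/funext|rewrite -[RHS]IH]. Qed.

Lemma infpath_shiftn l z : infpath z -> infpath (ishiftn l z).
Proof. by move=> zp i; rewrite /ishiftn addnS. Qed.

Lemma icat0 v s z : walk v s -> last v (map rng s) = src (z 0) ->
  src (icat s z 0) = v.
Proof. by case: s => [|e s] //= /andP[/eqP]. Qed.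

Lemma infpath_icat v s z : infpath z -> walk v s ->
  last v (map rng s) = src (z 0) -> infpath (icat s z).
Proof.
move=> zp; elim: s v => [|e s IH] v //= /andP[_ ws] ls.
by apply: infpath_cons; [exact: IH ws ls|rewrite -/(icat s z) (icat0 ws ls)].
Qed.

Lemma walk_mkseq l z : infpath z -> walk (src (z 0)) (mkseq z l).
Proof.
elim: l z => [|l IH] z zp //; rewrite mkseq_ishift /= eqxx zp.
exact: (IH (ishift z) (infpath_shift zp)).
Qed.

Lemma last_mkseq l z : infpath z -> last (src (z 0)) (map rng (mkseq z l)) = src (z l).
Proof.
by case: l => [|l] zp //; rewrite mkseqS map_rcons last_rcons.
Qed.

Lemma starts_exists l z : infpath z -> exists a : epath E l, starts a z.
Proof.
move=> zp; have [a [ap ae]] := epath_of_walk (walk_mkseq l zp) (size_mkseq _ _).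
by exists a; rewrite /starts ap ae !eqxx.
Qed.

Lemma starts_inj l (a b : epath E l) z : starts a z -> starts b z -> a = b.
Proof.
by move=> /andP[/eqP a1 /eqP a2] /andP[/eqP b1 /eqP b2]; apply: epath_eq; congruence.
Qed.

Lemma starts_prng l (a : epath E l) z : infpath z -> starts a z -> prng a = src (z l).
Proof.
by move=> zp /andP[/eqP az /eqP ae]; rewrite /prng az ae last_mkseq.
Qed.

Lemma starts_icat l (a : epath E l) z : prng a = src (z 0) ->
  starts a (icat (pedges a) z).
Proof.
move=> az; rewrite /starts (icat0 (pedges_walk a) az) eqxx /=.
by have := mkseq_icat (pedges a) z; rewrite pedges_size => ->.
Qed.

Lemma infpath_icat_epath l (a : epath E l) z : infpath z -> prng a = src (z 0) ->
  infpath (icat (pedges a) z).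
Proof. by move=> zp az; apply: infpath_icat zp (pedges_walk a) az. Qed.

Lemma icat_starts l (a : epath E l) z : starts a z ->
  icat (pedges a) (ishiftn l z) = z.
Proof. by move=> /andP[_ /eqP ->]; exact: icat_mkseq. Qed.

Lemma ishiftn_icat_epath l (a : epath E l) z : ishiftn l (icat (pedges a) z) = z.
Proof. by have := ishiftn_icat (pedges a) z; rewrite pedges_size. Qed.

Section PermAction.
Variable k : nat.
Implicit Types tau : {perm epath E k}.

(** The picked segment is unique by [starts_inj] and exists on every infinite path; the default [z]
    only concerns sequences that are not paths. *)
Definition perm_inf tau z : nat -> edge E :=
  if [pick a : epath E k | starts a z] is Some a
  then icat (pedges (tau a)) (ishiftn k z) else z.

Lemma perm_infE tau z a : starts a z ->
  perm_inf tau z = icat (pedges (tau a)) (ishiftn k z).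
Proof.
rewrite /perm_inf; case: pickP => [b bz az|/(_ a) ->//].
by rewrite (starts_inj bz az).
Qed.

Lemma starts_perm_inf tau z a : endpoint_fixing tau -> infpath z -> starts a z ->
  starts (tau a) (perm_inf tau z).
Proof.
move=> /endpoint_fixingP tfix zp az; rewrite (perm_infE _ az).
apply: starts_icat; have [_ ->] := tfix a.
by rewrite (starts_prng zp az) /ishiftn addn0.
Qed.

Lemma infpath_perm_inf tau z : endpoint_fixing tau -> infpath z ->
  infpath (perm_inf tau z).
Proof.
move=> /endpoint_fixingP tfix zp; have [a az] := starts_exists k zp.
rewrite (perm_infE _ az); apply: infpath_icat_epath; first exact: infpath_shiftn.
by have [_ ->] := tfix a; rewrite (starts_prng zp az) /ishiftn addn0.
Qed.

Lemma src_perm_inf tau z : endpoint_fixing tau -> infpath z ->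
  src (perm_inf tau z 0) = src (z 0).
Proof.
move=> tfix zp; have [a az] := starts_exists k zp.
have /andP[/eqP <- _] := starts_perm_inf tfix zp az.
have /endpoint_fixingP/(_ a)[-> _] := tfix.
by have /andP[/eqP -> _] := az.
Qed.

Lemma perm_infK tau z : endpoint_fixing tau -> infpath z ->
  perm_inf tau^-1%g (perm_inf tau z) = z.
Proof.
move=> tfix zp; have [a az] := starts_exists k zp.
rewrite (perm_infE _ (starts_perm_inf tfix zp az)) permK (perm_infE _ az).
by rewrite ishiftn_icat_epath (icat_starts az).
Qed.

Lemma perm_infKV tau z : endpoint_fixing tau -> infpath z ->
  perm_inf tau (perm_inf tau^-1%g z) = z.
Proof.
by move=> tfix zp; rewrite -{1}[tau]invgK perm_infK//; exact: endpoint_fixingV.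
Qed.

End PermAction.
End InfinitePaths.

(** * The shift induced by lambda_tau and the matching of its tail classes *)

Section Dynamics.
Variables (E : digraph) (k : nat) (tau : {perm epath E k}).
Hypothesis tfix : endpoint_fixing tau.
Implicit Types (z w : nat -> edge E).

Let uinv z := perm_inf tau^-1%g z.
Let tfixV := endpoint_fixingV tfix.

(** Since lambda_tau(S_e) = U_tau S_e, and U_tau acts as composition with [uinv], this edge and
    [lam_shift z] play for lambda_tau(S_e) the roles that the first edge and the shift play for
    S_e. *)
Definition lam_code z : edge E := uinv z 0.
Definition lam_shift z : nat -> edge E := ishift (uinv z).
Definition lam_shiftn i z := iter i lam_shift z.

Lemma infpath_lam_shift z : infpath z -> infpath (lam_shift z).
Proof. by move=> zp; apply/infpath_shift/infpath_perm_inf. Qed.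

Lemma infpath_lam_shiftn i z : infpath z -> infpath (lam_shiftn i z).
Proof. by move=> zp; elim: i => //= i; exact: infpath_lam_shift. Qed.

Lemma src_lam_code z : infpath z -> src (lam_code z) = src (z 0).
Proof. exact: src_perm_inf. Qed.

Lemma rng_lam_code z : infpath z -> rng (lam_code z) = src (lam_shift z 0).
Proof. by move=> zp; exact: (infpath_perm_inf tfixV zp). Qed.

Lemma lam_code_shift_inj z w : infpath z -> infpath w ->
  lam_code z = lam_code w -> lam_shift z = lam_shift w -> z = w.
Proof.
move=> zp wp cc tt; rewrite -[z](perm_infKV tfix zp) -[w](perm_infKV tfix wp).
by congr (perm_inf _ _); rewrite -[LHS]icons_shift -[RHS]icons_shift; congr icons.
Qed.

Definition lam_cons e z := perm_inf tau (icons e z).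

Lemma infpath_lam_cons e z : infpath z -> rng e = src (z 0) -> infpath (lam_cons e z).
Proof. by move=> zp ez; apply: infpath_perm_inf => //; exact: infpath_cons. Qed.

Lemma lam_code_cons e z : infpath z -> rng e = src (z 0) -> lam_code (lam_cons e z) = e.
Proof.
by move=> zp ez; rewrite /lam_code /uinv perm_infK//; exact: infpath_cons.
Qed.

Lemma lam_shift_cons e z : infpath z -> rng e = src (z 0) ->
  lam_shift (lam_cons e z) = z.
Proof.
by move=> zp ez; rewrite /lam_shift /uinv perm_infK//; exact: infpath_cons.
Qed.

Definition same_code z w := forall l, lam_code (lam_shiftn l z) = lam_code (lam_shiftn l w).

(** A path is recovered from its code and its [lam_shift], so equality of the iterates can be pulled
    back one step at a time. *)
Lemma same_code_inj z w i : infpath z -> infpath w -> same_code z w ->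
  lam_shiftn i z = lam_shiftn i w -> z = w.
Proof.
move=> zp wp zw; elim: i => //= i IH ii; apply: IH.
by apply: lam_code_shift_inj => //; exact: infpath_lam_shiftn.
Qed.

Lemma lam_shiftnD i j z : lam_shiftn (i + j) z = lam_shiftn i (lam_shiftn j z).
Proof. exact: iterD. Qed.

Section Intertwiner.
Implicit Types (y : nat -> edge E) (x : gpath E).

(* The partial bijection of points that matches the two tail classes, for the
   shift induced by [lambda_tau], of [y] and [y'], both placed in degree 0. It
   commutes with every [lambda_tau (S e)], hence with the whole image of
   [lambda_tau]. *)
Definition transport y y' x x' :=
  [/\ infpath x.1, infpath x'.1, x.2 = x'.2, same_code x.1 x'.1 &
   exists i j : nat, [/\ x.2 + i%:Z = j%:Z, lam_shiftn i x.1 = lam_shiftn j y &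
     lam_shiftn i x'.1 = lam_shiftn j y']].

Lemma transportC y y' x x' : transport y y' x x' -> transport y' y x' x.
Proof.
move=> [xp xp' dd cc [i [j [ij xy xy']]]]; split => //; exists i, j.
by rewrite -dd.
Qed.

Lemma transport_inj y y' x x1 x2 :
  transport y y' x x1 -> transport y y' x x2 -> x1 = x2.
Proof.
move=> [xp x1p d1 c1 [i [j [ij xy x1y]]]] [_ x2p d2 c2 [i' [j' [ij' xy' x2y]]]].
case: x1 x1p d1 c1 x1y => [z1 e1] /= z1p <- c1 z1y.
case: x2 x2p d2 c2 x2y => [z2 e2] /= z2p <- c2 z2y.
congr pair.
have c12 : same_code z1 z2 by move=> l; rewrite -c1 c2.
(* The degree is what gives uniqueness: x.2 + i = j and x.2 + i' = j' imply i' + j = i + j', so both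
   paths reach the same iterate of [y']. *)
apply: (@same_code_inj _ _ (i' + i)) => //.
rewrite [LHS]lam_shiftnD z1y -lam_shiftnD [in RHS]addnC [RHS]lam_shiftnD z2y -lam_shiftnD.
by congr lam_shiftn; lia.
Qed.

Lemma transport_shift y y' x x' : transport y y' x x' ->
  transport y y' (lam_shift x.1, x.2 + 1) (lam_shift x'.1, x'.2 + 1).
Proof.
move=> [xp xp' dd cc [i [j [ij xy xy']]]].
split; rewrite /= ?dd//; try exact: infpath_lam_shift.
  by move=> l; rewrite /lam_shiftn -!iterSr; exact: (cc l.+1).
exists i, j.+1; split; first by lia.
  by rewrite /lam_shiftn -iterSr /= -/(lam_shiftn _ _) xy.
by rewrite /lam_shiftn -iterSr /= -/(lam_shiftn _ _) xy'.
Qed.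

(** The partner of [x] is [x1] with the code of [x] prepended. This is possible because the source
    of a path is that of its code, so equal codes give equal sources. *)
Lemma transport_unshift y y' x x1 : infpath x.1 ->
  transport y y' (lam_shift x.1, x.2 + 1) x1 -> exists x', transport y y' x x'.
Proof.
move=> xp [_ x1p /= dd cc [i [j [ij xy xy']]]].
have ex : rng (lam_code x.1) = src (x1.1 0).
  rewrite rng_lam_code// -(src_lam_code (infpath_lam_shift xp)) -(src_lam_code x1p).
  by congr src; exact: (cc 0%N).
exists (lam_cons (lam_code x.1) x1.1, x.2); split => //=.
- exact: infpath_lam_cons.
- case=> [|l]; first by rewrite lam_code_cons.
  by rewrite /lam_shiftn !iterSr lam_shift_cons//; exact: (cc l).
- exists i.+1, j; split; first by lia.
  + by rewrite /lam_shiftn iterSr.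
  + by rewrite /lam_shiftn iterSr lam_shift_cons.
Qed.

Definition transport_pmap y y' x : option (gpath E) :=
  if pselect (exists x', transport y y' x x') is left xx'
  then Some (projT1 (cid xx')) else None.

Lemma transport_pmapP y y' x x' :
  transport_pmap y y' x = Some x' <-> transport y y' x x'.
Proof.
rewrite /transport_pmap; case: pselect => [xx|nxx]; split=> //.
- by move=> [<-]; exact: projT2 (cid xx).
- by move=> x1; congr Some; apply: transport_inj x1; exact: projT2 (cid xx).
- by move=> xx; case: nxx; exists x'.
Qed.

Lemma transport_pmap_None y y' x :
  transport_pmap y y' x = None -> forall x', ~ transport y y' x x'.
Proof. by move=> xN x' /transport_pmapP; rewrite xN. Qed.

Lemma transport_pinv y y' : pinvmap (transport_pmap y y') (transport_pmap y' y).
Proof.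
by move=> x x'; split=> /transport_pmapP/transportC xx; exact/transport_pmapP.
Qed.

End Intertwiner.
End Dynamics.

(** * Graph algebras *)

Lemma closed_eq_continuous (R : realType) (T : topologicalType) (V : cstarAlgebra R) (f g : T -> V) :
  continuous f -> continuous g -> closed [set x | f x = g x].
Proof.
move=> fc gc; rewrite (_ : [set x | _] = (fun x => f x - g x) @^-1` [set 0]).
  apply: closed_comp => [x _|].
    exact: (cvgB (fc x) (gc x)).
  by apply: accessible_closed_set1; apply: hausdorff_accessible; exact: norm_hausdorff.
apply/seteqP; split=> x /=; first by move=> ->; rewrite subrr.
by move/eqP; rewrite subr_eq0 => /eqP.
Qed.

Section GraphAlgebra.
Variables (R : realType) (E : digraph) (A : cstarAlgebra R).
Variables (P : vert E -> A) (S : edge E -> A).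
Hypothesis nosink : no_sinks E.
Implicit Types (x y : A) (e : edge E) (v : vert E).

Section CuntzKrieger.
Hypothesis ck : ck_family P S.

Lemma ckPP v w : P v ** P w = if v == w then P v else 0.
Proof.
case: eqP => [<-|/eqP vw]; last exact: ck_orth ck _ _ vw.
by have [_] := ck_proj ck v.
Qed.

Lemma cstar_ckP v : cstar (P v) = P v.
Proof. by have [] := ck_proj ck v. Qed.

Lemma ckSS e f : cstar (S e) ** S f = if e == f then P (rng e) else 0.
Proof.
case: eqP => [<-|/eqP ef]; first exact: ck_initial ck e.
exact: ck_edge_orth ck _ _ ef.
Qed.

Lemma ckSP e v : S e ** P v = if v == rng e then S e else 0.
Proof.
have SP : S e ** P (rng e) = S e.
  by rewrite -(ck_initial ck) cmulA; exact: ck_pisom ck e.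
rewrite -{1}SP -cmulA ckPP eq_sym; case: eqP => _ //.
exact: cmul0r.
Qed.

(** Without sinks every P_v expands by the summation relation, and orthogonality of the ranges
    leaves at most the term of [e]. *)
Lemma ckPS v e : P v ** S e = if v == src e then S e else 0.
Proof.
rewrite (ck_sum ck) ?cmul_suml; last exact: nosink.
case: eqP => [->|/eqP ve].
  rewrite (bigD1 e)//= big1 ?addr0; first exact: ck_pisom ck e.
  by move=> f /andP[_ fe]; rewrite -cmulA ckSS (negPf fe) cmul0r.
rewrite big1// => f /eqP fv; rewrite -cmulA ckSS.
by case: eqP => [fe|_]; [rewrite -fv fe eqxx in ve|rewrite cmul0r].
Qed.

Definition ga_unit : A := \sum_v P v.

Lemma ga_unit_projection : is_projection ga_unit.
Proof.
split; first by rewrite /ga_unit cstar_sum; apply: eq_bigr => v _; exact: cstar_ckP.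
rewrite /ga_unit cmul_suml; apply: eq_bigr => v _.
rewrite cmul_sumr (bigD1 v)//= ckPP eqxx big1 ?addr0// => w /negPf wv.
by rewrite ckPP eq_sym wv.
Qed.

Lemma ga_unitP v : ga_unit ** P v = P v.
Proof.
rewrite /ga_unit cmul_suml (bigD1 v)//= ckPP eqxx big1 ?addr0// => w /negPf wv.
by rewrite ckPP wv.
Qed.

Lemma ga_unitPr v : P v ** ga_unit = P v.
Proof.
have [us _] := ga_unit_projection.
by rewrite -{1}[P v]cstar_ckP -us -cstarM ga_unitP cstar_ckP.
Qed.

Lemma ga_unitS e : ga_unit ** S e = S e.
Proof.
rewrite /ga_unit cmul_suml (bigD1 (src e))//= ckPS eqxx big1 ?addr0// => w /negPf we.
by rewrite ckPS we.
Qed.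

Lemma ga_unitSr e : S e ** ga_unit = S e.
Proof.
rewrite /ga_unit cmul_sumr (bigD1 (rng e))//= ckSP eqxx big1 ?addr0// => w /negPf we.
by rewrite ckSP we.
Qed.

End CuntzKrieger.

Hypothesis ga : is_graph_algebra P S.
Let ck := ga_family ga.

(** The two-sided condition is imposed so that the set is stable under the star; it is then a closed
    star-subalgebra containing the generators. *)
Lemma ga_unitl x : ga_unit ** x = x.
Proof.
have [us _] := ga_unit_projection ck.
suff [] : ga_unit ** x = x /\ x ** ga_unit = x by [].
apply: (ga_generated ga (D := [set x | ga_unit ** x = x /\ x ** ga_unit = x])).
- split=> /=.
  + apply: closedI.
      by apply: closed_eq_continuous => // y; [exact: cmulr_continuous|exact: cvg_id].
    by apply: closed_eq_continuous => // y; [exact: cmull_continuous|exact: cvg_id].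
  + by rewrite cmul0l cmul0r.
  + by move=> y z [y1 y2] [z1 z2]; rewrite cmulDl cmulDr y1 y2 z1 z2.
  + by move=> c y [y1 y2]; rewrite -cscaleAl -cscaleAr y1 y2.
  + by move=> y z [y1 y2] [z1 z2]; rewrite cmulA y1 -cmulA z2.
  + by move=> y [y1 y2]; rewrite -us -!cstarM y1 y2.
- by move=> v /=; rewrite (ga_unitP ck) (ga_unitPr ck).
- by move=> e /=; rewrite (ga_unitS ck) (ga_unitSr ck).
Qed.

Lemma ga_unitr x : x ** ga_unit = x.
Proof.
have [us _] := ga_unit_projection ck.
by rewrite -[LHS]cstarK cstarM us ga_unitl cstarK.
Qed.

Lemma ga_star_hom_continuous (B : cstarAlgebra R) (f : A -> B) :
  star_hom f -> continuous f.
Proof.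
exact: (star_hom_continuous (ga_unit_projection ck) ga_unitl ga_unitr).
Qed.

Lemma subalg_sum (V : cstarAlgebra R) (D : set V) (I : Type) (r : seq I)
    (Q : pred I) (F : I -> V) : closed_star_subalgebra D ->
  (forall i, Q i -> D (F i)) -> D (\sum_(i <- r | Q i) F i).
Proof.
by move=> [_ D0 DD _ _ _] DF; elim/big_ind: _.
Qed.

Lemma ga_generatedS (D : set A) : closed_star_subalgebra D ->
  (forall e, D (S e)) -> forall x, D x.
Proof.
move=> Da DS; apply: (ga_generated ga Da) => // v.
rewrite (ck_sum ck); last exact: nosink.
apply: (subalg_sum _ Da) => e _.
by apply: (subalgM Da) => //; exact: (subalgS Da).
Qed.

Lemma star_hom_eq (B : cstarAlgebra R) (f g : A -> B) : star_hom f -> star_hom g ->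
  (forall e, f (S e) = g (S e)) -> forall x, f x = g x.
Proof.
move=> fh gh fg; apply: ga_generatedS; last by move=> e /=; exact: fg.
split=> /=.
- by apply: closed_eq_continuous; exact: ga_star_hom_continuous.
- by rewrite (star_hom0 fh) (star_hom0 gh).
- by move=> x y xe ye; rewrite (star_homD fh) (star_homD gh) xe ye.
- by move=> c x xe; rewrite (star_homZ fh) (star_homZ gh) xe.
- by move=> x y xe ye; rewrite (star_homM fh) (star_homM gh) xe ye.
- by move=> x xe; rewrite (star_homS fh) (star_homS gh) xe.
Qed.

End GraphAlgebra.

Lemma path_elt_morph (R : realType) (E : digraph) (A B : cstarAlgebra R)
    (P : vert E -> A) (S : edge E -> A) (Q : vert E -> B) (T : edge E -> B)
    (f : A -> B) l (a : epath E l) :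
  star_hom f -> (forall v, f (P v) = Q v) -> (forall e, f (S e) = T e) ->
  f (path_elt P S a) = path_elt Q T a.
Proof.
move=> fh fP fS; rewrite /path_elt; case: (pedges a) => [//|e s].
rewrite -fS; move: (S e); elim: s => //= g s IH x.
by rewrite IH (star_homM fh) fS.
Qed.

Lemma U_perm_morph (R : realType) (E : digraph) (A B : cstarAlgebra R)
    (P : vert E -> A) (S : edge E -> A) (Q : vert E -> B) (T : edge E -> B)
    (f : A -> B) k (tau : {perm epath E k}) :
  star_hom f -> (forall v, f (P v) = Q v) -> (forall e, f (S e) = T e) ->
  f (U_perm P S tau) = U_perm Q T tau.
Proof.
move=> fh fP fS; rewrite /U_perm (star_hom_sum fh); apply: eq_bigr => a _.
by rewrite (star_homM fh) (star_homS fh) !(path_elt_morph _ fh fP fS).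
Qed.

(** Commutation with [cstar V] is included because taking adjoints exchanges the two conditions. *)
Lemma commutant_star_subalgebra (R : realType) (A B : cstarAlgebra R) (g : A -> B)
    (V : B) : star_hom g -> continuous g ->
  closed_star_subalgebra [set x | V ** g x = g x ** V /\
                                  cstar V ** g x = g x ** cstar V].
Proof.
move=> gh gc.
have gV W : closed [set x | W ** g x = g x ** W].
  apply: closed_eq_continuous => x.
    exact: (continuous_comp (gc x) (@cmulr_continuous R B W (g x))).
  exact: (continuous_comp (gc x) (@cmull_continuous R B W (g x))).
split=> /=.
- exact: (closedI (gV V) (gV (cstar V))).
- by rewrite (star_hom0 gh) !cmul0l !cmul0r.
- move=> x x' [x1 x2] [x1' x2']; rewrite (star_homD gh) !cmulDl !cmulDr.
  by rewrite x1 x2 x1' x2'.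
- move=> c x [x1 x2]; rewrite (star_homZ gh) -!cscaleAl -!cscaleAr.
  by rewrite x1 x2.
- move=> x x' [x1 x2] [x1' x2']; rewrite (star_homM gh) !cmulA x1 x2.
  by rewrite -!cmulA x1' x2'.
- move=> x [x1 x2]; rewrite (star_homS gh) -{1 2}[V]cstarK -!cstarM.
  by rewrite x1 x2.
Qed.

Section PathOperators.
Variables (R : realType) (E : digraph).
Local Notation B := (bop_cstarAlgebra R (gpath E)).
Local Notation H := (l2 R (gpath E * bool)%type).
Local Notation repP := (@repP R E).
Local Notation repS := (@repS R E).
Implicit Types (f : H) (z : nat -> edge E) (d : int).

Definition path_pmap l (a : epath E l) (x : gpath E) : option (gpath E) :=
  if `[< infpath x.1 >] && starts a x.1 then Some (ishiftn l x.1, x.2 + l%:Z) else None.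

Definition path_unpmap l (a : epath E l) (x : gpath E) : option (gpath E) :=
  if `[< infpath x.1 >] && (prng a == src (x.1 0))
  then Some (icat (pedges a) x.1, x.2 - l%:Z) else None.

Lemma path_pinv l (a : epath E l) : pinvmap (path_pmap a) (path_unpmap a).
Proof.
move=> [z c] [w d]; rewrite /path_pmap /path_unpmap /=; split.
  case: ifP => // /andP[/asboolP zp az] [<- <-].
  rewrite (asboolT (infpath_shiftn _ zp)) (starts_prng zp az) /= addrK.
  by rewrite ishiftn0 eqxx (icat_starts az).
case: ifP => // /andP[/asboolP wp /eqP aw] [<- <-].
rewrite (asboolT (infpath_icat_epath wp aw)) (starts_icat aw) /=.
by rewrite ishiftn_icat_epath subrK.
Qed.

Lemma rep_wordE e s f z d b :
  (foldl (fun x g => x ** repS g) (repS e) s : bop R (gpath E)) f (z, d, b) =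
  if `[< infpath z >] && (mkseq z (size s).+1 == e :: s)
  then f (ishiftn (size s).+1 z, d + (size s).+1%:Z, b) else 0.
Proof.
elim/last_ind: s f => [|s g IH] f.
  by rewrite [LHS]repSE /mkseq /= eqseq_cons eqxx andbT.
rewrite foldl_rcons [LHS]IH size_rcons repSE [in RHS]mkseqS -rcons_cons eqseq_rcons.
have [zp|zp] := boolP `[< infpath z >] => //=.
case: (_ == _) => //=.
rewrite (asboolT (infpath_shiftn _ (asboolW zp))) ishiftn0 /=.
case: (_ == g) => //.
congr (f (_, _, _)); first exact: ishift_ishiftn.
by lia.
Qed.

Lemma rep_path_elt l (a : epath E l) :
  path_elt repP repS a = pop R (path_pinv a) :> bop R (gpath E).
Proof.
apply: bop_ext2 => f z d; case: z d => z d b; rewrite popE /path_pmap /=.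
rewrite /path_elt; case: l a => [|l] a.
  have -> : pedges a = [::] by apply: size0nil; rewrite pedges_size.
  rewrite repPE /starts (_ : pedges a = [::]); last by apply: size0nil; rewrite pedges_size.
  rewrite eqxx andbT eq_sym; case: ifP => // _ /=.
  by rewrite addr0.
rewrite /starts.
have := pedges_size a; have := pedges_walk a; case: (pedges a) => // e s /=.
move=> /andP[/eqP <- _] [sl]; rewrite rep_wordE sl.
rewrite [e :: s == _]eq_sym mkseq_ishift eqseq_cons.
by case: (z 0 =P e) => [->|_]; rewrite ?eqxx ?andbF //=; case: ifP.
Qed.

Lemma rep_pathE l (a : epath E l) f z d b :
  (path_elt repP repS a : bop R (gpath E)) f (z, d, b) =
  if `[< infpath z >] && starts a z then f (ishiftn l z, d + l%:Z, b) else 0.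
Proof. by rewrite rep_path_elt popE /path_pmap /=; case: ifP. Qed.

Lemma rep_path_adjE l (a : epath E l) f z d b :
  bop_adj (path_elt repP repS a : bop R (gpath E)) f (z, d, b) =
  if `[< infpath z >] && (prng a == src (z 0))
  then f (icat (pedges a) z, d - l%:Z, b) else 0.
Proof. by rewrite rep_path_elt pop_adjE /path_unpmap /=; case: ifP. Qed.

(** At a given path only one summand is nonzero, the one whose [tau a] is the initial segment of
    that path. The degree is unchanged, as k edges are removed and k are restored. *)
Lemma rep_U_permE k (tau : {perm epath E k}) f z d b : endpoint_fixing tau ->
  (U_perm repP repS tau : bop R (gpath E)) f (z, d, b) =
  if `[< infpath z >] then f (perm_inf tau^-1%g z, d, b) else 0.
Proof.
move=> tfix; rewrite /U_perm bop_sumE.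
under eq_bigr do rewrite rep_pathE.
case: ifPn => [/asboolP zp|_]; last by rewrite big1.
have [a az] := starts_exists k zp; rewrite (bigD1 ((tau^-1)%g a))//= permKV az.
rewrite big1 ?addr0; last first.
  move=> c ca; case: ifP => // cz; case/eqP: ca.
  by rewrite (starts_inj az cz) permK.
rewrite (perm_infE _ az) [LHS]rep_path_adjE (asboolT (infpath_shiftn _ zp)).
have /endpoint_fixingP/(_ a)[_ ->] := endpoint_fixingV tfix.
by rewrite (starts_prng zp az) ishiftn0 eqxx /= addrK.
Qed.

End PathOperators.

(** * What surjectivity of lambda_tau forces on infinite paths *)

Section Necessity.
Variables (R : realType) (E : digraph) (k : nat) (A : cstarAlgebra R).
Variables (P : vert E -> A) (S : edge E -> A) (tau : {perm epath E k}).
Hypotheses (nosink : no_sinks E) (ga : is_graph_algebra P S).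
Hypotheses (tfix : endpoint_fixing tau) (lam_aut : lambda_automorphism P S tau).
Local Notation H := (l2 R (gpath E * bool)%type).
Implicit Types (z w y : nat -> edge E) (d : int).

Let V y y' : bop R (gpath E) := pop R (transport_pinv tfix y y').

Let VE y y' (f : H) x b :
  V y y' f (x, b) = oapp (fun x' => f (x', b)) 0 (transport_pmap tau y y' x).
Proof. exact: popE. Qed.

Let lam_repE (pi : A -> bop_cstarAlgebra R (gpath E)) (lam : A -> A) e (f : H) z d b :
  star_hom pi -> (forall v, pi (P v) = repP R v) -> (forall e, pi (S e) = repS R e) ->
  is_lambda P S tau lam ->
  (pi (lam (S e)) : bop R (gpath E)) f (z, d, b) =
  if `[< infpath z >] && (lam_code tau z == e) then f (lam_shift tau z, d + 1, b) else 0.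
Proof.
move=> pih piP piS [_ _ ->]; rewrite (star_homM pih) piS.
rewrite (U_perm_morph _ pih piP piS) [LHS]rep_U_permE// repSE.
case: (boolP `[< infpath z >]) => //= /asboolP zp.
by rewrite (asboolT (infpath_perm_inf (endpoint_fixingV tfix) zp)).
Qed.

(** If the point has a partner, both shift together with the same code ([transport_shift]). If it
    has none, neither has its [lam_shift], by [transport_unshift], so both sides are zero. *)
Let V_lam (pi : A -> bop_cstarAlgebra R (gpath E)) (lam : A -> A) y y' e :
  star_hom pi -> (forall v, pi (P v) = repP R v) -> (forall e, pi (S e) = repS R e) ->
  is_lambda P S tau lam ->
  cmul (V y y' : bop_cstarAlgebra R (gpath E)) (pi (lam (S e)))
  = cmul (pi (lam (S e))) (V y y' : bop_cstarAlgebra R (gpath E)).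
Proof.
move=> pih piP piS laml; apply: bop_ext2 => f [z d] b.
have lamE g w c a := lam_repE e g w c a pih piP piS laml.
rewrite -[RHS]/((pi (lam (S e)) : bop R (gpath E)) (V y y' f) (z, d, b)).
rewrite lamE [LHS]VE.
case Ez : (transport_pmap tau y y' (z, d)) => [[w c]|]; rewrite [oapp _ _ _]/=.
  have zw := (transport_pmapP tfix _ _ _ _).1 Ez.
  have zp : infpath z by case: zw.
  have wp : infpath w by case: zw.
  have cc : lam_code tau z = lam_code tau w by case: zw => _ _ _ /(_ 0%N).
  rewrite lamE (asboolT zp) (asboolT wp) cc !andTb; case: eqP => // _; rewrite VE.
  by have /(transport_pmapP tfix) -> := transport_shift tfix zw.
case: ifP => // /andP[/asboolP zp _]; rewrite VE.
case Ew : (transport_pmap _ _ _ _) => [x1|]//=.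
have /(transport_pmapP tfix) zx1 := Ew.
have [x' xx'] := @transport_unshift _ _ _ tfix _ _ (z, d) _ zp zx1.
by have := transport_pmap_None tfix Ez xx'.
Qed.


Let V_S y y' e : cmul (V y y' : bop_cstarAlgebra R (gpath E)) (repS R e)
  = cmul (repS R e) (V y y' : bop_cstarAlgebra R (gpath E)).
Proof.
have ck := ga_family ga.
have [pi [pih piP piS]] := ga_universal ga (rep_ck_family R E).
have [lam laml [lam' _ lamK]] := lam_aut.
have [lamh _ _] := laml.
have Vs z z' : cstar (V z z' : bop_cstarAlgebra R (gpath E)) = V z' z.
  by apply: bop_ext2 => f x b; rewrite [LHS]pop_adjE [RHS]popE.
pose g x := pi (lam x).
have gh : star_hom g.
  split=> [c x x'|x x'|x]; rewrite /g.
  - by rewrite (star_hom_linear lamh) (star_hom_linear pih).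
  - by rewrite (star_homM lamh) (star_homM pih).
  - by rewrite (star_homS lamh) (star_homS pih).
have Da := commutant_star_subalgebra
  (V y y' : bop_cstarAlgebra R (gpath E)) gh
  (ga_star_hom_continuous nosink ga gh).
have VS f : cmul (V y y' : bop_cstarAlgebra R (gpath E)) (g (S f))
    = cmul (g (S f)) (V y y' : bop_cstarAlgebra R (gpath E)) /\
    cmul (cstar (V y y' : bop_cstarAlgebra R (gpath E))) (g (S f))
    = cmul (g (S f)) (cstar (V y y' : bop_cstarAlgebra R (gpath E))).
  by rewrite Vs; split; exact: (V_lam _ _ f pih piP piS laml).
(* The elements whose image under pi o lam commutes with [V] and its adjoint are all of [A];
   surjectivity enters by taking the preimage of [S e]. *)
have [+ _] := ga_generatedS nosink ga Da VS (lam' (S e)).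
by rewrite /g lamK piS.
Qed.

(** The relation was built from [lam_shift] alone; commutation with S_e makes it invariant under the
    original shift. Evaluating both sides on the basis vector at the shift of [x'] gives 1 on the
    left, so the right side must see the same first edge and the same partner. *)
Lemma transport_step y y' x x' : transport tau y y' x x' ->
  x.1 0 = x'.1 0 /\ transport tau y y' (ishift x.1, x.2 + 1) (ishift x'.1, x'.2 + 1).
Proof.
case: x x' => [z d] [w c] zw.
have zp : infpath z by case: zw.
have wp : infpath w by case: zw.
pose f : H := l2_delta ((ishift w, c + 1) : gpath E, true).
have := congr1 (fun T : bop R (gpath E) => T f (z, d, true)) (V_S y y' (w 0)).
rewrite [X in X = _]VE [X in _ = X]repSE.
rewrite ((transport_pmapP tfix _ _ _ _).2 zw) /oapp.
rewrite repSE (asboolT wp) eqxx l2_deltaE eqxx.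
rewrite (asboolT zp) !andTb; case: eqP => [zw0|_ /eqP]; last by rewrite oner_eq0.
rewrite VE; case Ez : (transport_pmap _ _ _ _) => [x1|]; rewrite /oapp; last first.
  by move/eqP; rewrite oner_eq0.
rewrite l2_deltaE; case: eqP => [[x1E]|_ /eqP]; last by rewrite oner_eq0.
by move=> _; split => //; apply/(transport_pmapP tfix); rewrite Ez x1E.
Qed.

(** The same evaluation, on the basis vector at [x1]: the right side is now 1, so [V] is defined at
    [(z, d)]. *)
Lemma transport_unstep y y' z d x1 : infpath z ->
  transport tau y y' (ishift z, d + 1) x1 -> exists x', transport tau y y' (z, d) x'.
Proof.
move=> zp zx1.
pose f : H := l2_delta (x1, true).
have := congr1 (fun T : bop R (gpath E) => T f (z, d, true)) (V_S y y' (z 0)).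
rewrite [X in X = _]VE [X in _ = X]repSE (asboolT zp) eqxx.
rewrite VE ((transport_pmapP tfix _ _ _ _).2 zx1) /oapp l2_deltaE eqxx.
case Ez : (transport_pmap _ _ _ _) => [x2|]; rewrite /oapp; last first.
  by move/eqP; rewrite eq_sym oner_eq0.
by move=> _; exists x2; apply/(transport_pmapP tfix).
Qed.

Let transport_refl y y' : infpath y -> infpath y' -> same_code tau y y' ->
  transport tau y y' (y, 0) (y', 0).
Proof. by move=> yp yp' yy; split => //; exists 0%N, 0%N. Qed.

Lemma same_code_eq y y' : infpath y -> infpath y' -> same_code tau y y' -> y = y'.
Proof.
move=> yp yp' yy; apply/funext => i.
have : transport tau y y' (ishiftn i y, i%:Z) (ishiftn i y', i%:Z).
  elim: i => [|i /transport_step[_]]; first exact: transport_refl.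
  rewrite /= (_ : i%:Z + 1 = i.+1%:Z); last by lia.
  by rewrite !ishift_ishiftn.
by move=> /transport_step[]; rewrite /ishiftn /= addn0.
Qed.

(** The domain of the matching of [y] with itself is the graded [lam_shift] tail class of [y]. It is
    followed forward along [y] for m shifts, where the two paths have merged, and then backward
    along [y'] to degree 0. *)
Lemma shift_eq_lam_shift_eq y y' m : infpath y -> infpath y' ->
  ishiftn m y = ishiftn m y' -> exists i, lam_shiftn tau i y = lam_shiftn tau i y'.
Proof.
move=> yp yp' yy'.
have iE i : i%:Z + 1 = i.+1%:Z :> int by lia.
have fwd i : transport tau y y (ishiftn i y, i%:Z) (ishiftn i y, i%:Z).
  elim: i => [|i /transport_step[_]]; first exact: transport_refl.
  by rewrite /= iE ishift_ishiftn.
have bwd i : (i <= m)%N -> exists x', transport tau y y (ishiftn (m - i) y', (m - i)%N%:Z) x'.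
  elim: i => [_|i IH im].
    by rewrite subn0 -yy'; exists (ishiftn m y, m%:Z); exact: fwd.
  have [x' xx'] := IH (ltnW im).
  apply: (@transport_unstep _ _ _ _ x'); first exact: infpath_shiftn.
  by rewrite iE ishift_ishiftn subnSK.
have [] := bwd m (leqnn m); rewrite subnn => x' [_ _ _ _ [i [j [ij y'y _]]]].
(* Degree 0 turns the relation between the two exponents into i = j. *)
exists i; rewrite y'y; congr lam_shiftn; move: ij => /=; lia.
Qed.

End Necessity.

(** * Permutation graphs *)

Section PathDecomposition.
Context {E : digraph}.

Lemma is_cons_exists l e (a : epath E l) : psrc a = rng e ->
  exists x : epath E l.+1, is_cons e a x.
Proof.
move=> ae; have [||x [x1 x2]] := @epath_of_walk E l.+1 (src e) (e :: pedges a).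
- by rewrite /= eqxx -ae pedges_walk.
- by rewrite /= pedges_size.
- by exists x; rewrite /is_cons x1 x2 ae !eqxx.
Qed.

Lemma is_cons_decomp l (x : epath E l.+1) : exists e (a : epath E l), is_cons e a x.
Proof.
have := pedges_size x; have := pedges_walk x.
case Ex : (pedges x) => [//|e s] /= /andP[/eqP xe ws] [sl].
have [a [a1 a2]] := epath_of_walk ws sl.
by exists e, a; rewrite /is_cons a1 a2 xe Ex !eqxx.
Qed.

Lemma is_cons_det l e (a : epath E l) (x y : epath E l.+1) :
  is_cons e a x -> is_cons e a y -> x = y.
Proof.
move=> /and3P[_ /eqP x1 /eqP x2] /and3P[_ /eqP y1 /eqP y2].
by apply: epath_eq; congruence.
Qed.

Lemma is_cons_inj l e e' (a a' : epath E l) (x : epath E l.+1) :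
  is_cons e a x -> is_cons e' a' x -> e = e' /\ a = a'.
Proof.
move=> /and3P[/eqP a1 _ /eqP x1] /and3P[/eqP a1' _ /eqP].
rewrite x1 => -[ee aa].
by split=> //; apply: epath_eq => //; rewrite a1 a1' ee.
Qed.

Lemma is_cons_prng l e (a : epath E l) (x : epath E l.+1) :
  is_cons e a x -> prng x = prng a.
Proof. by move=> /and3P[/eqP a1 _ /eqP xe]; rewrite /prng xe /= a1. Qed.

Lemma walk_rcons (v : vert E) s f :
  walk v (rcons s f) = walk v s && (src f == last v (map rng s)).
Proof. by elim: s v => [|e s IH] v /=; rewrite ?andbT// IH andbA. Qed.

Lemma is_rcons_exists l (b : epath E l) f : src f = prng b ->
  exists y : epath E l.+1, is_rcons b f y.
Proof.
move=> fb; have [||y [y1 y2]] := @epath_of_walk E l.+1 (psrc b) (rcons (pedges b) f).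
- by rewrite walk_rcons pedges_walk fb /prng eqxx.
- by rewrite size_rcons pedges_size.
- by exists y; rewrite /is_rcons y1 y2 fb !eqxx.
Qed.

Lemma is_rcons_decomp l (y : epath E l.+1) : exists (b : epath E l) f, is_rcons b f y.
Proof.
have := pedges_size y; have := pedges_walk y.
case/lastP Ey : (pedges y) => [//|s f].
rewrite walk_rcons size_rcons => /andP[ws /eqP fs] [sl].
have [b [b1 b2]] := epath_of_walk ws sl.
by exists b, f; rewrite /is_rcons /prng b1 b2 fs Ey !eqxx.
Qed.

Lemma is_rcons_det l (b : epath E l) f (x y : epath E l.+1) :
  is_rcons b f x -> is_rcons b f y -> x = y.
Proof.
move=> /and3P[_ /eqP x1 /eqP x2] /and3P[_ /eqP y1 /eqP y2].
by apply: epath_eq; congruence.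
Qed.

Lemma is_rcons_inj l f f' (b b' : epath E l) (y : epath E l.+1) :
  is_rcons b f y -> is_rcons b' f' y -> b = b' /\ f = f'.
Proof.
move=> /and3P[_ /eqP y1 /eqP y2] /and3P[_ /eqP y1' /eqP].
rewrite y2 => /rcons_inj[bb ff].
by split=> //; apply: epath_eq => //; rewrite -y1 -y1'.
Qed.

Lemma is_rcons_prng l f (b : epath E l) (y : epath E l.+1) :
  is_rcons b f y -> prng y = rng f.
Proof. by move=> /and3P[_ _ /eqP ye]; rewrite /prng ye map_rcons last_rcons. Qed.

Lemma sum_is_rcons (V : nmodType) l (F : epath E l.+1 -> V) :
  \sum_y F y = \sum_(b : epath E l) \sum_f \sum_(y | is_rcons b f y) F y.
Proof.
rewrite pair_bigA /=; under [RHS]eq_bigr do rewrite big_mkcond.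
rewrite exchange_big; apply: eq_bigr => y _ /=; rewrite -big_mkcond.
have [b [f by_]] := is_rcons_decomp y.
rewrite (big_pred1 (b, f))// => -[b' f'] /=.
by apply/idP/eqP => [/(is_rcons_inj by_)[-> ->]|[-> ->]].
Qed.

End PathDecomposition.

Section PermGraph.
Variables (E : digraph) (n : nat) (tau : {perm epath E n.+1}).
Local Notation G := (perm_graph tau : {set ledge E n}).
Implicit Types (a b : epath E n) (e f : edge E) (mu : ledge E n) (p : seq (ledge E n)).

Lemma perm_graphP mu : reflect
  (exists x : epath E n.+1, is_cons (lab1 mu) (lrng mu) x /\ is_rcons (lsrc mu) (lab2 mu) (tau x))
  (mu \in G).
Proof.
rewrite inE; apply: (iffP existsP) => -[x]; first by case/andP; exists x.
by case=> x1 x2; exists x; rewrite x1.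
Qed.

Lemma perm_graph_total1 e a : psrc a = rng e ->
  exists mu, [/\ mu \in G, lab1 mu = e & lrng mu = a].
Proof.
move=> ae; have [x ax] := is_cons_exists ae.
have [b [f bf]] := is_rcons_decomp (tau x).
by exists (b, e, f, a); split=> //; apply/perm_graphP; exists x.
Qed.

Lemma perm_graph_total2 b f : prng b = src f ->
  exists mu, [/\ mu \in G, lsrc mu = b & lab2 mu = f].
Proof.
move=> bf; have [y yb] := is_rcons_exists (esym bf).
have [e [a ea]] := is_cons_decomp ((tau^-1)%g y).
by exists (b, e, f, a); split=> //; apply/perm_graphP; exists ((tau^-1)%g y); rewrite permKV.
Qed.

Lemma perm_graph_det1 mu nu : mu \in G -> nu \in G ->
  lab1 mu = lab1 nu -> lrng mu = lrng nu -> mu = nu.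
Proof.
move=> /perm_graphP[x [x1 x2]] /perm_graphP[y [y1 y2]].
case: mu nu x1 x2 y1 y2 => [[[b e] f] a] [[[b' e'] f'] a'].
rewrite /lab1 /lab2 /lrng /lsrc /= => x1 x2 y1 y2 ee aa.
rewrite -ee -aa in y1 *; rewrite -(is_cons_det x1 y1) in y2.
by have [-> ->] := is_rcons_inj x2 y2.
Qed.

(** The path b f has a single preimage under [tau], which splits as e a in one way. *)
Lemma perm_graph_det2 mu nu : mu \in G -> nu \in G ->
  lab2 mu = lab2 nu -> lsrc mu = lsrc nu -> mu = nu.
Proof.
move=> /perm_graphP[x [x1 x2]] /perm_graphP[y [y1 y2]].
case: mu nu x1 x2 y1 y2 => [[[b e] f] a] [[[b' e'] f'] a'].
rewrite /lab1 /lab2 /lrng /lsrc /= => x1 x2 y1 y2 ff bb.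
rewrite -ff -bb in y2 *.
have /perm_inj xy := is_rcons_det x2 y2; rewrite -xy in y1.
by have [-> ->] := is_cons_inj x1 y1.
Qed.

Lemma perm_graph_valid_edge mu : endpoint_fixing tau -> mu \in G -> valid_edge mu.
Proof.
move=> /endpoint_fixingP tfix /perm_graphP[x [x1 x2]].
have [t1 t2] := tfix x; split.
- move: x1 x2 => /and3P[_ /eqP <- _] /and3P[_ /eqP <- _].
  exact: t1.
- by move: x1 => /and3P[/eqP].
- by move: x2 => /and3P[/eqP].
- by rewrite -(is_cons_prng x1) -t2 (is_rcons_prng x2).
Qed.

(** First labels determine an edge from its range, so the walk is built backwards from the
    prescribed end [a]; with second labels one walks forwards. *)
Lemma perm_graph_walk1 v s a : endpoint_fixing tau ->
  walk v s -> psrc a = last v (map rng s) ->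
  exists b p, [/\ psrc b = v, lwalk G b p, map lab1 p = s & lend b p = a].
Proof.
move=> tfix; elim: s v => [|e s IH] v /=; first by exists a, [::].
case/andP=> /eqP ev ws sa; have [b [p [be bp ps pa]]] := IH _ ws sa.
have [mu [muG mue mub]] := perm_graph_total1 be.
exists (lsrc mu), (mu :: p); split=> /=.
- by have [-> _ _ _] := perm_graph_valid_edge tfix muG; rewrite mue.
- by rewrite muG eqxx mub.
- by rewrite mue ps.
- by rewrite /lend /= mub.
Qed.

Lemma perm_graph_walk2 b s : endpoint_fixing tau -> walk (prng b) s ->
  exists p, lwalk G b p /\ map lab2 p = s.
Proof.
move=> tfix; elim: s b => [|f s IH] b /=; first by exists [::].
case/andP=> /eqP fb ws; have [mu [muG mub muf]] := perm_graph_total2 (esym fb).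
have [_ _ _ mur] := perm_graph_valid_edge tfix muG.
have [|p [mp ps]] := IH (lrng mu); first by rewrite mur muf.
by exists (mu :: p); rewrite /= muG mub eqxx mp muf ps.
Qed.

Lemma perm_graph_valid : endpoint_fixing tau -> synchronizes G -> valid G.
Proof.
move=> tfix Gs; split=> //.
- by move=> mu; exact: perm_graph_valid_edge.
- move=> e a _ mu nu muG nuG mua mue nua nue.
  by apply: perm_graph_det1 => //; congruence.
- move=> f b _ mu nu muG nuG mub muf nub nuf.
  by apply: perm_graph_det2 => //; congruence.
Qed.

End PermGraph.

(** * Automorphisms synchronize *)

(** Some state occurs at two positions i < j; the segment between them is traversed periodically. *)
Lemma long_path_infinite (T : finType) (r : rel T) (s : seq T) :
  sorted r s -> (#|T| < size s)%N ->
  exists w : nat -> T, (forall i, r (w i) (w i.+1)) /\ (forall i, w i \in s).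
Proof.
case: s => // x0 s0; set s := x0 :: s0 => rs sT.
have /(uniqPn x0)[i [j [ij js ijE]]] : ~~ uniq s.
  by apply: contraL sT => us; rewrite -leqNgt -(card_uniqP us) max_card.
have rP := sortedP x0 rs.
have d0 : (0 < j - i)%N by rewrite subn_gt0.
exists (fun k => nth x0 s (i + k %% (j - i))%N); split=> k.
  have := ltn_pmod k d0; rewrite leq_eqVlt => /predU1P[kd|kd].
    have -> : (k.+1 %% (j - i) = 0)%N by rewrite -addn1 -modnDml addn1 kd modnn.
    rewrite addn0 ijE; move: kd; set m := (k %% _)%N => kd.
    rewrite [X in r _ (nth _ _ X)](_ : j = (i + m).+1)%N; last by lia.
    by apply: rP; apply: leq_ltn_trans js; lia.
  have -> : (k.+1 %% (j - i) = (k %% (j - i)).+1)%N.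
    by rewrite -addn1 -modnDml addn1 modn_small.
  by rewrite addnS; move: kd; set m := (k %% _)%N => kd; apply: rP; apply: leq_ltn_trans js; lia.
by rewrite mem_nth//; have := ltn_pmod k d0; set m := (k %% _)%N => md; apply: leq_ltn_trans js; lia.
Qed.

Section InfiniteWalks.
Variables (E : digraph) (n : nat) (tau : {perm epath E n.+1}).
Hypothesis tfix : endpoint_fixing tau.
Local Notation G := (perm_graph tau : {set ledge E n}).

Definition infwalk (W : nat -> ledge E n) :=
  forall i, W i \in G /\ lrng (W i) = lsrc (W i.+1).

(** The infinite path b f_i f_(i+1) ..., where b is the source of the i-th edge and the f's are the
    second labels. Walks thereby become orbits of [lam_shift]. *)
Definition walk_point (W : nat -> ledge E n) i : nat -> edge E :=
  icat (pedges (lsrc (W i))) (fun j => lab2 (W (i + j)%N)).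

Section OneWalk.
Variable W : nat -> ledge E n.
Hypothesis Ww : infwalk W.

Let Wvalid i : valid_edge (W i).
Proof. by have [Wi _] := Ww i; exact: perm_graph_valid_edge. Qed.

Let labels_infpath i : infpath (fun j => lab2 (W (i + j)%N)).
Proof.
move=> j; have [_ _ _ <-] := Wvalid (i + j); have [_ ->] := Ww (i + j).
by rewrite addnS; have [] := Wvalid (i + j).+1.
Qed.

Let prng_lsrc i : prng (lsrc (W i)) = src (lab2 (W (i + 0)%N)).
Proof. by rewrite addn0; have [] := Wvalid i. Qed.

Lemma infpath_walk_point i : infpath (walk_point W i).
Proof. by apply: infpath_icat_epath; [exact: labels_infpath|exact: prng_lsrc]. Qed.

Lemma starts_walk_point i : starts (lsrc (W i)) (walk_point W i).
Proof. by apply: starts_icat; exact: prng_lsrc. Qed.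

Lemma ishiftn_walk_point i : ishiftn n (walk_point W i) = fun j => lab2 (W (i + j)%N).
Proof. exact: ishiftn_icat_epath. Qed.

(** The first n+1 edges form b f = tau(e a). Undoing [tau] leaves e, then a, which is the next
    source of the walk, then the remaining second labels. *)
Lemma perm_inf_walk_point i :
  perm_inf tau^-1%g (walk_point W i) = icons (lab1 (W i)) (walk_point W i.+1).
Proof.
have [WiG rW] := Ww i; have /perm_graphP[x [x1 y1]] := WiG.
have /andP[/eqP s1 /eqP s2] := starts_walk_point i.
have yst : starts (tau x) (walk_point W i).
  case/and3P: y1 => _ /eqP y1 /eqP y2.
  rewrite /starts y1 s1 eqxx y2 mkseqS s2 /=; apply/eqP; congr rcons.
  by rewrite -ishiftn0 ishiftn_walk_point addn0.
rewrite (perm_infE _ yst) permK; case/and3P: x1 => _ _ /eqP ->.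
rewrite rW /walk_point /=; congr icons; congr icat.
rewrite -ishift_ishiftn ishiftn_walk_point.
by apply/funext => j; rewrite /ishift addnS.
Qed.

Lemma lam_code_walk_point i : lam_code tau (walk_point W i) = lab1 (W i).
Proof. by rewrite /lam_code perm_inf_walk_point. Qed.

Lemma lam_shiftn_walk_point i : lam_shiftn tau i (walk_point W 0) = walk_point W i.
Proof.
elim: i => //= i ->; by rewrite /lam_shift perm_inf_walk_point ishift_cons.
Qed.

End OneWalk.

Lemma walk_point_inj W W' i : infwalk W -> infwalk W' ->
  walk_point W i = walk_point W' i -> lsrc (W i) = lsrc (W' i).
Proof.
move=> Ww Ww' ii; apply: (starts_inj (starts_walk_point Ww i)).
by rewrite ii; exact: starts_walk_point.
Qed.

Definition pair_step (s t : ledge E n * ledge E n) : bool :=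
  (lrng s.1 == lsrc t.1) && (lrng s.2 == lsrc t.2).

Definition pair_state (lab : ledge E n -> edge E) (s : ledge E n * ledge E n) :=
  [&& s.1 \in G, s.2 \in G, lab s.1 == lab s.2 & lsrc s.1 != lsrc s.2].

Lemma pair_state_infinite lab (s : seq (ledge E n * ledge E n)) :
  all (pair_state lab) s -> sorted pair_step s ->
  (#|{: ledge E n * ledge E n}| < size s)%N ->
  exists W W', [/\ infwalk W, infwalk W', forall i, lab (W i) = lab (W' i) &
                   forall i, lsrc (W i) != lsrc (W' i)].
Proof.
move=> /allP sP sr sz; have [w [wr ws]] := long_path_infinite sr sz.
exists (fun i => (w i).1), (fun i => (w i).2); split=> i.
- by have /and4P[? _ _ _] := sP _ (ws i); have /andP[/eqP ? _] := wr i.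
- by have /and4P[_ ? _ _] := sP _ (ws i); have /andP[_ /eqP ?] := wr i.
- by have /and4P[_ _ /eqP ? _] := sP _ (ws i).
- by have /and4P[_ _ _ ?] := sP _ (ws i).
Qed.

Lemma lwalk_zip b b' p p' : lwalk G b p -> lwalk G b' p' -> size p = size p' ->
  sorted pair_step (zip p p').
Proof.
elim: p p' b b' => [|mu p IH] [|nu p'] b b' //= /and3P[_ _ pw] /and3P[_ _ pw'] [sz].
have := IH _ _ _ pw pw' sz.
case: p p' pw pw' {IH sz} => [|mu' p] [|nu' p'] //= /and3P[_ /eqP mm _] /and3P[_ /eqP nn _] ->.
by rewrite /pair_step /= mm nn !eqxx.
Qed.

Lemma lwalk_det2 b p p' : lwalk G b p -> lwalk G b p' ->
  map lab2 p = map lab2 p' -> p = p'.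
Proof.
elim: p p' b => [|mu p IH] [|nu p'] b //=.
move=> /and3P[muG /eqP mub pw] /and3P[nuG /eqP nub pw'] [mn pp].
have mnE : mu = nu by exact: perm_graph_det2 muG nuG mn (etrans mub (esym nub)).
by rewrite -mnE in pw' *; rewrite (IH _ _ pw pw').
Qed.

(** Distinctness spreads forwards: equal ranges with equal first labels would force equal edges,
    hence equal sources. *)
Lemma lwalk_states1 b b' p p' : lwalk G b p -> lwalk G b' p' ->
  map lab1 p = map lab1 p' -> b != b' -> all (pair_state lab1) (zip p p').
Proof.
elim: p p' b b' => [|mu p IH] [|nu p'] b b' //=.
move=> /and3P[muG /eqP mub pw] /and3P[nuG /eqP nub pw'] [mn pp] bb.
have ss : lsrc mu != lsrc nu by rewrite mub nub.
apply/andP; split; first by apply/and4P; split; [| |exact/eqP|].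
apply: IH pw pw' pp _; apply: contraNneq bb => rr.
by rewrite -mub -nub (perm_graph_det1 muG nuG).
Qed.

(** Distinctness spreads backwards from the ends: once the sources agree, equal second labels make
    the rest of the two walks coincide. *)
Lemma lwalk_states2 b b' p p' : lwalk G b p -> lwalk G b' p' ->
  map lab2 p = map lab2 p' -> lend b p != lend b' p' ->
  all (pair_state lab2) (zip p p').
Proof.
elim: p p' b b' => [|mu p IH] [|nu p'] b b' //=.
move=> /and3P[muG /eqP mub pw] /and3P[nuG /eqP nub pw'] [mn pp] bb.
apply/andP; split; last exact: IH pw pw' pp bb.
apply/and4P; split; [| |exact/eqP|] => //.
apply: contraNneq bb => ss.
have mnE : mu = nu by exact: perm_graph_det2 muG nuG mn ss.
by rewrite -mnE in pw' *; rewrite (lwalk_det2 pw pw' pp) /lend /=.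
Qed.

Lemma automorphism_synchronizes (R : realType) (A : cstarAlgebra R)
    (P : vert E -> A) (S : edge E -> A) :
  no_sinks E -> is_graph_algebra P S -> lambda_automorphism P S tau ->
  synchronizes G.
Proof.
move=> nosink ga aut.
(* One more than the number of pairs of edges, so that two walks of this length read in parallel
   must repeat a pair. *)
exists #|{: ledge E n * ledge E n}|.+1; split=> b b' p p' pw pw' sp sp' pp.
  apply/eqP/negPn/negP => bb.
  have [||W [W' [Ww Ww' ll ss]]] := pair_state_infinite (lwalk_states1 pw pw' pp bb).
  - by apply: lwalk_zip pw pw' _; rewrite sp.
  - by rewrite size_zip sp sp' minnn.
  have /eqP := ss 0%N; apply; apply: walk_point_inj => //.
  apply: (same_code_eq nosink ga tfix aut); try exact: infpath_walk_point.
  by move=> i; rewrite !lam_shiftn_walk_point// !lam_code_walk_point.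
apply/eqP/negPn/negP => bb.
have spp : size p = size p' by rewrite -(size_map lab2) pp size_map.
have [||W [W' [Ww Ww' ll ss]]] := pair_state_infinite (lwalk_states2 pw pw' pp bb).
- exact: lwalk_zip pw pw' _.
- by rewrite size_zip -spp minnn.
(* Equal second labels make the two points agree after their first n edges; agreement of some
   [lam_shift] iterate then contradicts distinct sources at that index. *)
have [|i ii] := shift_eq_lam_shift_eq nosink ga tfix aut (m := n)
  (infpath_walk_point Ww 0) (infpath_walk_point Ww' 0).
- by rewrite !ishiftn_walk_point; apply/funext => j; exact: ll.
have /eqP := ss i; apply; apply: walk_point_inj => //.
by move: ii; rewrite !lam_shiftn_walk_point.
Qed.

End InfiniteWalks.

Lemma pedges_nil (E : digraph) (a : epath E 0) : pedges a = [::].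
Proof. by apply: size0nil; rewrite pedges_size. Qed.

Section PathElements.
Variables (R : realType) (E : digraph) (A : cstarAlgebra R).
Variables (P : vert E -> A) (S : edge E -> A).
Hypotheses (nosink : no_sinks E) (ck : ck_family P S).
Implicit Types (x y : A) (e f : edge E) (v : vert E).

Local Notation T := (path_elt P S).

Let PS := ckPS nosink ck.
Let SP := ckSP ck.

Lemma foldl_cmul x y (s : seq (edge E)) :
  foldl (fun x f => x ** S f) (x ** y) s = x ** foldl (fun x f => x ** S f) y s.
Proof. by elim: s y => //= e s IH y; rewrite -cmulA IH. Qed.

Lemma path_elt_cons l e (a : epath E l) (x : epath E l.+1) :
  is_cons e a x -> T x = S e ** T a.
Proof.
move=> /and3P[/eqP ae _ /eqP xe]; rewrite /path_elt xe.
by case: (pedges a) => [|f s] /=; rewrite ?foldl_cmul// ae SP eqxx.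
Qed.

Lemma path_elt_rcons l (b : epath E l) f (y : epath E l.+1) :
  is_rcons b f y -> T y = T b ** S f.
Proof.
move=> /and3P[/eqP fb _ /eqP ye]; rewrite /path_elt ye.
case Eb : (pedges b) => [|e s] /=; last by rewrite foldl_rcons.
by rewrite (_ : psrc b = src f) ?PS ?eqxx// fb /prng Eb.
Qed.

Lemma path_elt_nil (a : epath E 0) : T a = P (psrc a) /\ prng a = psrc a.
Proof.
by rewrite /path_elt /prng pedges_nil.
Qed.

Lemma cmul_P_path v l (a : epath E l) : P v ** T a = if v == psrc a then T a else 0.
Proof.
case: l a => [|l] a.
  by have [-> _] := path_elt_nil a; rewrite (ckPP ck); case: eqP => [->|].
have [e [b ax]] := is_cons_decomp a; rewrite (path_elt_cons ax) cmulA PS.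
case/and3P: ax => _ /eqP -> _; case: eqP => // _; exact: cmul0l.
Qed.

Lemma cmul_path_P v l (a : epath E l) : T a ** P v = if v == prng a then T a else 0.
Proof.
case: l a => [|l] a.
  by have [-> ->] := path_elt_nil a; rewrite (ckPP ck) eq_sym.
have [b [f ax]] := is_rcons_decomp a; rewrite (path_elt_rcons ax) -cmulA SP.
rewrite (is_rcons_prng ax); case: eqP => // _; exact: cmul0r.
Qed.

Lemma cmul_pathS_path l (a b : epath E l) :
  cstar (T a) ** T b = if a == b then P (prng a) else 0.
Proof.
elim: l a b => [|l IH] a b.
  have [-> ->] := path_elt_nil a; have [-> _] := path_elt_nil b.
  rewrite (cstar_ckP ck) (ckPP ck).
  suff -> : (a == b) = (psrc a == psrc b) by [].
  apply/eqP/eqP => [->//|ab]; apply: epath_eq => //.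
  by rewrite !pedges_nil.
have [e [a' aa]] := is_cons_decomp a; have [f [b' bb]] := is_cons_decomp b.
rewrite (path_elt_cons aa) (path_elt_cons bb) cstarM cmulA -(cmulA _ _ (S f)).
rewrite (ckSS ck); case: (e =P f) => [ef|ef]; last first.
  rewrite cmul0r cmul0l; case: eqP => // ab; case: ef.
  by rewrite ab in aa; have [] := is_cons_inj aa bb.
rewrite -cmulA cmul_P_path; case/and3P: (bb) => /eqP -> _ _.
rewrite ef eqxx IH (is_cons_prng aa); case: eqP => [ab|ab].
  by rewrite ef ab in aa; rewrite (is_cons_det aa bb) eqxx.
case: eqP => // abE; case: ab.
by rewrite abE in aa; have [] := is_cons_inj aa bb.
Qed.

(** Each P at the range of a path of length l is expanded by the summation relation, which appends
    one last edge. *)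
Lemma sum_path_range l : \sum_(a : epath E l) T a ** cstar (T a) = ga_unit P.
Proof.
elim: l => [|l IH].
  rewrite /ga_unit (partition_big (fun a : epath E 0 => psrc a) predT)//=.
  apply: eq_bigr => v _.
  have [a [av a0]] : exists a : epath E 0, psrc a = v /\ pedges a = [::].
    exact: epath_of_walk.
  rewrite (big_pred1 a) => [|b].
    by have [-> _] := path_elt_nil a; rewrite (cstar_ckP ck) (ckPP ck) eqxx av.
  apply/eqP/eqP => [bv|->//]; apply: epath_eq; first by rewrite bv.
  by rewrite a0 pedges_nil.
rewrite sum_is_rcons -IH; apply: eq_bigr => b _.
have <- : T b ** P (prng b) ** cstar (T b) = T b ** cstar (T b).
  by rewrite cmul_path_P eqxx.
rewrite (ck_sum ck) ?cmul_sumr ?cmul_suml; last exact: nosink.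
rewrite [RHS]big_mkcond; apply: eq_bigr => f _; case: eqP => bf; last first.
  by rewrite big_pred0// => y; apply/negP => /and3P[/eqP].
have [y yb] := is_rcons_exists bf.
rewrite (big_pred1 y); first by rewrite (path_elt_rcons yb) cstarM !cmulA.
by move=> z; apply/idP/eqP => [zb|->//]; exact: is_rcons_det zb yb.
Qed.

(** Unlike [path_elt], the empty word is the unit rather than a vertex projection, so labels along a
    walk multiply without tracking endpoints. *)
Definition word (s : seq (edge E)) : A := foldr (fun e x => S e ** x) (ga_unit P) s.

Lemma path_elt_word l (a : epath E l) : T a = P (psrc a) ** word (pedges a).
Proof.
elim: l a => [|l IH] a.
  have [-> _] := path_elt_nil a; rewrite pedges_nil.
  by rewrite /= (ga_unitPr ck).
have [e [a' ax]] := is_cons_decomp a; rewrite (path_elt_cons ax) IH.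
case/and3P: ax => /eqP -> /eqP -> /eqP -> /=.
by rewrite !cmulA PS SP !eqxx.
Qed.

End PathElements.

(** * The span of the S_x S_y^* with |x| = |y| *)

Section Core.
Variables (R : realType) (E : digraph) (A : cstarAlgebra R).
Variables (P : vert E -> A) (S : edge E -> A).
Hypotheses (nosink : no_sinks E) (ga : is_graph_algebra P S).
Implicit Types (x y : A) (e f : edge E) (v : vert E).

Local Notation T := (path_elt P S).
Local Notation "1" := (ga_unit P).
Let ck := ga_family ga.
Let mul1x := ga_unitl nosink ga.
Let mulx1 := ga_unitr nosink ga.

Definition vert_span : set A :=
  [set x | exists c : vert E -> R[i], x = \sum_v c v *: P v].

Lemma vert_span0 : vert_span 0.
Proof. by exists (fun=> 0); rewrite big1// => v _; rewrite scale0r. Qed.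

Lemma vert_spanD x y : vert_span x -> vert_span y -> vert_span (x + y).
Proof.
move=> [c ->] [d ->]; exists (fun v => c v + d v).
by rewrite -big_split; apply: eq_bigr => v _; rewrite scalerDl.
Qed.

Lemma vert_spanZ (a : R[i]) x : vert_span x -> vert_span (a *: x).
Proof.
move=> [c ->]; exists (fun v => a * c v).
by rewrite scaler_sumr; apply: eq_bigr => v _; rewrite scalerA.
Qed.

Lemma vert_span_sum I (r : seq I) (Q : pred I) (F : I -> A) :
  (forall i, Q i -> vert_span (F i)) -> vert_span (\sum_(i <- r | Q i) F i).
Proof. by move=> QF; elim/big_ind: _ => //; [exact: vert_span0|exact: vert_spanD]. Qed.

Lemma vert_spanP v : vert_span (P v).
Proof.
exists (fun w => (w == v)%:R); rewrite (bigD1 v)//= eqxx scale1r big1 ?addr0//.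
by move=> w /negPf ->; rewrite scale0r.
Qed.

Lemma vert_spanM x y : vert_span x -> vert_span y -> vert_span (x ** y).
Proof.
move=> xP [c ->]; rewrite cmul_sumr; apply: vert_span_sum => v _.
rewrite -cscaleAr; apply: vert_spanZ; move: xP => [d ->].
rewrite cmul_suml; apply: vert_span_sum => w _; rewrite -cscaleAl.
apply: vert_spanZ; rewrite (ckPP ck); case: eqP => _; last exact: vert_span0.
exact: vert_spanP.
Qed.

Lemma vert_spanS x : vert_span x -> vert_span (cstar x).
Proof.
move=> [c ->]; rewrite cstar_sum; apply: vert_span_sum => v _.
by rewrite cstarZ (cstar_ckP ck); apply/vert_spanZ/vert_spanP.
Qed.

Lemma vert_span_edges e f x : vert_span x -> vert_span (cstar (S e) ** x ** S f).
Proof.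
move=> [c ->]; rewrite cmul_sumr cmul_suml; apply: vert_span_sum => v _.
rewrite -cscaleAr -cscaleAl; apply: vert_spanZ.
rewrite -cmulA (ckPS nosink ck); case: eqP => _; last by rewrite cmul0r; exact: vert_span0.
rewrite (ckSS ck); case: eqP => _; last exact: vert_span0.
exact: vert_spanP.
Qed.

(* The span of the [S_x S_y^*] with [x] and [y] of length [N], described through
   its matrix coefficients. *)
Definition core N : set A :=
  [set x | forall a b : epath E N, vert_span (cstar (T a) ** x ** T b)].

Lemma coreS N x : core N x -> core N.+1 x.
Proof.
move=> xN a b; have [a' [e ax]] := is_rcons_decomp a.
have [b' [f bx]] := is_rcons_decomp b.
rewrite (path_elt_rcons nosink ck ax) (path_elt_rcons nosink ck bx) cstarM.
have -> : cstar (S e) ** cstar (T a') ** x ** (T b' ** S f)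
    = cstar (S e) ** (cstar (T a') ** x ** T b') ** S f by rewrite !cmulA.
by apply: vert_span_edges; exact: xN.
Qed.

Lemma core_leq N M x : (N <= M)%N -> core N x -> core M x.
Proof.
by move=> /subnK <-; elim: (M - N)%N => // d IH /IH; exact: coreS.
Qed.

Lemma coreD N x y : core N x -> core N y -> core N (x + y).
Proof. by move=> xN yN a b; rewrite cmulDr cmulDl; exact: vert_spanD. Qed.

Lemma coreZ N (c : R[i]) x : core N x -> core N (c *: x).
Proof. by move=> xN a b; rewrite -cscaleAr -cscaleAl; exact: vert_spanZ. Qed.

Lemma coreM N x y : core N x -> core N y -> core N (x ** y).
Proof.
move=> xN yN a b.
rewrite -(mulx1 x) -(sum_path_range nosink ck N) cmul_sumr cmul_suml.
rewrite cmul_sumr cmul_suml; apply: vert_span_sum => c _.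
have -> : cstar (T a) ** (x ** (T c ** cstar (T c)) ** y) ** T b
    = (cstar (T a) ** x ** T c) ** (cstar (T c) ** y ** T b) by rewrite !cmulA.
exact: vert_spanM.
Qed.

Lemma core_star N x : core N x -> core N (cstar x).
Proof.
move=> xN a b; have := vert_spanS (xN b a).
by rewrite !cstarM cstarK cmulA.
Qed.

Lemma coreP v : core 0 (P v).
Proof.
move=> a b; rewrite -cmulA (cmul_P_path nosink ck).
case: eqP => _; last by rewrite cmul0r; exact: vert_span0.
rewrite (cmul_pathS_path nosink ck); case: eqP => _; last exact: vert_span0.
exact: vert_spanP.
Qed.

Lemma core_edges N e f x : core N x -> core N.+1 (S e ** x ** cstar (S f)).
Proof.
move=> xN a b; have [g [a' ax]] := is_cons_decomp a.
have [h [b' bx]] := is_cons_decomp b.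
rewrite (path_elt_cons ck ax) (path_elt_cons ck bx) cstarM.
have -> : cstar (T a') ** cstar (S g) ** (S e ** x ** cstar (S f)) ** (S h ** T b')
    = cstar (T a') ** (cstar (S g) ** S e) ** x ** ((cstar (S f) ** S h) ** T b').
  by rewrite !cmulA.
rewrite !(ckSS ck); case: eqP => _; last by rewrite cmul0r !cmul0l; exact: vert_span0.
case: eqP => _; last by rewrite cmul0l !cmul0r; exact: vert_span0.
rewrite -(cstar_ckP ck (rng g)) -cstarM !(cmul_P_path nosink ck).
case: eqP => _; last by rewrite cstar0 !cmul0l; exact: vert_span0.
case: eqP => _; last by rewrite !cmul0r; exact: vert_span0.
exact: xN.
Qed.

Definition in_core : set A := [set x | exists N, core N x].

Lemma in_core2 x y : in_core x -> in_core y -> exists N, core N x /\ core N y.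
Proof.
move=> [N xN] [M yM]; exists (maxn N M); split.
  by apply: core_leq xN; exact: leq_maxl.
by apply: core_leq yM; exact: leq_maxr.
Qed.

Lemma in_coreD x y : in_core x -> in_core y -> in_core (x + y).
Proof.
by move=> xc yc; have [N [xN yN]] := in_core2 xc yc; exists N; exact: coreD.
Qed.

Lemma in_coreM x y : in_core x -> in_core y -> in_core (x ** y).
Proof.
by move=> xc yc; have [N [xN yN]] := in_core2 xc yc; exists N; exact: coreM.
Qed.

Lemma in_coreZ (c : R[i]) x : in_core x -> in_core (c *: x).
Proof. by move=> [N xN]; exists N; exact: coreZ. Qed.

Lemma in_coreB x y : in_core x -> in_core y -> in_core (x - y).
Proof. by move=> xc yc; apply: in_coreD => //; rewrite -scaleN1r; exact: in_coreZ. Qed.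

Lemma in_core_star x : in_core x -> in_core (cstar x).
Proof. by move=> [N xN]; exists N; exact: core_star. Qed.

Lemma in_coreP v : in_core (P v).
Proof. by exists 0%N; exact: coreP. Qed.

Lemma in_core_sum I (r : seq I) (Q : pred I) (F : I -> A) :
  (forall i, Q i -> in_core (F i)) -> in_core (\sum_(i <- r | Q i) F i).
Proof.
move=> QF; elim/big_ind: _ => //; last exact: in_coreD.
by exists 0%N => a b; rewrite cmul0r cmul0l; exact: vert_span0.
Qed.

Lemma in_core1 : in_core 1.
Proof. by apply: in_core_sum => v _; exact: in_coreP. Qed.

Lemma in_core_edges e f x : in_core x -> in_core (S e ** x ** cstar (S f)).
Proof. by move=> [N xN]; exists N.+1; exact: core_edges. Qed.

Lemma in_core_words (s t : seq (edge E)) x : size s = size t -> in_core x ->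
  in_core (word P S s ** x ** cstar (word P S t)).
Proof.
move=> st xc; elim: s t st => [|e s IH] [|f t] //= st.
  by have [us _] := ga_unit_projection ck; rewrite us mul1x mulx1.
have -> : S e ** word P S s ** x ** cstar (S f ** word P S t)
    = S e ** (word P S s ** x ** cstar (word P S t)) ** cstar (S f).
  by rewrite cstarM !cmulA.
by apply: in_core_edges; apply: IH; case: st.
Qed.

(** Each coefficient S_a^* x S_b is fixed by [g], being in the span of the P_v, while its image
    contains the factor g x = 0. All coefficients vanish, hence [x] does. *)
Lemma core_inj (g : A -> A) x : star_hom g -> (forall v, g (P v) = P v) ->
  in_core x -> g x = 0 -> x = 0.
Proof.
move=> gh gP [N xN] gx.
have fix_span y : vert_span y -> g y = y.
  move=> [c ->]; rewrite (star_hom_sum gh); apply: eq_bigr => v _.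
  by rewrite (star_homZ gh) gP.
rewrite -[x]mul1x -[1 ** x]mulx1 -(sum_path_range nosink ck N).
rewrite cmul_suml cmul_suml big1// => a _; rewrite cmul_sumr big1// => b _.
have -> : T a ** cstar (T a) ** x ** (T b ** cstar (T b))
    = T a ** (cstar (T a) ** x ** T b) ** cstar (T b) by rewrite !cmulA.
rewrite -(fix_span _ (xN a b)) !(star_homM gh) gx cmul0r cmul0l cmul0r.
exact: cmul0l.
Qed.

Lemma core_inj_eq (g : A -> A) x y : star_hom g -> (forall v, g (P v) = P v) ->
  in_core x -> in_core y -> g x = g y -> x = y.
Proof.
move=> gh gP xc yc gxy; apply/eqP; rewrite -subr_eq0; apply/eqP.
apply: (core_inj gh gP); first exact: in_coreB.
by rewrite (star_homB gh) gxy subrr.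
Qed.

Definition is_vunitary (u : A) :=
  [/\ cstar u ** u = 1, u ** cstar u = 1 & forall v, u ** P v = P v ** u].

(** The P_v and u S_e again form a Cuntz-Krieger family: unitarity preserves the initial projections
    and orthogonality, and u P_v u^* = P_v preserves the summation relation. *)
Lemma vunitary_endo (u : A) : is_vunitary u ->
  exists g : A -> A, [/\ star_hom g, forall v, g (P v) = P v &
    forall e, g (S e) = u ** S e].
Proof.
move=> [usu uus uP].
have PSS e : P (src e) ** (S e ** cstar (S e)) = S e ** cstar (S e).
  by rewrite cmulA (ckPS nosink ck) eqxx.
have uPu v : u ** P v ** cstar u = P v by rewrite uP -cmulA uus mulx1.
have SsS e : cstar (u ** S e) ** (u ** S e) = P (rng e).
  by rewrite cstarM cmulA -(cmulA (cstar (S e))) usu mulx1 (ckSS ck) eqxx.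
have range_proj e : is_projection (u ** S e ** cstar (u ** S e)).
  split; first by rewrite cstarM cstarK.
  rewrite -(cmulA (u ** S e)) (cmulA (cstar (u ** S e))) SsS (cmulA (u ** S e)).
  by rewrite -(cmulA u) (ckSP ck) eqxx.
apply: (ga_universal ga); split.
- exact: ck_proj ck.
- exact: ck_orth ck.
- move=> e; rewrite /is_partial_isometry -cmulA SsS -cmulA (ckSP ck).
  by rewrite eqxx.
- exact: SsS.
- move=> e f ef; rewrite cstarM cmulA -(cmulA (cstar (S e))) usu mulx1.
  by rewrite (ckSS ck) (negPf ef).
- move=> e; apply: projection_le => //; first exact: ck_proj ck _.
  by rewrite !cmulA -uP -(cmulA u) (ckPS nosink ck) eqxx.
- move=> v vE; rewrite -{1}(uPu v) (ck_sum ck)// cmul_sumr cmul_suml.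
  by apply: eq_bigr => e _; rewrite cstarM !cmulA.
Qed.

End Core.

(** * Synchronizing permutations give automorphisms *)

Section Sufficiency.
Variables (R : realType) (E : digraph) (n : nat) (A : cstarAlgebra R).
Variables (P : vert E -> A) (S : edge E -> A) (tau : {perm epath E n.+1}).
Hypotheses (nosink : no_sinks E) (ga : is_graph_algebra P S).
Hypotheses (tfix : endpoint_fixing tau).
Local Notation G := (perm_graph tau : {set ledge E n}).
Local Notation T := (path_elt P S).
Local Notation "1" := (ga_unit P).
Local Notation u := (U_perm P S tau).
Local Notation word := (word P S).
Let ck := ga_family ga.
Let mul1x := ga_unitl nosink ga.
Let mulx1 := ga_unitr nosink ga.
Let TT := cmul_pathS_path nosink ck.
Let PT := cmul_P_path nosink ck.
Let TP := cmul_path_P nosink ck.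
Let sumT := sum_path_range nosink ck.

Let core1 := in_core1 nosink ga.
Let core_vert := in_coreP nosink ga.
Let core_mul x y := @in_coreM R E A P S nosink ga x y.
Let core_sub x y := @in_coreB R E A P S nosink ga x y.
Let core_star' x := @in_core_star R E A P S ga x.
Let core_words := @in_core_words R E A P S nosink ga.
Let core_edges' := @in_core_edges R E A P S nosink ga.
Let core_sum := @in_core_sum R E A P S nosink ga.

Let tau_src a : psrc (tau a) = psrc a.
Proof. by have /endpoint_fixingP/(_ a)[] := tfix. Qed.

Let tau_rng a : prng (tau a) = prng a.
Proof. by have /endpoint_fixingP/(_ a)[] := tfix. Qed.

Lemma U_permT x : u ** T x = T (tau x).
Proof.
rewrite /U_perm cmul_suml (bigD1 x)//= big1 ?addr0 => [|a ax].
  by rewrite -cmulA TT eqxx -tau_rng TP eqxx.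
by rewrite -cmulA TT (negPf ax) cmul0r.
Qed.

Lemma U_perm_starT x : cstar u ** T (tau x) = T x.
Proof.
rewrite /U_perm cstar_sum cmul_suml (bigD1 x)//= big1 ?addr0 => [|a ax].
  by rewrite cstarM cstarK -cmulA TT eqxx tau_rng TP eqxx.
by rewrite cstarM cstarK -cmulA TT (inj_eq perm_inj) (negPf ax) cmul0r.
Qed.

(** Unitarity rests on [tau] preserving ranges, commutation with the P_v on its preserving
    sources. *)
Lemma U_perm_vunitary : is_vunitary P u.
Proof.
split.
- rewrite -[cstar u ** u]mulx1 -(sumT n.+1) cmul_sumr; apply: eq_bigr => x _.
  by rewrite cmulA -(cmulA (cstar u)) U_permT U_perm_starT.
- rewrite -[u ** cstar u]mulx1 -(sumT n.+1) cmul_sumr.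
  rewrite (reindex_inj (@perm_inj _ tau)) [RHS](reindex_inj (@perm_inj _ tau)).
  apply: eq_bigr => x _.
  by rewrite cmulA -(cmulA u) U_perm_starT U_permT.
- move=> v; rewrite /U_perm cmul_suml cmul_sumr; apply: eq_bigr => a _.
  rewrite -cmulA -{1}(cstar_ckP ck v) -cstarM cmulA !PT tau_src.
  by case: eqP => // _; rewrite cstar0 cmul0l cmul0r.
Qed.

Variable lam : A -> A.
Hypotheses (lamh : star_hom lam) (lamP : forall v, lam (P v) = P v).
Hypothesis lamS : forall e, lam (S e) = u ** S e.

Lemma lam1 : lam 1 = 1.
Proof. by rewrite (star_hom_sum lamh); apply: eq_bigr => v _; exact: lamP. Qed.

Lemma lam_edge mu : mu \in G ->
  lam (S (lab1 mu)) ** T (lrng mu) = T (lsrc mu) ** S (lab2 mu).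
Proof.
move=> /perm_graphP[x [x1 x2]].
by rewrite lamS -cmulA -(path_elt_cons ck x1) U_permT (path_elt_rcons nosink ck x2).
Qed.

Lemma lam_walk b p : lwalk G b p ->
  lam (word (map lab1 p)) ** T (lend b p) = T b ** word (map lab2 p).
Proof.
elim: p b => [|mu p IH] b /=; first by rewrite lam1 mul1x mulx1.
move=> /and3P[muG /eqP mub pw]; rewrite (star_homM lamh) -cmulA.
rewrite -[lend b (mu :: p)]/(lend (lrng mu) p) IH// cmulA lam_edge//.
by rewrite mub cmulA.
Qed.

Section Synchronizing.
Variable m : nat.
Hypothesis sync1 : forall b b' p p', lwalk G b p -> lwalk G b' p' ->
  size p = m -> size p' = m -> map lab1 p = map lab1 p' -> b = b'.
Hypothesis sync2 : forall b b' p p', lwalk G b p -> lwalk G b' p' ->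
  (m <= size p)%N -> (m <= size p')%N -> map lab2 p = map lab2 p' ->
  lend b p = lend b' p'.

(* By synchronization, all walks with first labels [h] start at the same vertex. *)
Lemma lam_path_source (a : epath E n) (h : epath E m) :
  T a ** cstar (T a) ** lam (T h) = lam (T h) \/ T a ** cstar (T a) ** lam (T h) = 0.
Proof.
have lamT (a' : epath E n) : psrc a' = prng h -> exists b p, [/\ lwalk G b p, size p = m,
    map lab1 p = pedges h & lam (T h) ** T a' = T b ** word (map lab2 p)].
  move=> ah; have [b [p [bh bp ps pa]]] := perm_graph_walk1 tfix (pedges_walk h) ah.
  exists b, p; split=> //; first by rewrite -(size_map lab1) ps pedges_size.
  rewrite (path_elt_word nosink ck) (star_homM lamh) lamP -ps -pa -cmulA lam_walk//.
  by rewrite cmulA PT bh eqxx.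
have lamT0 (a' : epath E n) : psrc a' <> prng h -> lam (T h) ** T a' = 0.
  move=> ah; have <- : T h ** P (prng h) = T h by rewrite TP eqxx.
  rewrite (star_homM lamh) lamP -cmulA PT; case: eqP => [hh|_]; last exact: cmul0r.
  by case: ah.
have expand x : x ** lam (T h) =
    \sum_(a' : epath E n) x ** (lam (T h) ** T a') ** cstar (T a').
  rewrite -[LHS]mulx1 -(sumT n) cmul_sumr; apply: eq_bigr => a' _.
  by rewrite !cmulA.
have [[a0 a0h]|na0] := pselect (exists a' : epath E n, psrc a' = prng h); last first.
  by right; rewrite expand big1// => a' _; rewrite lamT0 ?cmul0r ?cmul0l// => ah;
    apply: na0; exists a'.
have [b0 [p0 [bp0 sp0 lp0 _]]] := lamT _ a0h.
have lamTb (a' : epath E n) : lam (T h) ** T a' = T b0 ** cstar (T b0) ** (lam (T h) ** T a').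
  have [ah|ah] := pselect (psrc a' = prng h); last by rewrite lamT0// cmul0r.
  have [b [p [bp sp lp ->]]] := lamT _ ah.
  have -> : b = b0 by apply: sync1 bp bp0 sp sp0 _; rewrite lp lp0.
  by rewrite cmulA -(cmulA (T b0)) TT eqxx TP eqxx.
have [->|ab0] := eqVneq a b0.
  left; rewrite expand -[RHS]mul1x expand; apply: eq_bigr => a' _.
  by rewrite -lamTb mul1x.
right; rewrite expand big1// => a' _; rewrite lamTb !cmulA -(cmulA (T a)) TT.
by rewrite (negPf ab0) cmul0r !cmul0l.
Qed.

Lemma path_range_lam (a : epath E n) :
  exists q, in_core P S q /\ lam q = T a ** cstar (T a).
Proof.
exists (\sum_(h : epath E m | `[< T a ** cstar (T a) ** lam (T h) = lam (T h) >])
  T h ** cstar (T h)); split.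
  apply: core_sum => h _.
  have -> : T h ** cstar (T h) = P (psrc h) **
      (word (pedges h) ** 1 ** cstar (word (pedges h))) ** P (psrc h).
    by rewrite (path_elt_word nosink ck) cstarM (cstar_ckP ck) mulx1 !cmulA.
  apply: core_mul; last exact: core_vert.
  by apply: core_mul; [exact: core_vert|exact: core_words].
rewrite (star_hom_sum lamh) big_mkcond -[RHS]mulx1 -lam1 -(sumT m).
rewrite (star_hom_sum lamh) cmul_sumr; apply: eq_bigr => h _.
rewrite (star_homM lamh) cmulA; case: asboolP => [->//|nh].
by have [//|->] := lam_path_source a h; rewrite cmul0l.
Qed.

(** Insert the sum of the S_z S_z^* between the two factors. Along a walk whose second labels are
    the last edge of [g] followed by [z], S_g S_z becomes a lambda_tau-image times S_a, where a is
    the end of the walk; the same holds for [d], and the ends agree. *)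
Lemma path_pair_lam (g d : epath E n.+1) : prng g = prng d ->
  exists w, in_core P S w /\ lam w = T g ** cstar (T d).
Proof.
move=> gd.
have step (z : epath E m) : exists w, in_core P S w /\
    lam w = T g ** (T z ** cstar (T z)) ** cstar (T d).
  have -> : T g ** (T z ** cstar (T z)) ** cstar (T d) =
      (T g ** T z) ** cstar (T d ** T z) by rewrite cstarM !cmulA.
  have [zg|zg] := eqVneq (psrc z) (prng g); last first.
    exists 0; rewrite (star_hom0 lamh); split.
      by rewrite -(subrr 1); apply: core_sub; exact: core1.
    have -> : T g ** T z = 0; last by rewrite cmul0l.
    have <- : P (psrc z) ** T z = T z by rewrite PT eqxx.
    by rewrite cmulA TP (negPf zg) cmul0l.
  have walkT (x : epath E n.+1) : prng x = prng g -> exists mu p,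
      [/\ mu \in G, lwalk G (lrng mu) p, map lab2 p = pedges z &
        T x ** T z = lam (word (map lab1 (mu :: p))) ** T (lend (lrng mu) p)].
    move=> xg; have [b [f xbf]] := is_rcons_decomp x.
    have bf : prng b = src f by case/and3P: xbf => /eqP.
    have fz : rng f = psrc z by rewrite -(is_rcons_prng xbf) xg.
    have [|p [pw ps]] := @perm_graph_walk2 E n tau b (f :: pedges z) tfix.
      by rewrite /= bf eqxx fz pedges_walk.
    case: p pw ps => [//|mu p] /= /and3P[muG mub pw] [muf ps].
    exists mu, p; split=> //.
    have /lam_walk : lwalk G b (mu :: p) by rewrite /= muG mub pw.
    rewrite -[lend b _]/(lend (lrng mu) p) => ->.
    rewrite (path_elt_rcons nosink ck xbf) (path_elt_word nosink ck z) /= ps muf.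
    by rewrite -cmulA (cmulA (S f)) -fz (ckSP ck) eqxx.
  have [mu [p [muG pw pz ->]]] := walkT g erefl.
  have [nu [p' [nuG pw' pz' ->]]] := walkT d (esym gd).
  have sz : size p = m by rewrite -(size_map lab2) pz pedges_size.
  have sz' : size p' = m by rewrite -(size_map lab2) pz' pedges_size.
  (* The first edges [mu] and [nu] are split off because their second labels, the last edges of [g]
     and [d], may differ; the remaining [m] labels are those of [z] in both walks. *)
  have -> : lend (lrng nu) p' = lend (lrng mu) p.
    by apply: sync2 => //; rewrite ?sz ?sz' ?pz ?pz'.
  have [q [qc lq]] := path_range_lam (lend (lrng mu) p).
  exists (word (map lab1 (mu :: p)) ** q ** cstar (word (map lab1 (nu :: p')))); split.
    by apply: core_words => //; rewrite ?size_map /= ?size_map sz sz'.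
  by rewrite (star_homM lamh) (star_homM lamh _ q) (star_homS lamh) lq cstarM !cmulA.
have /choice[w wP] := step.
exists (\sum_z w z); split; first by apply: core_sum => z _; have [] := wP z.
rewrite (star_hom_sum lamh) -[in RHS](mulx1 (T g)) -(sumT m) cmul_sumr cmul_suml.
by apply: eq_bigr => z _; have [] := wP z.
Qed.

Lemma U_perm_star_lam : exists w, in_core P S w /\ lam w = cstar u.
Proof.
have /choice[w wP] : forall x, exists w, in_core P S w /\
    lam w = T x ** cstar (T (tau x)).
  by move=> x; apply: path_pair_lam; rewrite tau_rng.
exists (\sum_x w x); split; first by apply: core_sum => x _; have [] := wP x.
rewrite (star_hom_sum lamh) /U_perm cstar_sum; apply: eq_bigr => x _.
by rewrite cstarM cstarK; have [] := wP x.
Qed.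

(** With lam w = u^*, the endomorphism g given by g(S_e) = w S_e is a right inverse at once. It is a
    left inverse if g(u) w = 1, an equation that [lam] maps to u u^* = 1; injectivity on the core
    requires g(u) to be there. *)
Lemma lam_bijective : bijective lam.
Proof.
have [w [wc lw]] := U_perm_star_lam.
have [usu uus uP] := U_perm_vunitary.
have inj x y := @core_inj_eq R E A P S nosink ga lam x y lamh lamP.
have one_core := core1.
have ws := core_star' wc.
have vw : is_vunitary P w.
  split.
  - apply: inj => //; first exact: core_mul.
    by rewrite (star_homM lamh) (star_homS lamh) lw cstarK lam1.
  - apply: inj => //; first exact: core_mul.
    by rewrite (star_homM lamh) (star_homS lamh) lw cstarK lam1.
  - move=> v; apply: inj; try by apply: core_mul => //; exact: core_vert.
    rewrite !(star_homM lamh) lw lamP.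
    by rewrite -[P v]cstarK -!cstarM (cstar_ckP ck) uP.
have [g [gh gP gS]] := vunitary_endo nosink ga vw.
have comp_hom (f h : A -> A) : star_hom f -> star_hom h -> star_hom (f \o h).
  move=> fh hh; split=> [c x y|x y|x] /=.
  - by rewrite (star_hom_linear hh) (star_hom_linear fh).
  - by rewrite (star_homM hh) (star_homM fh).
  - by rewrite (star_homS hh) (star_homS fh).
have lamg x : lam (g x) = x.
  apply: (star_hom_eq nosink ga (f := lam \o g) (g := idfun)) => // [|e /=].
    exact: comp_hom.
  by rewrite gS (star_homM lamh) lw lamS cmulA usu mul1x.
have gT l (a b : epath E l) : in_core P S (g (T a ** cstar (T b))).
  elim: l a b => [|l IH] a b.
    have [-> _] := path_elt_nil P S a; have [-> _] := path_elt_nil P S b.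
    rewrite (star_homM gh) (star_homS gh) !gP (cstar_ckP ck).
    by apply: core_mul => //; exact: core_vert.
  have [e [a' ax]] := is_cons_decomp a; have [f [b' bx]] := is_cons_decomp b.
  rewrite (path_elt_cons ck ax) (path_elt_cons ck bx) cstarM.
  have -> : g (S e ** T a' ** (cstar (T b') ** cstar (S f))) =
      w ** (S e ** g (T a' ** cstar (T b')) ** cstar (S f)) ** cstar w.
    by rewrite !(star_homM gh) !(star_homS gh) !gS cstarM !cmulA.
  apply: core_mul => //; apply: core_mul => //.
  by apply: core_edges' => //; exact: IH.
have gu : in_core P S (g u).
  by rewrite (star_hom_sum gh); apply: core_sum => a _; exact: gT.
have guw : g u ** w = 1.
  apply: inj => //; first exact: core_mul.
  by rewrite (star_homM lamh) lamg lw uus lam1.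
exists g => // x.
apply: (star_hom_eq nosink ga (f := g \o lam) (g := idfun)) => // [|e /=].
  exact: comp_hom.
by rewrite lamS (star_homM gh) gS cmulA guw mul1x.
Qed.

End Synchronizing.
End Sufficiency.

(** * The recursion *)

Section ValidGraphs.
Context {E : digraph} {n : nat}.
Implicit Types (G H : {set ledge E n}) (a b : epath E n) (e f : edge E).

Lemma lwalk_sub G H b p : G \subset H -> lwalk G b p -> lwalk H b p.
Proof.
move=> /fintype.subsetP GH; elim: p b => //= mu p IH b /and3P[/GH -> -> /=].
exact: IH.
Qed.

(** Every clause of validity is universal in edges or walks; the same synchronization length serves
    the subgraph. *)
Lemma valid_sub G H : G \subset H -> valid H -> valid G.
Proof.
move=> GH [[m [H1 H2]] He H3 H4]; have GHs := fintype.subsetP GH; split.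
- exists m; split=> b b' p p' /(lwalk_sub GH) bp /(lwalk_sub GH) bp'.
    exact: H1.
  exact: H2.
- by move=> mu /GHs; exact: He.
- by move=> e a ae mu nu /GHs muH /GHs nuH; exact: H3.
- by move=> f b bf mu nu /GHs muH /GHs nuH; exact: H4.
Qed.

Lemma valid0 : valid (finset.set0 : {set ledge E n}).
Proof.
split.
(* Without edges there are no walks of length 1; length 0 would compare empty walks at different
   vertices. *)
- by exists 1%N; split=> b b' [|mu p] [|nu q] //=; rewrite inE.
- by move=> mu; rewrite inE.
- by move=> e a _ mu nu; rewrite inE.
- by move=> f b _ mu nu; rewrite inE.
Qed.

Definition covers H e a := exists mu, [/\ mu \in H, lab1 mu = e & lrng mu = a].

(** An invariant for the recursion: [pending] lists the slots (first label, range) still to be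
    filled. The last clause forbids edges of [H] outside [G] in any other slot. *)
Definition completes (pending : edge E -> epath E n -> Prop) G H :=
  [/\ valid H, G \subset H, forall e a, pending e a -> covers H e a &
      forall mu, mu \in H -> mu \in G \/ pending (lab1 mu) (lrng mu)].

(** The edge to add is the one that [H] has in the slot (e, a); clause (ii) makes it unique, so
    every other new edge lies in a remaining slot. *)
Lemma completes_step (pending pending' : edge E -> epath E n -> Prop) e a G H :
  psrc a = rng e ->
  (forall e' a', pending e' a' <-> pending' e' a' \/ (e' = e /\ a' = a)) ->
  completes pending G H <->
  exists2 mu, extensions e a G mu & completes pending' (mu |: G)%SET H.
Proof.
move=> ae pp; split.
  case=> vH GH cov new; have [|mu [muH mue mua]] := cov e a; first by apply/pp; right.
  have muGH : mu |: G \subset H by rewrite finset.subUset finset.sub1set muH.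
  exists mu; first by split=> //; exact: valid_sub vH.
  split=> // [e' a' pea|nu nuH]; first by apply: cov; apply/pp; left.
  have [nuG|/pp[?|[nue nua]]] := new _ nuH.
  - by left; rewrite !inE nuG orbT.
  - by right.
  - by left; rewrite (valid_lab1 vH ae nuH muH) ?finset.setU11.
case=> mu [mue mua vmu] [vH]; rewrite finset.subUset finset.sub1set => /andP[muH GH] cov new.
split=> // [e' a' /pp[|[-> ->]]|nu nuH]; [exact: cov|by exists mu|].
have [|pnu] := new _ nuH; last by right; apply/pp; left.
rewrite !inE => /predU1P[->|]; last by left.
by right; apply/pp; right.
Qed.

Lemma Phi0_recP (next : {set ledge E n} -> set {set ledge E n}) pending e s H :
  (forall a, a \in s -> psrc a = rng e) ->
  (forall G, valid G -> next G H <-> completes pending G H) ->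
  forall G, valid G -> Phi0_rec next e s G H <->
    completes (fun e' a' => pending e' a' \/ (e' = e /\ a' \in s)) G H.
Proof.
move=> + nextP; elim: s => [|a s IH] sP G vG /=.
  rewrite nextP//; split=> -[vH GH cov new]; split=> //.
  - by move=> e' a' [/cov//|[]].
  - by move=> mu /new[]; [left|right; left].
  - by move=> e' a' pea; apply: cov; left.
  - by move=> mu /new[|[|[]]//]; [left|right].
rewrite (completes_step (e := e) (a := a) (pending' := fun e' a' => pending e' a' \/ e' = e /\ a' \in s)).
- split=> -[mu muE /IH muH]; exists mu => //; case: muE => _ _ vmu; apply: muH => //;
    by move=> a' a's; apply: sP; rewrite inE a's orbT.
- by apply: sP; rewrite inE eqxx.
- move=> e' a'; rewrite inE; split.
    by case=> [|[-> /predU1P[->|]]]; [left; left|right|left; right].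
  by case=> [[|[-> a's]]|[-> ->]]; [left|right; rewrite a's orbT|right; rewrite eqxx].
Qed.

Lemma Phi1_recP (al : vert E -> seq (epath E n)) s G H : path_enumeration al -> valid G ->
  Phi1_rec al s G H <-> completes (fun e a => e \in s /\ psrc a = rng e) G H.
Proof.
move=> alP; elim: s G => [|e s IH] G vG /=.
  split=> [->|[vH GH cov new]]; first by split=> // [e a []//|mu]; left.
  by apply/eqP; rewrite finset.eqEsubset GH andbT; apply/fintype.subsetP => mu /new[|[]].
have alE a : a \in al (rng e) <-> psrc a = rng e.
  by have [_ ->] := alP (rng e); split=> /eqP.
rewrite (Phi0_recP (pending := fun e a => e \in s /\ psrc a = rng e))//; last first.
  by move=> a /alE.
have pE e' a : (e' \in e :: s /\ psrc a = rng e') <->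
    (e' \in s /\ psrc a = rng e') \/ (e' = e /\ a \in al (rng e)).
  rewrite inE alE; split=> [[/predU1P[->|]]|[[-> ->]|[-> ->]]]; rewrite ?eqxx ?orbT;
    by [right|left|].
split=> -[vH GH cov new]; split=> //.
- by move=> e' a /pE; exact: cov.
- by move=> mu /new[]; [left|move=> /pE; right].
- by move=> e' a /pE; exact: cov.
- by move=> mu /new[]; [left|move=> /pE; right].
Qed.

(** Once all slots are pending, the last clause of [completes] is automatic, since clause (i) places
    every edge of a valid graph in a slot. *)
Lemma Phi1P (es : seq (edge E)) (al : vert E -> seq (epath E n)) H :
  edge_enumeration es -> path_enumeration al ->
  Phi1 es al 0 finset.set0 H <->
  valid H /\ forall e a, psrc a = rng e -> covers H e a.
Proof.
move=> [_ esP] alP; rewrite /Phi1 drop0 Phi1_recP//; last exact: valid0.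
split=> [[vH _ cov _]|[vH cov]]; split=> //.
- by move=> e a ae; exact: cov.
- exact: finset.sub0set.
- by move=> e a [_]; exact: cov.
- by move=> mu muH; right; split=> //; have [] := valid_ends vH muH.
Qed.

(** The edge of [H] in slot (e, a) prescribes tau(e a) = b f. Clause (iii) makes this map injective,
    hence a permutation of a finite set, and clause (i) makes it preserve endpoints. *)
Lemma valid_perm_graph H : valid H ->
  (forall e a, psrc a = rng e -> covers H e a) ->
  exists2 tau : {perm epath E n.+1}, endpoint_fixing tau & H = perm_graph tau.
Proof.
move=> vH cov.
pose rel (x y : epath E n.+1) := exists mu, [/\ mu \in H,
  is_cons (lab1 mu) (lrng mu) x & is_rcons (lsrc mu) (lab2 mu) y].
have /choice[g gP] : forall x, exists y, rel x y.
  move=> x; have [e [a ax]] := is_cons_decomp x.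
  have [mu [muH mue mua]] : covers H e a by apply: cov; case/and3P: ax => /eqP.
  have [_ _ bf _] := valid_ends vH muH.
  have [y yb] := is_rcons_exists (esym bf).
  by exists y, mu; rewrite mue mua.
have det1 mu nu : mu \in H -> nu \in H -> lab1 mu = lab1 nu -> lrng mu = lrng nu -> mu = nu.
  move=> muH nuH ee aa; have [_ ae _ _] := valid_ends vH muH.
  by apply: (valid_lab1 vH ae).
have det2 mu nu : mu \in H -> nu \in H -> lab2 mu = lab2 nu -> lsrc mu = lsrc nu -> mu = nu.
  move=> muH nuH ff bb; have [_ _ bf _] := valid_ends vH muH.
  by apply: (valid_lab2 vH bf).
have ginj : injective g.
  move=> x x' gg; have [mu [muH x1 y1]] := gP x; have [nu [nuH x2 y2]] := gP x'.
  rewrite -gg in y2; have [bb ff] := is_rcons_inj y1 y2.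
  by rewrite -(det2 mu nu) // in x2; exact: is_cons_det x2.
exists (perm ginj).
  apply/endpoint_fixingP => x; rewrite permE.
  have [mu [muH x1 y1]] := gP x; have [m1 m2 m3 m4] := valid_ends vH muH.
  rewrite (is_cons_prng x1) (is_rcons_prng y1) m4; split=> //.
  move: x1 y1 => /and3P[_ /eqP -> _] /and3P[_ /eqP -> _].
  exact: m1.
apply/setP => mu; apply/idP/perm_graphP => [muH|[x [x1 y1]]].
  have [_ ae _ _] := valid_ends vH muH.
  have [x ax] := is_cons_exists ae; exists x; rewrite permE; split=> //.
  have [nu [nuH x2 y2]] := gP x; have [ee aa] := is_cons_inj ax x2.
  by rewrite (det1 mu nu).
have [nu [nuH x2 y2]] := gP x; have [ee aa] := is_cons_inj x1 x2.
rewrite permE in y1; have [bb ff] := is_rcons_inj y1 y2.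
suff -> : mu = nu by [].
case: mu nu ee aa bb ff {x1 y1 x2 y2 nuH} => [[[b e] f] a] [[[b' e'] f'] a'].
by rewrite /lab1 /lab2 /lrng /lsrc /= => -> -> -> ->.
Qed.

End ValidGraphs.

Lemma synchronizes_automorphism (R : realType) (E : digraph) (n : nat)
    (A : cstarAlgebra R) (P : vert E -> A) (S : edge E -> A)
    (tau : {perm epath E n.+1}) :
  no_sinks E -> is_graph_algebra P S -> endpoint_fixing tau ->
  synchronizes (perm_graph tau : {set ledge E n}) -> lambda_automorphism P S tau.
Proof.
move=> nosink ga tfix [m [sync1 sync2]].
have [lam [lamh lamP lamS]] := vunitary_endo nosink ga (U_perm_vunitary nosink ga tfix).
exists lam; first by split=> //; exact: (lam1 lamh lamP).
exact: (lam_bijective nosink ga tfix lamh lamP lamS sync1 sync2).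
Qed.

Local Close Scope ring_scope.
Local Close Scope classical_set_scope.

Theorem theorem4p4 (R : realType) (E : digraph) (k : nat)
    (A : cstarAlgebra R) (P : vert E -> A) (S : edge E -> A)
    (es : seq (edge E)) (al : vert E -> seq (epath E k.-1)) :
  no_sinks E -> no_sources E -> every_cycle_has_exit E ->
  (1 <= k)%N ->
  is_graph_algebra P S ->
  edge_enumeration es -> path_enumeration al ->
  Phi1 es al 0 finset.set0 =
    [set G | exists tau : {perm epath E k},
       [/\ endpoint_fixing tau, lambda_automorphism P S tau
         & G = perm_graph tau]]%classic.
Proof.
move=> nosink _ _; case: k es al => [//|n] es al _ ga esP alP.
apply/seteqP; split=> [H /(Phi1P _ esP alP)[vH cov]|_ [tau [tfix aut ->]]].
  have [tau tfix HE] := valid_perm_graph vH cov.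
  exists tau; split=> //; apply: synchronizes_automorphism => //.
  by rewrite -HE; exact: valid_sync vH.
apply/(Phi1P _ esP alP); split; last by move=> e a; exact: perm_graph_total1.
exact: perm_graph_valid tfix (automorphism_synchronizes tfix nosink ga aut).
Qed.
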